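(* Let $P=P(n,m)$ be a uniformly random planar graph on vertex set $[n]$ with $m$ edges, let $L$ be the largest component of $P$ and $S=P\setminus L$ the union of the other components. Assume $m=n/2+s$ with $s=s(n)>0$, $s=o(n)$ and $s^3n^{-2}\to\infty$. Let $r$ be a uniformly random vertex of $P$, $r_L$ a uniformly random vertex of $L$, and $r_S$ a uniformly random vertex of $S$ (in each case first sample $P$, then choose the vertex uniformly from the respective vertex set). Then, in the local weak sense, (i) $(L,r_L)\to \mathcal S$; (ii) $(S,r_S)\to T(1)$; (iii) $(P,r)\to T(1)$.
   Context: Local weak convergence of random rooted graphs $G_n\to G_0$: for every fixed finite rooted graph $(H,r_H)$ and every $\ell\in\mathbb N$, $\Pr[B_\ell(G_n)\cong(H,r_H)]\to\Pr[B_\ell(G_0)\cong(H,r_H)]$, where $B_\ell(H,r)$ is the subgraph induced on vertices at distance at most $\ell$ from the root, rooted at $r$, and $\cong$ is root-preserving isomorphism. $T(c)$ is the Galton–Watson tree with Poisson$(c)$ offspring. The Skeleton tree $\mathcal S$ is obtained by taking independent copies $T_1,T_2,\dots$ of $T(1)$ with roots $r_1,r_2,\dots$, adding the edges $r_1r_2,r_2r_3,\dots$, and rooting at $r_1$. *)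

(* Defs.v *)
From HB Require Import structures.
From mathcomp Require Import all_boot all_order all_algebra finmap.
From mathcomp Require Import all_classical all_reals all_analysis.
Set Implicit Arguments. Unset Strict Implicit. Unset Printing Implicit Defensive.
Import Order.TTheory GRing.Theory Num.Theory.
Import numFieldTopology.Exports.
Local Open Scope ring_scope.

Definition wf_graph n (E : {set {set 'I_n}}) : bool :=
  [forall e in E, #|e| == 2%N].

Definition adj n (E : {set {set 'I_n}}) : rel 'I_n :=
  fun x y => [set x; y] \in E.

Definition planar (R : realType) n (E : {set {set 'I_n}}) : Prop :=
  exists (p : 'I_n -> (R * R)%type) (gamma : 'I_n -> 'I_n -> R -> (R * R)%type),
    injective p /\
    (forall x y, adj E x y -> (x < y)%N ->
       [/\ ({within `[0, 1], continuous gamma x y})%classic,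
           {in `[0, 1] &, injective (gamma x y)},
           gamma x y 0 = p x, gamma x y 1 = p y &
           forall t z, t \in `]0, 1[ -> gamma x y t <> p z]) /\
    (forall x y x' y', adj E x y -> (x < y)%N -> adj E x' y' -> (x' < y')%N ->
       (x, y) <> (x', y') ->
       forall t t', t \in `]0, 1[ -> t' \in `]0, 1[ ->
         gamma x y t <> gamma x' y' t').

Definition planar_graphs (R : realType) n m : {set {set {set 'I_n}}} :=
  [set E | [&& wf_graph E, #|E| == m & `[< planar R E >] ]].

Definition comp n (E : {set {set 'I_n}}) (x : 'I_n) : {set 'I_n} :=
  [set y | connect (adj E) x y].

(* the largest component L (ties broken by the smallest vertex it      *)
(* contains, i.e. [pick] in the enumeration order of 'I_n); empty if n=0 *)
Definition largest_comp n (E : {set {set 'I_n}}) : {set 'I_n} :=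
  let M := (\max_(v : 'I_n) #|comp E v|)%N in
  match [pick v : 'I_n | #|comp E v| == M] with
  | Some v => comp E v
  | None => finset.set0
  end.

Definition small_comps n (E : {set {set 'I_n}}) : {set 'I_n} :=
  ~: largest_comp E.

Definition adj_in n (E : {set {set 'I_n}}) (U : {set 'I_n}) : rel 'I_n :=
  fun x y => [&& x \in U, y \in U & adj E x y].

Fixpoint reach n (E : {set {set 'I_n}}) (U : {set 'I_n}) (r : 'I_n) (k : nat)
  : {set 'I_n} :=
  match k with
  | 0 => [set r] :&: U
  | k'.+1 => let B := reach E U r k' in
             B :|: [set y | [exists x in B, adj_in E U x y]]
  end.

Definition ball_iso n (E : {set {set 'I_n}}) (U : {set 'I_n}) (r : 'I_n) (l : nat)
  (VH : finType) (eH : rel VH) (rH : VH) : Prop :=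
  let B := reach E U r l in
  exists f : 'I_n -> VH,
    [/\ {in B &, injective f}, f @: B = [set: VH], f r = rH &
        {in B &, forall x y, eH (f x) (f y) = adj_in E U x y}].

(* Pr[ B_l(G[U(P)], r) ~= (H,rH) ] where P ~ P(n,m) and r is uniform in *)
(* the vertex set U(P) (convention: contribution 0 if U(P) is empty, and *)
(* probability 0 if there is no planar graph with n vertices, m edges)   *)
Definition emp_prob (R : realType) n m (U : {set {set 'I_n}} -> {set 'I_n})
  (l : nat) (VH : finType) (eH : rel VH) (rH : VH) : R :=
  (#|planar_graphs R n m|%:R)^-1 *
  \sum_(E in planar_graphs R n m)
     (#|U E|%:R)^-1 *
     #|[set v in U E | `[< ball_iso E (U E) v l eH rH >] ]|%:R.

Local Open Scope classical_set_scope.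
Local Open Scope fset_scope.

(* finite Ulam--Harris (plane) trees: finite sets of addresses closed   *)
(* under taking parents and left siblings; the root is [::]             *)
Definition UHtree (A : {fset (seq nat)}) : Prop :=
  [::] \in A /\
  (forall u i, rcons u i \in A -> u \in A /\ (forall j, (j <= i)%N -> rcons u j \in A)).

Definition depth_le (A : {fset (seq nat)}) (l : nat) : Prop :=
  forall u, u \in A -> (size u <= l)%N.

Definition tchild (u v : seq nat) : bool :=
  (size v == (size u).+1) && (take (size u) v == u).

Definition tedge (u v : seq nat) : bool := tchild u v || tchild v u.

Definition nchildren (A : {fset (seq nat)}) (u : seq nat) : nat :=
  #|` [fset v in A | tchild u v]|.

(* probability that the depth-l truncation of a Galton--Watson tree with *)
(* Poisson(c) offspring (as a Ulam--Harris tree) equals A, for A of depth *)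
(* at most l: product of Poisson(c) probabilities of the offspring        *)
(* numbers of the vertices at depth < l                                  *)
Definition gw_weight (R : realType) (c : R) (l : nat) (A : {fset (seq nat)}) : R :=
  \prod_(u <- enum_fset A | (size u < l)%N) poisson_pmf c (nchildren A u).

Definition tree_iso (A : {fset (seq nat)}) (VH : finType) (eH : rel VH) (rH : VH)
  : Prop :=
  exists f : VH -> seq nat,
    [/\ injective f, forall x, f x \in A, forall u, u \in A -> exists x, f x = u,
        f rH = [::] & forall x y, eH x y = tedge (f x) (f y)].

Definition gw_ball_prob (R : realType) (c : R) (l : nat)
  (VH : finType) (eH : rel VH) (rH : VH) : \bar R :=
  \esum_(A in [set A | [/\ UHtree A, depth_le A l & tree_iso A eH rH]])
     (gw_weight c l A)%:E.

(* Skeleton tree: B_l(S) consists of the roots r_0, ..., r_l (0-indexed)  *)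
(* on a path, with the depth-(l-i) truncation of the i-th independent     *)
(* copy T_i of T(1) hanging from r_i.  Vertices are pairs (i, u).         *)
Definition skel_edge (a b : nat * seq nat) : bool :=
  ((a.1 == b.1) && tedge a.2 b.2) ||
  [&& a.2 == [::], b.2 == [::] & (b.1 == a.1.+1) || (a.1 == b.1.+1)].

Definition skel_iso (l : nat) (As : seq {fset (seq nat)})
  (VH : finType) (eH : rel VH) (rH : VH) : Prop :=
  exists f : VH -> (nat * seq nat)%type,
    [/\ injective f,
        forall x, ((f x).1 <= l)%N /\ (f x).2 \in nth fset0 As (f x).1,
        forall i u, (i <= l)%N -> u \in nth fset0 As i -> exists x, f x = (i, u),
        f rH = (0%N, [::]) & forall x y, eH x y = skel_edge (f x) (f y)].

Definition skel_ball_prob (R : realType) (l : nat)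
  (VH : finType) (eH : rel VH) (rH : VH) : \bar R :=
  \esum_(As in [set As : seq {fset (seq nat)} |
            [/\ size As = l.+1,
                forall i, (i <= l)%N -> UHtree (nth fset0 As i) /\
                                        depth_le (nth fset0 As i) (l - i) &
                skel_iso l As eH rH]])
     (\prod_(i < l.+1) gw_weight (1 : R) (l - i) (nth fset0 As i))%:E.

(* Main.v *)
(* Planarity enters only through two facts: forests are planar, and a planar graph stays planar when
   edges are removed or when a pendant edge is attached at an isolated vertex (a leaf can be drawn in
   a free direction near its neighbour).

   Since m = n/2 + o(n), the forests with m edges make up a proportion at least e^{-o(n)} of all
   sequences of m pairs.  In a uniform sequence of pairs the number of vertices with a prescribed
   depth-l neighbourhood, a Poisson(1) Galton-Watson tree in the limit, deviates from its mean with
   probability e^{-cn} (bounded differences), so the same statistics hold with high probability in P.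
   This is (iii).  As T(1) dies out, almost all vertices lie in bounded components, hence |L| = o(n)
   and (ii) follows; moreover |L| is unbounded and a positive proportion of the vertices is isolated.

   For (i), fix |L| = k and a spanning tree of L.  Trading j excess edges of L (edges outside the
   tree) for pendant edges at some of the linearly many isolated vertices bounds the probability of
   having j of them by binom(k^2, j) (C/n)^j, which is exponentially small in k for j >= dk, since
   k = o(n).  After deleting the excess edges, replacing the tree on L by another one preserves
   planarity, so the tree is uniform among the trees on L.  Rooted trees are maps L -> L, of which there are at least k^{k-1} among k^k, and
   in a uniform map the neighbourhood of a vertex x is a spine x, f(x), f(f(x)), ... carrying
   independent Poisson(1) Galton-Watson trees, with exponential concentration.  The few excess edges
   spoil few neighbourhoods.

   Only lower bounds on the counts are needed, because the limit weights sum to 1. *)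

Require Import Defs.
From HB Require Import structures.
From mathcomp Require Import all_boot all_fingroup finmap zify.
Set Implicit Arguments. Unset Strict Implicit. Unset Printing Implicit Defensive.
Local Close Scope group_scope.

(** Isomorphism types are replaced by plane trees whose siblings are ordered by increasing vertex
    number. A vertex then carries at most one copy of a given depth, copies can be counted exactly,
    and the product of the factorials of the offspring numbers, the price of the ordering, is the
    denominator of the Poisson weights. A copy of depth L fixes all neighbours of its vertices of
    depth below L and says nothing about edges among those of depth L. A ball of radius l is
    therefore read off a copy of depth l+1, and every plane tree of depth l is first extended by one
    generation, at almost no loss of mass.

    Nothing is known about the law of |L| except that it tends to infinity and is o(n), so (i) needs
    a union bound over all sizes k. The failure probability at size k decays exponentially in k, and
    the sum over k >= k1 is a geometric tail: this is where the unboundedness of |L| enters. Each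
    pendant edge uses up at most two isolated vertices; the graph classes between which edges are
    traded therefore carry a lower bound on their number. *)

Module Combinatorics.

(** * Graphs and forests *)

(** Turns a sum of cardinals into one cardinal, so that double counting becomes an injection for
    [card_leq_inj]. *)
Lemma sum_card_pairs (T U : finType) (A : {set T}) (B : T -> {set U}) :
  \sum_(x in A) #|B x| = #|[set q : T * U | (q.1 \in A) && (q.2 \in B q.1)]|.
Proof.
rewrite -sum1_card (eq_bigl (fun q : T * U => (q.1 \in A) && (q.2 \in B q.1))); last first.
  by move=> q; rewrite inE.
rewrite -(pair_big_dep (mem A) (fun x y => y \in B x) (fun _ _ => 1)) /=.
by apply: eq_bigr => x _; rewrite sum1_card.
Qed.

Lemma card_leq_inj (T U : finType) (f : T -> U) (A : {set T}) (B : {set U}) :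
  {in A &, injective f} -> (forall x, x \in A -> f x \in B) -> #|A| <= #|B|.
Proof.
move=> fi fB; rewrite -(card_in_imset fi); apply: subset_leq_card.
by apply/subsetP => _ /imsetP[x xA ->]; exact: fB.
Qed.

Lemma eq_set2 (T : finType) (a b x y : T) : [set a; b] = [set x; y] ->
  (a = x /\ b = y) \/ (a = y /\ b = x).
Proof.
move=> E; have ha : a \in [set x; y] by rewrite -E set21.
have hb : b \in [set x; y] by rewrite -E set22.
have hx : x \in [set a; b] by rewrite E set21.
have hy : y \in [set a; b] by rewrite E set22.
move: ha hb hx hy; rewrite !inE => /orP[]/eqP-> /orP[]/eqP->; rewrite ?orbb; auto.
  by move=> _ /eqP->; auto.
by move=> /eqP->; auto.
Qed.

Section Graph.
Variable n : nat.
Implicit Types (E F : {set {set 'I_n}}) (x y z a b v : 'I_n).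

Lemma adj_sym E : symmetric (adj E).
Proof. by move=> x y; rewrite /adj setUC. Qed.

Lemma adj_connect_sym E : connect_sym (adj E).
Proof. exact/sym_connect_sym/adj_sym. Qed.

Lemma adjS E F x y : E \subset F -> adj E x y -> adj F x y.
Proof. by move=> /subsetP; apply. Qed.

Lemma connect_adjS E F x y : E \subset F -> connect (adj E) x y -> connect (adj F) x y.
Proof. by move=> EF; apply: connect_sub => a b /(adjS EF); exact: connect1. Qed.

Lemma wf_adj_neq E x y : wf_graph E -> adj E x y -> x != y.
Proof. by move=> /forall_inP w /w; rewrite cards2; case: (x != y). Qed.

Lemma wf_edge E (e : {set 'I_n}) : wf_graph E -> e \in E -> exists x y, [/\ x != y, e = [set x; y] & adj E x y].
Proof.
move=> /forall_inP w eE; have := w e eE => /cards2P[x [y [xy ee]]].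
by exists x, y; rewrite /adj -ee.
Qed.

Lemma wf_graphS E F : F \subset E -> wf_graph E -> wf_graph F.
Proof. by move=> /subsetP s /forall_inP w; apply/forall_inP => e /s /w. Qed.

Lemma wf_graphU1 E x y : x != y -> wf_graph E -> wf_graph ([set x; y] |: E).
Proof.
move=> xy /forall_inP w; apply/forall_inP => e; rewrite in_setU1 => /orP[/eqP->|/w//].
by rewrite cards2 xy.
Qed.

Lemma adjU1 E x y a b : adj ([set x; y] |: E) a b ->
  [\/ adj E a b, a = x /\ b = y | a = y /\ b = x].
Proof.
rewrite /adj in_setU1 => /orP[/eqP/eq_set2[]|] *.
- by constructor 2.
- by constructor 3.
- by constructor 1.
Qed.

Lemma connect_adjU1 E x y a b : connect (adj ([set x; y] |: E)) a b ->
  [\/ connect (adj E) a b, connect (adj E) a x /\ connect (adj E) y b |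
      connect (adj E) a y /\ connect (adj E) x b].
Proof.
move=> /connectP[p]; elim: p a => [|c p IH] a /=.
  by move=> _ ->; constructor 1; exact: connect0.
move=> /andP[/adjU1 ac /IH{}IH] /IH{IH}.
have cs := adj_connect_sym E.
case: ac => [/connect1 ac|[-> ->]|[-> ->]] [h|[h1 h2]|[h1 h2]].
- by constructor 1; exact: connect_trans h.
- by constructor 2; split=> //; exact: connect_trans h1.
- by constructor 3; split=> //; exact: connect_trans h1.
- by constructor 2; split.
- by constructor 2; split.
- by constructor 1.
- by constructor 3; split.
- by constructor 1.
- by constructor 3; split.
Qed.

(** A simple path from [x] never returns to [x], hence never uses its first edge again. *)
Lemma connect_adj_first E x y : x != y -> connect (adj E) x y ->
  exists2 z, adj E x z & connect (adj (E :\ [set x; z])) z y.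
Proof.
move=> xy /connectP[p pp ey]; move: ey; case: (shortenP pp) => -[|z q] /=.
  by move=> _ _ _ e; rewrite e eqxx in xy.
move=> /andP[xz zq] /andP[xq uq] _ ->; exists z => //.
apply/connectP; exists q => //.
have : x \notin z :: q by [].
elim: q z zq {xz xq uq} (xz) => //= w q IH z /andP[zw wq] xz; rewrite !inE !negb_or.
move=> /and3P[nz nw nq]; apply/andP; split.
  rewrite /adj in_setD1 -/(adj E z w) zw andbT.
  by apply/eqP => /eq_set2[[e _]|[_ e]]; [rewrite e eqxx in nz|rewrite e eqxx in nw].
have sub r u : path (adj E) u r -> x \notin u :: r -> path (adj (E :\ [set x; z])) u r.
  elim: r u => //= t r IHr u /andP[ut tr]; rewrite !inE !negb_or => /and3P[xu xt xr].
  rewrite IHr// ?inE ?negb_or ?xt// andbT /adj in_setD1 -/(adj E u t) ut andbT.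
  by apply/eqP => /eq_set2[[e _]|[_ e]]; [rewrite e eqxx in xu|rewrite e eqxx in xt].
by apply: sub; rewrite // inE negb_or nw.
Qed.

(** Every edge is a bridge; this form needs no notion of cycle and is visibly inherited by
    subgraphs. *)
Definition acyclic E := [forall x, forall y, adj E x y ==> ~~ connect (adj (E :\ [set x; y])) x y].

Lemma acyclicP E : reflect (forall x y, adj E x y -> ~~ connect (adj (E :\ [set x; y])) x y) (acyclic E).
Proof.
apply: (iffP forallP) => [h x y xy|h x]; first by have /forallP/(_ y)/implyP := h x; apply.
by apply/forallP => y; apply/implyP; exact: h.
Qed.

Lemma acyclicS E F : F \subset E -> acyclic E -> acyclic F.
Proof.
move=> FE /acyclicP aE; apply/acyclicP => x y /(adjS FE)/aE; apply: contraNN.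
by apply: connect_adjS; exact: setSD.
Qed.

(** If an old edge [a b] stopped being a bridge, the detour would use the new edge, and [a b] would
    then connect [x] to [y] inside [E]. *)
Lemma acyclicU1 E x y : acyclic E -> ~~ connect (adj E) x y -> acyclic ([set x; y] |: E).
Proof.
move=> /acyclicP aE nxy; have cs := adj_connect_sym E.
have xyE : [set x; y] \notin E by apply: contraNN nxy => h; exact: connect1.
apply/acyclicP => a b /adjU1[ab|[-> ->]|[-> ->]]; last first.
- by rewrite [[set y; x]]setUC setU1K// cs.
- by rewrite setU1K.
have ne : [set x; y] != [set a; b] by apply: contraNneq xyE => ->.
have -> : ([set x; y] |: E) :\ [set a; b] = [set x; y] |: (E :\ [set a; b]).
  apply/setP => e; rewrite !inE; case: (eqVneq e [set x; y]) => [->|//].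
  by rewrite ne.
have sub : E :\ [set a; b] \subset E by exact: subsetDl.
apply/negP => /connect_adjU1[h|[h1 h2]|[h1 h2]].
- by have := aE a b ab; rewrite h.
- have ha := connect_adjS sub h1; have hb := connect_adjS sub h2.
  move: nxy; rewrite (connect_trans (_ : connect _ x a)) //; first by rewrite cs.
  by apply: connect_trans (connect1 ab) _; rewrite cs.
- have ha := connect_adjS sub h1; have hb := connect_adjS sub h2.
  move: nxy; rewrite cs (connect_trans (_ : connect _ y a)) //; first by rewrite cs.
  by apply: connect_trans (connect1 ab) _; rewrite cs.
Qed.

Lemma card_adj E : wf_graph E -> #|[set p : 'I_n * 'I_n | adj E p.1 p.2]| <= 2 * #|E|.
Proof.
move=> w; rewrite mulnC -sum_nat_const.
apply: (@leq_trans (\sum_(e in E) #|[set p : 'I_n * 'I_n | [set p.1; p.2] == e]|)).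
  rewrite sum_card_pairs.
  apply: (@card_leq_inj _ _ (fun p => ([set p.1; p.2], p))); first by move=> ? ? _ _ [].
  by move=> p; rewrite !inE eqxx andbT.
apply: leq_sum => e eE; have [x [y [xy -> _]]] := wf_edge w eE.
apply: (@leq_trans #|[set (x, y); (y, x)]|); last by rewrite cards2; case: eqP.
apply: subset_leq_card; apply/subsetP => -[a b]; rewrite !inE /=.
by move=> /eqP/eq_set2[[-> ->]|[-> ->]]; rewrite eqxx ?orbT.
Qed.

(** There are at least [n - #|E|] components, and [S] picks representatives. Putting an edge [x y]
    back merges at most two components, so it suffices to discard the representative connected to
    [x]. *)
Lemma disconnected_set E : wf_graph E ->
  exists2 S : {set 'I_n}, n <= #|S| + #|E| &
    {in S &, forall r r', connect (adj E) r r' -> r = r'}.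
Proof.
move: {2}#|E| (erefl #|E|) => k; elim: k E => [|k IH] E.
  move=> /cards0_eq -> _; exists setT; first by rewrite cardsT card_ord leq_addr.
  by move=> r r' _ _ /connectP[[|c p] //= /andP[]]; rewrite /adj inE.
move=> Ek w; have [e eE] : exists e, e \in E by apply/set0Pn; rewrite -card_gt0 Ek.
have [x [y [xy ee _]]] := wf_edge w eE.
have k' : #|E :\ e| = k by apply/eqP; rewrite -eqSS -Ek (cardsD1 e E) eE.
have [S hS hc] := IH _ k' (wf_graphS (subsetDl _ _) w).
have eqE : E = [set x; y] |: (E :\ e) by rewrite -ee setD1K.
set F := E :\ e in k' hS hc eqE; have cs := adj_connect_sym F.
pose T := [set r in S | ~~ connect (adj F) r x].
exists T.
  have : #|S :\: T| <= 1.
    apply/card_le1_eqP => r r'; rewrite !inE !negb_and !negbK.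
    move=> /andP[rx rS] /andP[rx' rS']; rewrite rS /= in rx; rewrite rS' /= in rx'.
    by apply: hc => //; apply: connect_trans rx' _; rewrite cs.
  have := cardsID T S; rewrite (setIidPr _); last by apply/subsetP => r; rewrite inE => /andP[].
  by move: hS; rewrite Ek k'; lia.
move=> r r'; rewrite !inE => /andP[rS rx] /andP[rS' rx']; rewrite eqE.
move=> /connect_adjU1[h|[h _]|[h1 h2]]; first exact: hc.
  by rewrite h in rx.
by rewrite cs h2 in rx'.
Qed.

(** * Graph properties closed under attaching a pendant edge at an isolated vertex *)

Section LeafClosed.
Variable P : {set {set 'I_n}} -> bool.
Hypothesis P0 : P set0.
Hypothesis Pleaf : forall E x v, P E -> x != v -> (forall y, ~~ adj E v y) -> P ([set x; v] |: E).

Lemma acyclic_leaf_closed E : wf_graph E -> acyclic E -> P E.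
Proof.
move=> w /acyclicP aE; pose EW (W : {set 'I_n}) := [set e in E | e \subset W].
have cs := adj_connect_sym E.
have EWS W : EW W \subset E by apply/subsetP => e; rewrite inE => /andP[].
have EWmono W x : EW W \subset EW (x |: W).
  by apply/subsetP => e; rewrite !inE => /andP[-> h]; apply: subset_trans h (subsetUr _ _).
(* The forest is built vertex by vertex. [W] holds the vertices placed so far, and the invariant
   says that vertices of [W] in one component of [E] are already joined inside [W]. *)
suff H k W : #|~: W| = k -> P (EW W) ->
    {in W &, forall a b, connect (adj E) a b -> connect (adj (EW W)) a b} -> P E.
  apply: (H _ set0 erefl) => [|a]; last by rewrite inE.
  suff -> : EW set0 = set0 by [].
  apply/setP => e; rewrite !inE; apply/negbTE; rewrite negb_and; apply/orP.
  case: (boolP (e \in E)) => [eE|]; [right|by left].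
  by rewrite subset0 -card_gt0; have /forall_inP/(_ e eE)/eqP-> := w.
elim: k W => [|k IH] W.
  move=> /cards0_eq W0; have -> : W = setT by rewrite -[W]setCK W0 setC0.
  suff -> : EW setT = E by [].
  by apply/setP => e; rewrite !inE subsetT andbT.
move=> Wk PW hW; have [x0 x0W] : exists x, x \in ~: W by apply/set0Pn; rewrite -card_gt0 Wk.
have step x : x \notin W -> #|~: (x |: W)| = k.
  move=> xW; apply/eqP; rewrite -eqSS -Wk (cardsD1 x (~: W)) inE xW add1n eqSS; apply/eqP.
  by congr #|pred_of_set _|; apply/setP => z; rewrite !inE negb_or.
have [/existsP[x /andP[xW /existsP[a /andP[aW xa]]]]|] :=
    boolP [exists x, (x \notin W) && [exists a, (a \in W) && adj E x a]].
  (* Two neighbours of [x] in [W] would be joined inside [W], and the edge to one of them would not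
     be a bridge. So [x] enters as a leaf. *)
  have uniqa b : b \in W -> adj E x b -> b = a.
    move=> bW xb; apply/eqP; apply: contraT => ba.
    have ab : connect (adj E) a b by apply: connect_trans (connect1 xb); rewrite cs; exact: connect1.
    have := aE x b xb; rewrite (connect_trans (y := a))//.
      apply: connect1; rewrite /adj in_setD1 -/(adj E x a) xa andbT.
      by apply/eqP => /eq_set2[[_ e]|[e1 _]]; [rewrite e eqxx in ba|rewrite e1 bW in xW].
    apply: connect_adjS (hW a b aW bW ab); apply/subsetP => e; rewrite !inE => /andP[-> eW].
    rewrite andbT; apply/eqP => ee; move: xW; rewrite (subsetP eW)// ee !inE eqxx//.
  have ax : a != x by apply: contraNneq xW => <-.
  have eqW : EW (x |: W) = [set a; x] |: EW W.
    apply/setP => e; rewrite in_setU1; apply/idP/orP => [|[/eqP ->|]].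
    - rewrite inE => /andP[eE eW]; have [u [v [uv ee ad]]] := wf_edge w eE.
      have uW : u \in x |: W by apply: (subsetP eW); rewrite ee !inE eqxx.
      have vW : v \in x |: W by apply: (subsetP eW); rewrite ee !inE eqxx orbT.
      move: uW vW; rewrite !in_setU1 => /orP[/eqP ux|uW] /orP[/eqP vx|vW].
      + by rewrite ux vx eqxx in uv.
      + by left; rewrite ee ux (uniqa v)// -?ux// setUC.
      + by left; rewrite ee vx (uniqa u)// -vx adj_sym.
      + by right; rewrite inE eE ee; apply/subsetP => t; rewrite !inE => /orP[] /eqP ->.
    - rewrite inE; apply/andP; split; first by rewrite setUC.
      by apply/subsetP => t; rewrite !inE => /orP[] /eqP ->; rewrite ?eqxx ?aW ?orbT.
    - exact: (subsetP (EWmono W x)).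
  apply: (IH (x |: W)); first exact: step.
    rewrite eqW; apply: Pleaf => // y; rewrite /adj inE; apply/negP => /andP[_ /subsetP/(_ x)].
    by rewrite !inE eqxx => /(_ isT); rewrite (negbTE xW).
  have cs' := adj_connect_sym (EW (x |: W)).
  have xa' : connect (adj (EW (x |: W))) x a by apply: connect1; rewrite eqW /adj setUC setU11.
  have key b : b \in W -> connect (adj E) x b -> connect (adj (EW (x |: W))) x b.
    move=> bW xb; apply: connect_trans xa' _; apply: connect_adjS (EWmono W x) _.
    by apply: hW => //; apply: connect_trans xb; rewrite cs; exact: connect1.
  move=> u v; rewrite !in_setU1 => /orP[/eqP ->|uW] /orP[/eqP ->|vW] uv.
  - exact: connect0.
  - exact: key.
  - by rewrite cs'; apply: key => //; rewrite cs.
  - exact: connect_adjS (EWmono W x) (hW u v uW vW uv).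
(* No edge leaves [W], so [W] is a union of components, and [x0] enters without bringing any
   edge. *)
rewrite negb_exists => /forallP nadj; rewrite inE in x0W.
have nad x a : x \notin W -> a \in W -> ~~ adj E x a.
  move=> xW aW; have := nadj x; rewrite xW /= negb_exists => /forallP/(_ a).
  by rewrite aW.
have clW : closed (adj E) W.
  move=> u v uv; case uW: (u \in W); case vW: (v \in W) => //.
    by have := nad v u (negbT vW) uW; rewrite adj_sym uv.
  by have := nad u v (negbT uW) vW; rewrite uv.
have ncon b : b \in W -> connect (adj E) x0 b -> False.
  by move=> bW /(closed_connect clW); rewrite bW (negbTE x0W).
have eqW : EW (x0 |: W) = EW W.
  apply/eqP; rewrite eqEsubset EWmono andbT; apply/subsetP => e; rewrite !inE => /andP[eE eW].
  rewrite eE; have [u [v [uv ee ad]]] := wf_edge w eE.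
  have uW : u \in x0 |: W by apply: (subsetP eW); rewrite ee !inE eqxx.
  have vW : v \in x0 |: W by apply: (subsetP eW); rewrite ee !inE eqxx orbT.
  move: uW vW; rewrite !in_setU1 => /orP[/eqP ux|uW] /orP[/eqP vx|vW].
  + by rewrite ux vx eqxx in uv.
  + by have := nad x0 v x0W vW; rewrite -ux ad.
  + by have := nad x0 u x0W uW; rewrite -vx adj_sym ad.
  + by rewrite ee; apply/subsetP => t; rewrite !inE => /orP[] /eqP ->.
apply: (IH (x0 |: W)); rewrite ?eqW//; first exact: step.
move=> u v; rewrite !in_setU1 => /orP[/eqP ->|uW] /orP[/eqP ->|vW] uv.
- exact: connect0.
- by case: (ncon v vW uv).
- by case: (ncon u uW); rewrite cs.
- exact: hW.
Qed.

Definition isolated E := [set v | [forall y, ~~ adj E v y]].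

Lemma isolatedP E v : reflect (forall y, ~~ adj E v y) (v \in isolated E).
Proof. by rewrite inE; exact: forallP. Qed.

(** The bound on the isolated vertices guarantees a supply of places for later pendant edges. *)
Definition graph_class i k := [set E | [&& P E, wf_graph E, #|E| == i & k <= #|isolated E|]].

(* Double counting of the pendant edges that can be attached at isolated vertices. *)
Lemma graph_class_step i k :
  #|graph_class i k.+2| * (k * n.-1) <= 2 * i.+1 * #|graph_class i.+1 k|.
Proof.
pose B E := [set p : 'I_n * 'I_n | (p.1 \in isolated E) && (p.2 != p.1)].
have cB E : #|B E| = #|isolated E| * n.-1.
  have -> : B E = [set p : 'I_n * 'I_n | (p.1 \in isolated E) && (p.2 \in [set~ p.1])].
    by apply/setP => p; rewrite !inE.
  rewrite -(sum_card_pairs (isolated E) (fun x => [set~ x])) -sum_nat_const; apply: eq_bigr => x _.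
  by rewrite cardsC1 card_ord.
apply: (@leq_trans (\sum_(E in graph_class i k.+2) #|B E|)).
  rewrite -sum_nat_const; apply: leq_sum => E; rewrite inE => /and4P[_ _ _ h].
  by rewrite cB leq_mul2r; apply/orP; right; apply: leq_trans h; lia.
pose A E := [set p : 'I_n * 'I_n | adj E p.1 p.2].
apply: (@leq_trans (\sum_(E in graph_class i.+1 k) #|A E|)); last first.
  rewrite mulnC -sum_nat_const; apply: leq_sum => E; rewrite inE => /and4P[_ w /eqP c _].
  by apply: leq_trans (card_adj w) _; rewrite c.
rewrite !sum_card_pairs.
apply: (@card_leq_inj _ _ (fun q => ([set q.2.2; q.2.1] |: q.1, q.2))) => [[E [w t]] [E' [w' t']]|[E [w t]]] /=; last first.
  rewrite [in X in X -> _]inE /= => /andP[]; rewrite inE => /and4P[PE wE /eqP c iE]; rewrite inE /= => /andP[/isolatedP iw tw].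
  have nE : [set t; w] \notin E by have := iw t; rewrite adj_sym.
  rewrite inE /=; apply/andP; split; last by rewrite inE /adj /= [X in X \in _]setUC setU11.
  rewrite inE Pleaf//= wf_graphU1//= cardsU1 nE c add1n eqxx /=.
  apply: (@leq_trans #|isolated E :\: [set t; w]|).
    have le2 : #|isolated E :&: [set t; w]| <= 2.
      by apply: leq_trans (subset_leq_card (subsetIr _ _)) _; rewrite cards2; case: (t != w).
    move: iE; rewrite -(cardsID [set t; w] (isolated E)) => iE.
    by rewrite -(leq_add2l 2) (leq_trans iE)// leq_add2r.
  apply: subset_leq_card; apply/subsetP => v; rewrite 2!inE negb_or in_set1.
  move=> /andP[/andP[vt vw] /isolatedP iv]; apply/isolatedP => y; apply/negP => /adjU1[h|[e _]|[e _]].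
  - by have := iv y; rewrite h.
  - by rewrite e eqxx in vt.
  - by rewrite e inE eqxx in vw.
rewrite !inE /= => /andP[_ /andP[/forallP iw tw]] /andP[_ /andP[/forallP iw' tw']] [e ew et].
subst w' t'; rewrite -[E](setU1K (_ : [set t; w] \notin E)) ?e ?setU1K//.
- by have := iw' t; rewrite adj_sym.
- by have := iw t; rewrite adj_sym.
Qed.

End LeafClosed.

Definition forests j := [set E | [&& wf_graph E, #|E| == j & acyclic E]].
Definition connected_pairs E := [set p : 'I_n * 'I_n | connect (adj E) p.1 p.2].

Lemma forests0 : #|forests 0| = 1.
Proof.
rewrite -(cards1 (set0 : {set {set 'I_n}})); congr #|pred_of_set _|.
apply/setP => E; rewrite !inE cards_eq0; case: eqP => [->|_]; last by rewrite andbF.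
rewrite /= andbC; apply/andP; split; last by apply/forall_inP => e; rewrite inE.
by apply/acyclicP => x y; rewrite /adj inE.
Qed.

(** Joining two components gives a forest again, and a forest with [j.+1] edges arises from at most
    [2 * j.+1] ordered pairs. *)
Lemma forests_disconnected j :
  \sum_(E in forests j) #|~: connected_pairs E| <= 2 * j.+1 * #|forests j.+1|.
Proof.
pose A E := [set p : 'I_n * 'I_n | adj E p.1 p.2].
apply: (@leq_trans (\sum_(E in forests j.+1) #|A E|)); last first.
  rewrite mulnC -sum_nat_const; apply: leq_sum => E; rewrite inE => /and3P[w /eqP c _].
  by apply: leq_trans (card_adj w) _; rewrite c.
rewrite !sum_card_pairs.
have notin E x y : ~~ connect (adj E) x y -> [set x; y] \notin E.
  by apply: contraNN => h; exact: connect1.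
apply: (@card_leq_inj _ _ (fun q => ([set q.2.1; q.2.2] |: q.1, q.2))) => [[E [x y]] [E' [x' y']]|[E [x y]]] /=.
  rewrite !inE /= => /andP[_ h] /andP[_ h'] [e ex ey]; subst x' y'.
  by rewrite -[E](setU1K (notin _ _ _ h)) e setU1K// notin.
rewrite !inE /= => /andP[/and3P[w /eqP c a] h]; rewrite /adj setU11 andbT.
rewrite wf_graphU1//=; last by apply: contraNneq h => ->; exact: connect0.
by rewrite cardsU1 notin// c eqxx acyclicU1.
Qed.

(** For connected [x != y], delete the first edge [x z] of a path to [y]. Then [z] and [y] stay
    connected, and [x], the smaller forest and [(z, y)] recover the data. Diagonal pairs give the
    first term. This is a recursion for the mean number of connected pairs. *)
Lemma forests_connected j :
  \sum_(E in forests j.+1) #|connected_pairs E| <=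
  n * #|forests j.+1| + n * \sum_(E in forests j) #|connected_pairs E|.
Proof.
have diag E : #|[set p : 'I_n * 'I_n | p.1 == p.2]| = n.
  rewrite -[RHS]card_ord -cardsT -(card_imset _ (_ : injective (fun x : 'I_n => (x, x)))).
    congr #|pred_of_set _|; apply/setP => -[x y]; rewrite inE /=.
    apply/eqP/imsetP => [->|[z _ [-> ->]]//]; by exists y; rewrite ?inE.
  by move=> x y [].
pose C E := [set p in connected_pairs E | p.1 != p.2].
apply: (@leq_trans (\sum_(E in forests j.+1) (n + #|C E|))).
  apply: leq_sum => E _.
  rewrite -[X in X + _](diag E); apply: leq_trans (leq_card_setU _ _).
  by apply: subset_leq_card; apply/subsetP => p; rewrite !inE => ->; case: eqP.
rewrite big_split /= sum_nat_const mulnC leq_add2l.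
rewrite [X in n * X]sum_card_pairs.
rewrite sum_card_pairs -[n in n * _]card_ord -cardsT -cardsX.
have ex (q : {set {set 'I_n}} * ('I_n * 'I_n)) : exists z, (q.2.2 != q.2.1) && connect (adj q.1) q.2.1 q.2.2 ->
    adj q.1 q.2.1 z && connect (adj (q.1 :\ [set q.2.1; z])) z q.2.2.
  have [/andP[h1 h2]|_] := boolP ((q.2.2 != q.2.1) && connect (adj q.1) q.2.1 q.2.2); last by exists q.2.1.
  rewrite eq_sym in h1; have [z a b] := connect_adj_first h1 h2.
  by exists z; rewrite a.
have /fin_all_exists[f hf] : forall q : {set {set 'I_n}} * ('I_n * 'I_n), exists z, (q.2.2 != q.2.1) && connect (adj q.1) q.2.1 q.2.2 ->
    adj q.1 q.2.1 z && connect (adj (q.1 :\ [set q.2.1; z])) z q.2.2 by exact: ex.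
apply: (@card_leq_inj _ _ (fun q => (q.2.1, (q.1 :\ [set q.2.1; f q], (f q, q.2.2))))).
  move=> [E [x y]] [E' [x' y']]; rewrite !inE /= => /and3P[_ h1 h2] /and3P[_ h1' h2'] [ex' eE ef ey].
  subst x' y'; have := hf (E, (x, y)); have := hf (E', (x, y)).
  rewrite /= h1 h1' eq_sym h2 /= => /(_ isT)/andP[a1 _] /(_ isT)/andP[a2 _].
  rewrite -(setD1K a2) -(setD1K a1); congr (_, _).
  by rewrite ef in eE *; rewrite eE.
move=> [E [x y]]; rewrite !inE /= => /and3P[/and3P[w /eqP c a] h1 h2].
have := hf (E, (x, y)); rewrite /= h1 eq_sym h2 => /(_ isT)/andP[xz zy].
rewrite zy andbT (wf_graphS (subsetDl _ _) w) (acyclicS (subsetDl _ _) a) andbT /=.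
by rewrite -eqSS -c (cardsD1 [set x; f (E, (x, y))] E) -/(adj E x _) xz.
Qed.

(** A cruder count of disconnected pairs, one for each ordered pair of component representatives. It
    remains available near [j = n / 2], where the recursion for connected pairs gives no control. *)
Lemma forests_components j : j <= n ->
  (n - j) * (n - j).-1 * #|forests j| <= 2 * j.+1 * #|forests j.+1|.
Proof.
move=> jn; apply: leq_trans (forests_disconnected j).
rewrite mulnC -sum_nat_const; apply: leq_sum => E; rewrite inE => /and3P[w /eqP c _].
have [S hS hc] := disconnected_set w; rewrite c in hS.
apply: (@leq_trans (#|S| * #|S|.-1)); first by apply: leq_mul; lia.
pose B := [set p : 'I_n * 'I_n | (p.1 \in S) && (p.2 \in S :\ p.1)].
apply: (@leq_trans #|B|).
  rewrite -(sum_card_pairs S (fun x => S :\ x)) -sum_nat_const; apply: leq_sum => x xS.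
  by rewrite (cardsD1 x S) xS.
apply: subset_leq_card; apply/subsetP => -[x y]; rewrite !inE /= => /and3P[xS yx yS].
by apply: contraNN yx => h; rewrite (hc x y xS yS h).
Qed.

End Graph.

(** * Components and the choice of the largest one *)

Section Components.
Variables (n : nat).
Implicit Types (E F : {set {set 'I_n}}) (v x y : 'I_n).

Lemma comp_closed E v x y : x \in Defs.comp E v -> adj E x y -> y \in Defs.comp E v.
Proof. by rewrite !inE => vx xy; apply: connect_trans vx (connect1 xy). Qed.

Lemma comp_eq E v x : x \in Defs.comp E v -> Defs.comp E x = Defs.comp E v.
Proof.
rewrite inE => vx; apply/setP => y; rewrite !inE.
exact/esym/(same_connect (adj_connect_sym E) vx).
Qed.

Lemma eq_components E F : (forall x y, adj E x y -> connect (adj F) x y) ->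
  (forall x y, adj F x y -> connect (adj E) x y) -> Defs.comp E =1 Defs.comp F.
Proof.
move=> EF FE v; apply/setP => y; rewrite !inE.
by apply/idP/idP; apply: connect_sub.
Qed.

(** The tie-breaking rule looks only at the components, so the chosen component survives every
    exchange of edges that preserves them. *)
Lemma eq_largest_comp E F : Defs.comp E =1 Defs.comp F -> largest_comp E = largest_comp F.
Proof.
move=> e; rewrite /largest_comp; under eq_bigr do rewrite e.
under eq_pick do rewrite e.
by case: pickP => // v _; rewrite e.
Qed.

Lemma largest_compP E : 0 < n -> exists v, largest_comp E = Defs.comp E v /\
  forall u, #|Defs.comp E u| <= #|Defs.comp E v|.
Proof.
move=> n0; rewrite /largest_comp; case: pickP => [v /eqP e|none].
  by exists v; split=> // u; rewrite e; exact: (@leq_bigmax _ (fun u => #|Defs.comp E u|)).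
have [|v e] := @eq_bigmax _ (fun u => #|Defs.comp E u|); first by rewrite card_ord.
by have := none v; rewrite e eqxx.
Qed.

Lemma largest_comp_mem E v : v \in largest_comp E -> largest_comp E = Defs.comp E v.
Proof.
move=> vL; have n0 : 0 < n by apply: leq_trans (ltn_ord v).
by have [w [e _]] := largest_compP E n0; move: vL; rewrite e => /comp_eq.
Qed.

Lemma largest_comp_closed E x y :
  x \in largest_comp E -> adj E x y -> y \in largest_comp E.
Proof. by move=> xL; rewrite (largest_comp_mem xL); apply: comp_closed; rewrite inE. Qed.

Lemma small_comps_closed E x y :
  x \in small_comps E -> adj E x y -> y \in small_comps E.
Proof.
rewrite !inE => xL xy; apply: contra xL => yL.
by apply: largest_comp_closed yL _; rewrite adj_sym.
Qed.

End Components.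

(** * Trees as functions *)

Section TreeFunctions.
Variable U : finType.
Implicit Types (f g : {ffun U -> U}) (r v x y z : U).

Lemma fconnect_rect f r (P : U -> Prop) : P r -> (forall x, P (f x) -> P x) ->
  forall x, fconnect f x r -> P x.
Proof.
move=> Pr Pf x /connectP[p]; elim: p x => [|y p IH] x /= => [_ <-//|].
by move=> /andP[/eqP <- fp] /(IH _ fp)/Pf.
Qed.

Lemma fconnect_closed f (P : U -> Prop) x y : P x -> (forall z, P z -> P (f z)) ->
  fconnect f x y -> P y.
Proof.
move=> Px Pf /connectP[p]; elim: p x Px => [|z p IH] x Px /= => [_ ->//|].
by move=> /andP[/eqP e fp]; apply: IH fp; rewrite -e; exact: Pf.
Qed.

Lemma fconnect_fixed f x y : f x = x -> fconnect f x y -> y = x.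
Proof. by move=> fx; apply: (fconnect_closed (P := fun z => z = x)) => // z ->. Qed.

Lemma fconnect_root_uniq f x r r' : f r = r -> f r' = r' ->
  fconnect f x r -> fconnect f x r' -> r = r'.
Proof.
move=> fr fr' xr; move: xr; apply: (fconnect_rect (P := fun x => fconnect f x r' -> r = r')).
  by move=> h; rewrite (fconnect_fixed fr h).
move=> {}x IH /connectP[[|y p] /=]; last first.
  by move=> /andP[/eqP <- fp] e; apply: IH; apply/connectP; exists p.
by move=> _ e; apply: IH; rewrite -e fr'; exact: connect0.
Qed.

(** A rooted forest is encoded by its parent map, with the roots as fixed points. *)
Definition roots_of f := [set r | f r == r].
Definition rooted f := [forall x, [exists r, (f r == r) && fconnect f x r]].
Definition rooted_forests j := [set f | rooted f && (#|roots_of f| == j)].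

(** Pitman's double counting: hang a root [r] below a vertex [v] of another tree. There are
    [#|U| * j] choices of the pair; the result has [j] roots, and marking the non-root [r] makes the
    step reversible. *)
Lemma rooted_forests_step j :
  #|rooted_forests j.+1| * (#|U| * j) <= #|rooted_forests j| * (#|U| - j).
Proof.
pose B f := [set p : U * U | (f p.2 == p.2) && ~~ fconnect f p.1 p.2].
pose C f := ~: roots_of f.
apply: (@leq_trans (\sum_(f in rooted_forests j.+1) #|B f|)).
  rewrite -sum_nat_const; apply: leq_sum => f; rewrite inE => /andP[/forallP rf /eqP c].
  have -> : B f = [set p | (p.1 \in [set: U]) && (p.2 \in [set r in roots_of f | ~~ fconnect f p.1 r])].
    by apply/setP => p; rewrite !inE.
  rewrite -(sum_card_pairs setT (fun v => [set r in roots_of f | ~~ fconnect f v r])).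
  rewrite -cardsT -sum_nat_const; apply: leq_sum => v _.
  have /existsP[r0 /andP[/eqP fr0 vr0]] := rf v.
  apply: (@leq_trans #|roots_of f :\ r0|).
    by have := cardsD1 r0 (roots_of f); rewrite c inE fr0 eqxx add1n => -[->].
  apply: subset_leq_card; apply/subsetP => r; rewrite !inE => /andP[rr0 /eqP fr].
  rewrite fr eqxx /=; apply: contraNN rr0 => vr.
  by rewrite (fconnect_root_uniq fr fr0 vr vr0).
apply: (@leq_trans (\sum_(f in rooted_forests j) #|C f|)); last first.
  rewrite -sum_nat_const; apply: leq_sum => f; rewrite inE => /andP[_ /eqP c].
  by rewrite /C cardsCs setCK c.
rewrite !sum_card_pairs.
pose upf f r v : {ffun U -> U} := [ffun x => if x == r then v else f x].
have upK f r v : f r = r -> upf (upf f r v) r r = f.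
  by move=> fr; apply/ffunP => x; rewrite !ffunE; case: eqP => [->|].
apply: (@card_leq_inj _ _ (fun q : {ffun U -> U} * (U * U) => (upf q.1 q.2.2 q.2.1, q.2.2))).
  move=> [f [v r]] [f' [v' r']]; rewrite !inE /= => /and3P[_ /eqP fr _] /and3P[_ /eqP fr' _] [e er].
  subst r'; have := congr1 (fun h : {ffun U -> U} => h r) e; rewrite /= !ffunE eqxx => ev.
  by rewrite -(upK f r v fr) e upK// ev.
move=> [f [v r]]; rewrite !inE /= => /and3P[/andP[/forallP rf /eqP c] /eqP fr nvr].
have vr : v != r by apply: contraNneq nvr => ->; exact: connect0.
set g := upf f r v.
have gr : g r = v by rewrite ffunE eqxx.
have gx x : x != r -> g x = f x by rewrite ffunE => /negbTE ->.
have stepg x y : fconnect g (g x) y -> fconnect g x y.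
  by apply: connect_trans; apply: connect1; rewrite /= eqxx.
have stepf x y : fconnect f (f x) y -> fconnect f x y.
  by apply: connect_trans; apply: connect1; rewrite /= eqxx.
have c1 x y : fconnect f x y -> ~~ fconnect f x r -> fconnect g x y.
  apply: (fconnect_rect (P := fun x => ~~ fconnect f x r -> fconnect g x y)) => [_|{}x IH nx].
    exact: connect0.
  have xr : x != r by apply: contraNneq nx => ->; exact: connect0.
  apply: stepg; rewrite gx//; apply: IH; apply: contraNN nx; exact: stepf.
have c2 x : fconnect f x r -> fconnect g x r.
  apply: (fconnect_rect (P := fun x => fconnect g x r)) => [|{}x IH]; first exact: connect0.
  have [->|xr] := eqVneq x r; first exact: connect0.
  by apply: stepg; rewrite gx.
have c3 x : ~~ fconnect f x r -> exists r', (g r' == r') && fconnect g x r'.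
  move=> nx; have /existsP[r' /andP[/eqP fr' xr']] := rf x; exists r'.
  have rr' : r' != r by apply: contraNneq nx => <-.
  by rewrite gx// fr' eqxx c1.
rewrite gr vr andbT; apply/andP; split.
  apply/forallP => x; apply/existsP; have [xr|] := boolP (fconnect f x r); last exact: c3.
  have [r' /andP[h1 h2]] := c3 v nvr; exists r'; rewrite h1.
  by apply: connect_trans (c2 x xr) _; apply: stepg; rewrite gr.
have -> : roots_of g = roots_of f :\ r.
  apply/setP => x; rewrite !inE; have [->|xr] := eqVneq x r; first by rewrite gr (negbTE vr).
  by rewrite gx.
by have := cardsD1 r (roots_of f); rewrite c inE fr eqxx add1n => -[->].
Qed.

Definition treefun f r := (f r == r) && [forall x, fconnect f x r].

Lemma treefunP f r : reflect (f r = r /\ forall x, fconnect f x r) (treefun f r).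
Proof. by apply: (iffP andP) => -[/eqP h /forallP]. Qed.

Lemma treefun_fixed f r x : treefun f r -> f x = x -> x = r.
Proof. by move=> /treefunP[_ /(_ x) h] fx; rewrite (fconnect_fixed fx h). Qed.

(** The lower half of Cayley's formula for rooted trees. *)
Lemma card_treefun : 0 < #|U| ->
  #|U| ^ #|U|.-1 <= #|[set p : {ffun U -> U} * U | treefun p.1 p.2]|.
Proof.
set k := #|U| => k0.
(* The identity has [k] roots; each step from [k - i] to [k - i.+1] roots contributes the factor
   [k * (k - i.+1) / i.+1], which builds up the binomial coefficient. *)
have H i : i < k -> 'C(k.-1, i) * k ^ i <= #|rooted_forests (k - i)|.
  elim: i => [_|i IH ik].
    rewrite bin0 muln1 subn0 card_gt0; apply/set0Pn; exists [ffun x => x].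
    rewrite inE; apply/andP; split; last first.
      by apply/eqP; rewrite /k -cardsT; congr #|pred_of_set _|; apply/setP => x; rewrite !inE ffunE eqxx.
    by apply/forallP => x; apply/existsP; exists x; rewrite ffunE eqxx connect0.
  have {}IH := IH (ltnW ik).
  have := rooted_forests_step (k - i.+1); rewrite -/k.
  have -> : (k - i.+1).+1 = k - i by lia.
  have -> : k - (k - i.+1) = i.+1 by lia.
  move=> h; rewrite -(leq_pmul2r (ltn0Sn i)); apply: leq_trans h.
  rewrite mulnAC [_ * i.+1]mulnC mul_bin_left expnS.
  rewrite mulnCA -mulnA [k * _]mulnC mulnA [_ * (k * _)]mulnC.
  have -> : k.-1 - i = k - i.+1 by lia.
  move: IH; set c := 'C(_, _); set d := k - i.+1; move=> IH.
  rewrite (_ : d * c * k ^ i * k = k * d * (c * k ^ i)); last by set t := k ^ i; nia.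
  by rewrite leq_mul2l IH orbT.
apply: (@leq_trans #|rooted_forests 1|).
  by have := H k.-1; rewrite binn mul1n (_ : k - k.-1 = 1) ?prednK//; [apply|lia].
have ex f : exists r, f \in rooted_forests 1 -> treefun f r.
  have [fr|] := boolP (f \in rooted_forests 1); last first.
    by have /card_gt0P[r _] := k0; exists r.
  move: fr; rewrite inE => /andP[/forallP rf /cards1P[r er]]; exists r => _.
  have : r \in roots_of f by rewrite er inE.
  rewrite inE => fr; apply/andP; split=> //; apply/forallP => x.
  have /existsP[r' /andP[fr' xr']] := rf x.
  have : r' \in roots_of f by rewrite inE.
  by rewrite er inE => /eqP <-.
have /fin_all_exists[h hh] := ex.
apply: (@card_leq_inj _ _ (fun f => (f, h f))) => [f f' _ _ []//|f /hh].
by rewrite inE.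
Qed.

(** Hence an edge of a tree tells which of its ends is the child. *)
Lemma treefun_2cycle f r x : treefun f r -> f (f x) = x -> f x = x.
Proof.
move=> /treefunP[fr /(_ x)] h ffx.
have : r = x \/ r = f x.
  move: h; apply: (fconnect_closed (P := fun z => z = x \/ z = f x)); first by left.
  by move=> z [->|->]; [right|left].
by case=> e; [rewrite -{1}e fr e|move: fr; rewrite e ffx].
Qed.

(** Breadth-first search: [D] is the distance to [r], and the parent of [x] is a neighbour closer to
    [r]. *)
Lemma exists_treefun (e : rel U) r : (forall x, connect e x r) ->
  exists2 f, treefun f r & forall x, f x != x -> e x (f x).
Proof.
move=> con.
have ex x : exists k, [exists p : k.-tuple U, path e x p && (last x p == r)].
  have /connectP[p pp er] := con x; exists (size p); apply/existsP; exists (in_tuple p).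
  by rewrite /= pp -er eqxx.
pose D x := ex_minn (ex x).
have Dmin x (p : seq U) : path e x p -> last x p = r -> D x <= size p.
  move=> pp er; rewrite /D; case: ex_minnP => m _; apply; apply/existsP; exists (in_tuple p).
  by rewrite /= pp er eqxx.
have nx x : exists z, x != r -> e x z && (D z < D x).
  have [->|xr] := eqVneq x r; first by exists r.
  rewrite {2}/D; case: ex_minnP => m /existsP[[[|z p] sz] /andP[pp /eqP er]] _.
    by move: er => /= er; rewrite er eqxx in xr.
  exists z => _; case/andP: pp => -> zp /=; rewrite -(eqP sz) /= ltnS; exact: Dmin.
have /fin_all_exists[h hh] := nx.
exists [ffun x => if x == r then r else h x].
  apply/treefunP; split; first by rewrite ffunE eqxx.
  move=> x; move: {2}(D x) (leqnn (D x)) => k; elim: k x => [|k IH] x.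
    have [->|xr] := eqVneq x r; first by rewrite connect0.
    by have /andP[_] := hh x xr => lt; rewrite leqn0 => /eqP e0; rewrite e0 in lt.
  have [->|xr] := eqVneq x r; first by rewrite connect0.
  have /andP[_ lt] := hh x xr => le.
  apply: connect_trans (IH (h x) _); last by rewrite -ltnS (leq_trans lt).
  by apply: connect1; rewrite /= ffunE (negbTE xr).
move=> x; rewrite ffunE; have [->|xr _] := eqVneq x r; first by rewrite eqxx.
by have /andP[] := hh x xr.
Qed.

Section Edges.
Variables (n : nat) (i : U -> 'I_n).
Hypothesis i_inj : injective i.

Definition tree_edges f := [set [set i x; i (f x)] | x in [set x | f x != x]].

Lemma tree_edgesP f (e : {set 'I_n}) :
  reflect (exists2 x, f x != x & e = [set i x; i (f x)]) (e \in tree_edges f).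
Proof.
apply: (iffP imsetP) => [[x]|[x h ->]]; first by rewrite inE => h ->; exists x.
by exists x; rewrite ?inE.
Qed.

(** Agreement spreads from the root outwards: an edge directed oppositely by the two maps would
    produce a 2-cycle of [f]. *)
Lemma tree_edges_inj f g r : treefun f r -> treefun g r -> tree_edges f = tree_edges g -> f = g.
Proof.
move=> tf tg E; apply/ffunP => x; have /treefunP[fr conf] := tf; have /treefunP[gr _] := tg.
move: (conf x); apply: (fconnect_rect (P := fun x => f x = g x)); first by rewrite fr gr.
move=> {}x IH; have [fx|fx] := eqVneq (f x) x; first by rewrite (treefun_fixed tf fx) fr gr.
have : [set i x; i (f x)] \in tree_edges g by rewrite -E; apply/tree_edgesP; exists x.
move=> /tree_edgesP[y gy /eq_set2[[/i_inj -> /i_inj ->]//|[/i_inj e1 /i_inj e2]]].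
by move: fx; rewrite (treefun_2cycle tf) ?eqxx// IH e2 -e1.
Qed.

Lemma card_tree_edges f r : treefun f r -> #|tree_edges f| = #|U|.-1.
Proof.
move=> tf; rewrite card_in_imset.
  have -> : [set x | f x != x] = [set~ r].
    apply/setP => x; rewrite !inE; congr negb; apply/eqP/eqP => [|->]; first exact: treefun_fixed tf.
    by case/treefunP: tf.
  by rewrite cardsC1.
move=> x y; rewrite !inE => fx fy /eq_set2[[/i_inj //]|[/i_inj e1 /i_inj e2]].
by move: fx; rewrite (treefun_2cycle tf) ?eqxx// e2.
Qed.

Lemma wf_tree_edges f : wf_graph (tree_edges f).
Proof.
apply/forall_inP => e /tree_edgesP[x fx ->]; rewrite cards2.
by rewrite (inj_eq i_inj) [x == _]eq_sym fx.
Qed.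

(** The factor [#|U|] pays for the root, which the edge set forgets. *)
Lemma leq_card_tree_edges : 0 < #|U| ->
  #|U| ^ #|U|.-1 <= #|U| * #|[set tree_edges p.1 | p in [set p : {ffun U -> U} * U | treefun p.1 p.2]]|.
Proof.
move=> U0; apply: leq_trans (card_treefun U0) _; rewrite mulnC -cardsT -cardsX.
apply: (@card_leq_inj _ _ (fun p : {ffun U -> U} * U => (tree_edges p.1, p.2))) => [[f r] [g r']|p h].
  by rewrite !inE /= => tf tg [e er]; subst r'; rewrite (tree_edges_inj tf tg e).
by rewrite inE /= in_setT andbT; apply: imset_f.
Qed.

(** The tree grows from its root: [W] is closed under [f], and a vertex outside [W] with parent in
    [W] is isolated so far, hence attached as a leaf. *)
Lemma tree_edges_leaf_closed (P : {set {set 'I_n}} -> bool)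
    (Pleaf : forall E (x v : 'I_n), P E -> x != v -> (forall y : 'I_n, ~~ adj E v y) -> P ([set x; v] |: E))
    E f r : P E -> (forall x (y : 'I_n), ~~ adj E (i x) y) -> treefun f r -> P (E :|: tree_edges f).
Proof.
move=> PE iso tf; have /treefunP[fr con] := tf.
pose EW (W : {set U}) := E :|: [set [set i x; i (f x)] | x in [set x in W | f x != x]].
suff H k W : #|~: W| = k -> r \in W -> (forall x, x \in W -> f x \in W) -> P (EW W) ->
    P (E :|: tree_edges f).
  apply: (H _ [set r] erefl); rewrite ?set11//.
    by move=> x; rewrite !inE => /eqP->; rewrite fr.
  suff -> : EW [set r] = E by [].
  apply/setP => e; rewrite inE orbC; case: imsetP => //= -[x]; rewrite !inE.
  by move=> /andP[/eqP->]; rewrite fr eqxx.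
elim: k W => [|k IH] W.
  move=> /cards0_eq W0 _ _; have -> : W = setT by rewrite -[W]setCK W0 setC0.
  suff -> : EW setT = E :|: tree_edges f by [].
  rewrite /EW /tree_edges (_ : [set x in setT | f x != x] = [set x | f x != x])//.
  by apply/setP => x; rewrite !inE.
move=> Wk rW clW PW.
have [x xW fxW] : exists2 x, x \notin W & f x \in W.
  have [x0] : exists x, x \in ~: W by apply/set0Pn; rewrite -card_gt0 Wk.
  rewrite inE; move: (con x0).
  apply: (fconnect_rect (P := fun x => x \notin W -> exists2 x, x \notin W & f x \in W)).
    by rewrite rW.
  move=> {}x0 IH0 nx0; have [fx0|/IH0//] := boolP (f x0 \in W).
  by exists x0.
have nfx : f x != x by apply: contraNneq xW => <-.
apply: (IH (x |: W)).
- apply/eqP; rewrite -eqSS -Wk (cardsD1 x (~: W)) inE xW add1n eqSS; apply/eqP.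
  by congr #|pred_of_set _|; apply/setP => z; rewrite !inE negb_or.
- by rewrite inE rW orbT.
- by move=> y; rewrite !in_setU1 => /orP[/eqP->|/clW ->]; rewrite ?fxW orbT.
have -> : EW (x |: W) = [set i (f x); i x] |: EW W.
  apply/setP => e; rewrite in_setU1 !in_setU orbCA; congr (_ || _).
  apply/imsetP/orP => [[y]|[/eqP ->|/imsetP[y]]].
  - rewrite !inE => /andP[/orP[/eqP ->|yW] fy] ->; first by left; rewrite setUC.
    by right; apply: imset_f; rewrite inE yW.
  - by exists x; rewrite ?inE ?eqxx // setUC.
  - by rewrite inE => /andP[yW fy] ->; exists y; rewrite // !inE yW orbT.
apply: Pleaf => //; first by rewrite (inj_eq i_inj).
move=> y; apply/negP; rewrite /adj inE => /orP[h|/imsetP[z]].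
  by have := iso x y; rewrite /adj h.
rewrite inE => /andP[zW fz] /eq_set2[[/i_inj e _]|[/i_inj e _]].
  by rewrite e zW in xW.
by rewrite e clW in xW.
Qed.

End Edges.
End TreeFunctions.

Lemma comp_treefun n (E : {set {set 'I_n}}) (V : {set 'I_n}) (v : 'I_n) : V = Defs.comp E v ->
  exists f r, treefun (U := {x | x \in V}) f r /\
    tree_edges val f \subset [set e in E | e \subset V].
Proof.
move=> eV; have inV u : (u \in V) = connect (adj E) v u by rewrite eV inE.
have vV : v \in V by rewrite inV connect0.
pose r : {x | x \in V} := exist _ v vV.
pose e := relpre (val : {x | x \in V} -> 'I_n) (adj E).
have con x : connect e x r.
  have : connect (adj E) v (val x) by rewrite -inV; exact: valP.
  rewrite adj_connect_sym => /connectP[p pp er].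
  elim: p x pp er => [|y p IH] x /= => [_ er|/andP[xy yp] er].
    by rewrite (_ : x = r) ?connect0//; apply: val_inj; rewrite /= -er.
  have yV : y \in V.
    rewrite inV; apply: connect_trans (connect1 xy).
    by rewrite -inV; exact: valP.
  by apply: connect_trans (IH (exist _ y yV) yp er); exact: connect1.
have [f tf fe] := exists_treefun con.
exists f, r; split=> //; apply/subsetP => d /tree_edgesP[x /fe fx ->]; rewrite inE.
apply/andP; split; first exact: fx.
by apply/subsetP => z; rewrite !inE => /orP[]/eqP->; exact: valP.
Qed.

(** * Exchange of edges *)

Lemma leq_card_fibers (T K : finType) (key : T -> K) (A B : {set T}) s t :
  (forall x, x \in B -> #|[set y in B | key y == key x]| * t <= s * #|[set y in A | key y == key x]|) ->
  #|B| * t <= s * #|A|.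
Proof.
move=> H.
have fib (C : {set T}) : #|C| = \sum_(c : K) #|[set y in C | key y == c]|.
  rewrite -sum1_card (partition_big key xpredT) //=; apply: eq_bigr => c _.
  by rewrite -sum1_card; apply: eq_bigl => y; rewrite inE.
rewrite (fib B) (fib A) big_distrl big_distrr /=; apply: leq_sum => c _.
have [->|[x]] := set_0Vmem [set y in B | key y == c]; first by rewrite cards0.
by rewrite inE => /andP[xB /eqP <-]; exact: H.
Qed.

Section Exchange.
Variables (n : nat) (P : {set {set 'I_n}} -> bool).
Hypothesis P0 : P set0.
Hypothesis Psub : forall E F : {set {set 'I_n}}, F \subset E -> P E -> P F.
Hypothesis Pleaf : forall E (x v : 'I_n), P E -> x != v -> (forall y, ~~ adj E v y) ->
  P ([set x; v] |: E).
Implicit Types (E F : {set {set 'I_n}}) (V : {set 'I_n}).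

(** Each of the [j] added edges costs at most two isolated vertices, so the surplus [2 * j] leaves
    at least [a] of them throughout. *)
Lemma graph_class_iter i j a :
  #|graph_class P i (a + 2 * j)| * (a * n.-1) ^ j <= (2 * (i + j)) ^ j * #|graph_class P (i + j) a|.
Proof.
elim: j i => [|j IH] i; first by rewrite !expn0 muln1 mul1n muln0 !addn0.
have := graph_class_step P0 Pleaf i (a + 2 * j).
rewrite (_ : (a + 2 * j).+2 = a + 2 * j.+1); last by lia.
move=> h1; have h2 := IH i.+1; rewrite !addSn -!addnS in h2.
rewrite expnS [in leqRHS]expnS mulnA.
apply: leq_trans (_ : 2 * i.+1 * #|graph_class P i.+1 (a + 2 * j)| * (a * n.-1) ^ j <= _).
  rewrite leq_mul2r; apply/orP; right; apply: leq_trans h1.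
  by rewrite leq_mul2l leq_mul2r leq_addr !orbT.
rewrite -!mulnA; apply: leq_trans (_ : 2 * (i.+1 * ((2 * (i + j.+1)) ^ j * #|graph_class P (i + j.+1) a|)) <= _).
  by rewrite !leq_mul2l h2 !orbT.
by rewrite leq_mul2l leq_mul2r (_ : i.+1 <= i + j.+1) ?orbT//; lia.
Qed.

Definition inner V E := [set e in E | e \subset V].

Definition pairs_in V : {set {set 'I_n}} := [set e : {set 'I_n} | (e \subset V) && (#|e| == 2)].

(** A graph is recovered from [E :\: J] and [J], and [J] is one of the [j]-subsets of the pairs
    inside a set of [k] vertices that [E :\: J] determines. *)
Lemma card_restore (A B : {set {set {set 'I_n}}}) k j :
  (forall E, E \in A -> exists2 J : {set {set 'I_n}}, J \subset E &
    [/\ #|J| = j, E :\: J \in B, J \subset pairs_in (largest_comp (E :\: J)) & #|largest_comp (E :\: J)| = k]) ->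
  #|A| <= #|B| * 'C(k ^ 2, j).
Proof.
move=> H.
have /fin_all_exists[g gP] : forall E, exists J : {set {set 'I_n}}, E \in A -> J \subset E /\
    [/\ #|J| = j, E :\: J \in B, J \subset pairs_in (largest_comp (E :\: J)) & #|largest_comp (E :\: J)| = k].
  by move=> E; have [/H[J ? ?]|_] := boolP (E \in A); [exists J|exists set0].
pose S E := [set J : {set {set 'I_n}} | [&& J \subset pairs_in (largest_comp E), #|J| == j & #|largest_comp E| == k]].
apply: (@leq_trans (\sum_(E in B) #|S E|)).
  rewrite sum_card_pairs; apply: (@card_leq_inj _ _ (fun E => (E :\: g E, g E))).
    move=> E E' /gP[sE _] /gP[sE' _] [e1 e2].
    by rewrite -(setID E (g E)) -(setID E' (g E')) (setIidPr sE) (setIidPr sE') e1 e2.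
  by move=> E /gP[_ [c b s k']]; rewrite inE /= b inE s c k' !eqxx.
rewrite -sum_nat_const; apply: leq_sum => E _.
have [k'|nk] := eqVneq #|largest_comp E| k; last first.
  rewrite (_ : S E = set0) ?cards0//; apply/setP => J; rewrite !inE (negbTE nk); lia.
apply: (@leq_trans 'C(#|pairs_in (largest_comp E)|, j)).
  rewrite -cards_draws; apply: subset_leq_card; apply/subsetP => J.
  by rewrite !inE => /and3P[-> -> _].
apply: leq_bin2l; rewrite cards_draws k' bin2 -divn2.
by apply: leq_trans (leq_div _ _) _; rewrite leq_mul2l leq_pred orbT.
Qed.

Variable nice : forall V, pred {ffun {x | x \in V} -> {x | x \in V}}.

(** The case without excess edges, to which [card_not_nice_spanning] reduces by deleting them. *)
Definition ugly i a k := [set E in graph_class P i a | (#|largest_comp E| == k) &&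
  [exists f : {ffun {x | x \in largest_comp E} -> {x | x \in largest_comp E}}, exists r,
    [&& treefun f r, inner (largest_comp E) E == tree_edges val f & ~~ nice f]]].

Lemma treefun_connect V (f : {ffun {x | x \in V} -> {x | x \in V}}) r (x y : {x | x \in V}) : treefun f r ->
  connect (adj (tree_edges val f)) (val x) (val y).
Proof.
move=> /treefunP[_ conf].
have to_root (z : {x | x \in V}) : connect (adj (tree_edges val f)) (val z) (val r).
  move: (conf z); apply: (fconnect_rect (P := fun z : {x | x \in V} => connect (adj (tree_edges val f)) (val z) (val r))).
    exact: connect0.
  move=> {}z; apply: connect_trans; have [->|fz] := eqVneq (f z) z; first exact: connect0.
  by apply/connect1/tree_edgesP; exists z.
by apply: connect_trans (to_root x) _; rewrite adj_connect_sym.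
Qed.

Lemma tree_edges_inner V (f : {ffun {x | x \in V} -> {x | x \in V}}) (e : {set 'I_n}) : e \in tree_edges (val : {x | x \in V} -> 'I_n) f ->
  e \subset V.
Proof.
by move=> /tree_edgesP[x _ ->]; apply/subsetP => y; rewrite !inE => /orP[/eqP->|/eqP->]; exact: valP.
Qed.

(* Replacing the tree on the largest component preserves membership in the class and all the
   components, so the graphs with equal remainder run over all the trees on that component. *)
Lemma card_ugly i a k s : 1 < k ->
  (forall V, #|V| = k -> #|[set f | ~~ @nice V f]| <= s) ->
  #|ugly i a k| * k ^ k.-1 <= k * (k * s) * #|graph_class P i a|.
Proof.
move=> k1 hs; pose key E := (largest_comp E, E :\: inner (largest_comp E) E).
apply: (leq_card_fibers (key := key)) => E; rewrite inE => /andP[].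
rewrite inE => /and4P[PE wE /eqP cE iE] /andP[/eqP Vk] /existsP[f /existsP[r /and3P[tf /eqP innE _]]].
set V := largest_comp E in f r tf innE Vk *.
have [v vV] : exists v, v \in V by apply/card_gt0P; rewrite Vk ltnW.
have Vcomp := largest_comp_mem vV; rewrite -/V in Vcomp.
pose U := {x | x \in V}; have cU : #|{: U}| = k by rewrite card_sig.
pose F := E :\: inner V E.
have FE : F \subset E by exact: subsetDl.
have Fiso x y : x \in V -> ~~ adj F x y.
  move=> xV; apply/negP; rewrite /adj in_setD => /andP[ninn xy]; case/negP: ninn.
  rewrite inE xy /=; apply/subsetP => z; rewrite !inE => /orP[/eqP->//|/eqP->].
  by move: xV; rewrite Vcomp => /comp_closed; apply.
have wF : wf_graph F by exact: wf_graphS wE.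
have innF e : e \in F -> e \subset V -> False.
  move=> eF eV; have [x [y [_ e2 xy]]] := wf_edge wF eF.
  by have := Fiso x y; rewrite xy (subsetP eV) ?e2 ?set21// => /(_ isT).
have EF : E = F :|: tree_edges val f.
  by rewrite -innE setUC -[LHS](setID E (inner V E)) (setIidPr _)//; apply/subsetP => e; rewrite inE => /andP[].
have innU g : inner V (F :|: tree_edges (val : U -> 'I_n) g) = tree_edges val g.
  apply/setP => e; rewrite /inner in_set in_setU; apply/andP/idP => [[/orP[eF /(innF _ eF)//|//]]|eT].
  by rewrite eT orbT; split=> //; exact: tree_edges_inner eT.
pose Trees := [set tree_edges (val : U -> 'I_n) p.1 | p in [set p : {ffun U -> U} * U | treefun p.1 p.2]].
have cT : k ^ k.-1 <= k * #|Trees|.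
  by rewrite -cU; apply: leq_card_tree_edges; [exact: val_inj|rewrite cU ltnW].
have good : #|Trees| <= #|[set E' in graph_class P i a | key E' == key E]|.
  apply: (@card_leq_inj _ _ (fun T => F :|: T)).
    move=> _ _ /imsetP[p _ ->] /imsetP[q _ ->] /= e.
    exact: etrans (esym (innU p.1)) (etrans (congr1 (inner V) e) (innU q.1)).
  move=> T /imsetP[[g r']]; rewrite inE /= => tg ->.
  set E' := F :|: _.
  have comps : Defs.comp E' =1 Defs.comp E.
    have aux (h h' : {ffun {x | x \in V} -> {x | x \in V}}) r1 r2 : treefun h r1 -> treefun h' r2 -> forall x y,
        adj (F :|: tree_edges (val : U -> 'I_n) h) x y -> connect (adj (F :|: tree_edges val h')) x y.
      move=> th th' x y; rewrite {1}/adj in_setU => /orP[xy|xy].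
        by apply/connect1; rewrite /adj in_setU xy.
      have xyV := subsetP (tree_edges_inner xy).
      apply: (connect_adjS (subsetUr F _)).
      exact: (treefun_connect (exist _ x (xyV _ (set21 _ _))) (exist _ y (xyV _ (set22 _ _))) th').
    apply: (@eq_components _ E' E) => x y; first by move=> h; rewrite [X in adj X]EF; exact: aux tg tf _ _ h.
    by rewrite [X in adj X]EF => h; exact: aux tf tg _ _ h.
  have LE' : largest_comp E' = V by exact: eq_largest_comp.
  have kE' : key E' = (V, F).
    rewrite /key LE' innU; congr pair.
    rewrite setDUl setDv setU0; apply/setDidPl; rewrite disjoint_subset.
    by apply/subsetP => e eF; rewrite inE; apply/negP => /tree_edges_inner/(innF _ eF).
  rewrite inE kE'; apply/andP; split; last exact: eqxx.
  rewrite inE; apply/and4P; split.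
  - apply: (tree_edges_leaf_closed val_inj Pleaf) tg; first exact: Psub FE PE.
    by move=> x y; apply: Fiso; exact: valP.
  - apply/forall_inP => e; rewrite in_setU => /orP[]; first by move: wF => /forall_inP; apply.
    by have /forall_inP := wf_tree_edges (val_inj : injective (val : U -> 'I_n)) g; apply.
  - have dis (h : {ffun {x | x \in V} -> {x | x \in V}}) : #|F :|: tree_edges (val : U -> 'I_n) h| = #|F| + #|tree_edges (val : U -> 'I_n) h|.
      rewrite cardsU (_ : F :&: _ = set0) ?cards0 ?subn0//; apply/setP => e; rewrite in_setI in_set0.
      by apply/negP => /andP[eF] /tree_edges_inner; exact: innF.
    by rewrite dis (card_tree_edges val_inj tg) -(card_tree_edges val_inj tf) -dis -EF cE.
  - apply: leq_trans iE _; apply: subset_leq_card; apply/subsetP => w /isolatedP iw.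
    apply/isolatedP => y; apply/negP; rewrite /adj in_setU => /orP[wy|wy].
      by have /negP := iw y; apply; exact: adjS wy.
    have wyV := subsetP (tree_edges_inner wy).
    have wV := wyV _ (set21 _ _); have yV := wyV _ (set22 _ _).
    have wney : w != y.
      by have /forall_inP/(_ _ wy) := wf_tree_edges (val_inj : injective (val : U -> 'I_n)) g; rewrite cards2; case: (w != y).
    have Vw : V = Defs.comp E w := largest_comp_mem wV.
    move: yV; rewrite Vw inE => /connectP[[|z q] /=]; first by move=> _ e; rewrite e eqxx in wney.
    by move=> /andP[wz _] _; have /negP := iw z; apply.
have bad : #|[set E' in ugly i a k | key E' == key E]| <= k * s.
  apply: (@leq_trans #|[set F :|: tree_edges (val : U -> 'I_n) p.1 | p in setX [set h | ~~ @nice V h] setT]|); last first.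
    apply: leq_trans (leq_imset_card _ _) _; rewrite cardsX mulnC; apply: leq_mul; last exact: hs.
    by apply: eq_leq; rewrite cardsT; exact: cU.
  apply: subset_leq_card; apply/subsetP => E'; rewrite !inE => /andP[/andP[_ /andP[_]]].
  rewrite /key -/V => ex /eqP[LE' FE']; move: ex; rewrite LE' in FE' *.
  move=> /existsP[h /existsP[r' /and3P[_ /eqP inn nn]]].
  apply/imsetP; exists (h, r); first by rewrite !inE andbT.
  rewrite /= -inn /F -FE' setUC -[LHS](setID E' (inner V E')) (setIidPr _)//.
  by apply/subsetP => e; rewrite inE => /andP[].
apply: leq_trans (leq_mul bad cT) _.
by rewrite mulnA [k * s * k]mulnC leq_mul2l good orbT.
Qed.

Definition nice_spanning E j := [exists f : {ffun {x | x \in largest_comp E} -> {x | x \in largest_comp E}},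
  exists r, [&& treefun f r, tree_edges val f \subset E,
    #|inner (largest_comp E) E| < #|largest_comp E|.-1 + j & nice f]].

(** With at least [j] excess edges, delete [j] of them: the first term. With exactly [e < j], delete
    them all; a spanning tree remains, and its map cannot be nice, since it would witness
    [nice_spanning]. Keeping a spanning tree keeps the largest component. *)
Lemma card_not_nice_spanning m a k j : 0 < k ->
  #|[set E in graph_class P m a | (#|largest_comp E| == k) && ~~ nice_spanning E j]| <=
  #|graph_class P (m - j) a| * 'C(k ^ 2, j) + \sum_(e < j) #|ugly (m - e) a k| * 'C(k ^ 2, e).
Proof.
move=> k0; set A := [set E in _ | _].
have span E : E \in A -> exists f : {ffun {x | x \in largest_comp E} -> {x | x \in largest_comp E}}, exists r,
    [/\ treefun f r, tree_edges val f \subset inner (largest_comp E) E & #|tree_edges val f| = k.-1].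
  rewrite inE => /andP[_ /andP[/eqP ck _]].
  have [v vL] : exists v, v \in largest_comp E by apply/card_gt0P; rewrite ck.
  have [f [r [tf sf]]] := comp_treefun (largest_comp_mem vL).
  by exists f, r; split=> //; rewrite (card_tree_edges val_inj tf) card_sig ck.
have remove (E J : {set {set 'I_n}}) f r : E \in A -> treefun f r -> J \subset inner (largest_comp E) E ->
    [disjoint J & tree_edges (val : {x | x \in largest_comp E} -> 'I_n) f] ->
    tree_edges val f \subset inner (largest_comp E) E ->
    [/\ E :\: J \in graph_class P (m - #|J|) a, largest_comp (E :\: J) = largest_comp E & J \subset pairs_in (largest_comp E)].
  rewrite 2!inE => /andP[/and4P[PE wE /eqP cE iE] _] tf sJ dJ sT.
  have JE : J \subset E by apply: subset_trans sJ _; apply/subsetP => e; rewrite inE => /andP[].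
  have sD : E :\: J \subset E by exact: subsetDl.
  have TD : tree_edges val f \subset E :\: J.
    apply/subsetP => e eT; rewrite inE; have := subsetP sT e eT; rewrite inE => /andP[-> _].
    by rewrite andbT; apply/negP => eJ; move: dJ; rewrite disjoint_subset => /subsetP/(_ e eJ); rewrite inE eT.
  split.
  - rewrite inE (Psub sD PE) (wf_graphS sD wE) /=; apply/andP; split.
      by rewrite cardsD (setIidPr JE) cE.
    apply: leq_trans iE _; apply: subset_leq_card; apply/subsetP => w /isolatedP iw.
    by apply/isolatedP => y; apply: contra (iw y); exact: adjS.
  - apply: eq_largest_comp; apply: eq_components => x y xy; first by apply: connect1; exact: adjS xy.
    have [xyJ|nJ] := boolP ([set x; y] \in J); last by apply/connect1; rewrite /adj in_setD nJ.
    have := subsetP sJ _ xyJ; rewrite inE => /andP[_ /subsetP xyV].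
    apply: (connect_adjS TD).
    exact: (treefun_connect (exist _ x (xyV _ (set21 _ _))) (exist _ y (xyV _ (set22 _ _))) tf).
  - apply/subsetP => e eJ; have := subsetP sJ e eJ; rewrite !inE => /andP[eE ->] /=.
    by move: wE => /forall_inP; apply.
pose big := [set E in A | k.-1 + j <= #|inner (largest_comp E) E|].
have -> : A = big :|: (A :\: big) by rewrite setUC -[LHS](setID A big) setUC; congr (_ :|: _); apply/setIidPr/subsetP => E; rewrite inE => /andP[].
apply: leq_trans (leq_card_setU _ _) _; apply: leq_add.
  apply: card_restore => E; rewrite inE => /andP[EA hj].
  have [f [r [tf sT cT]]] := span E EA.
  have : j <= #|inner (largest_comp E) E :\: tree_edges val f|.
    by rewrite cardsD (setIidPr sT) cT; lia.
  case/card_geqP => s [us sz sub].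
  have cJ : #|[set e in s]| = j by rewrite cardsE -sz; exact/card_uniqP.
  have sJ : [set e in s] \subset inner (largest_comp E) E :\: tree_edges val f.
    by apply/subsetP => e; rewrite inE; exact: sub.
  have := remove E [set e in s] f r EA tf (subset_trans sJ (subsetDl _ _)) _ sT.
  rewrite cJ; case=> [|h1 h2 h3].
    rewrite disjoint_subset; apply/subsetP => e /(subsetP sJ); rewrite !inE => /andP[]//.
  exists [set e in s].
    apply: subset_trans sJ _; apply/subsetP => e; rewrite !inE => /andP[_ /andP[]]//.
  by rewrite h2; split=> //; move: EA; rewrite inE => /andP[_ /andP[/eqP]].
pose layer (e : 'I_j) := [set E in A :\: big | #|inner (largest_comp E) E| == k.-1 + e].
apply: (@leq_trans (\sum_(e < j) #|layer e|)); last first.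
  apply: leq_sum => e _; apply: card_restore => E; rewrite 2!inE => /andP[/andP[_ EA] /eqP ce].
  have [f [r [tf sT cT]]] := span E EA; set J := inner (largest_comp E) E :\: tree_edges val f.
  have cJ : #|J| = e by rewrite cardsD (setIidPr sT) cT ce; lia.
  have sJ : J \subset inner (largest_comp E) E by exact: subsetDl.
  have := remove E J f r EA tf sJ _ sT; rewrite cJ; case=> [|h1 h2 h3].
    by rewrite disjoint_subset; apply/subsetP => x; rewrite !inE => /andP[].
  have ck : #|largest_comp E| = k by move: EA; rewrite inE => /andP[_ /andP[/eqP]].
  exists J; first by apply: subset_trans sJ _; apply/subsetP => x; rewrite !inE => /andP[].
  rewrite h2; split=> //; rewrite inE h1 h2 ck eqxx /=.
  apply/existsP; exists f; apply/existsP; exists r; rewrite tf /=; apply/andP; split.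
    apply/eqP/setP => x; rewrite !inE; have := subsetP sT x; rewrite inE.
    by case: (x \in tree_edges val f) => [/(_ isT)/andP[-> ->]//|_]; case: (x \in E); case: (x \subset _).
  apply/negP => nf; move: EA; rewrite inE => /andP[_ /andP[_ /negP]]; apply.
  apply/existsP; exists f; apply/existsP; exists r; rewrite tf nf ce ck ltn_add2l ltn_ord !andbT /=.
  by apply: subset_trans sT _; apply/subsetP => x; rewrite !inE => /andP[].
apply: (@leq_trans #|\bigcup_(e < j) layer e|); last first.
  apply: (big_ind2 (fun (X : {set {set {set 'I_n}}}) x => #|X| <= x)) => //; first by rewrite cards0.
  by move=> X x Y y hX hY; apply: leq_trans (leq_card_setU _ _) _; exact: leq_add.
apply: subset_leq_card; apply/subsetP => E EAb; have := EAb; rewrite in_setD => /andP[nb EA].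
have [f [r [tf sT cT]]] := span E EA; have := subset_leq_card sT; rewrite cT => h1.
have h2 : #|inner (largest_comp E) E| < k.-1 + j.
  by rewrite ltnNge; apply/negP => h; move: nb; rewrite inE EA h.
have ej : #|inner (largest_comp E) E| - k.-1 < j by rewrite ltn_subLR.
by apply/bigcupP; exists (Ordinal ej) => //; rewrite inE EAb /= subnKC.
Qed.

End Exchange.

(** * Patterns and balls *)

Section Pattern.
Variables (D : finType) (r : D) (p : D -> D) (dep : D -> nat) (L : nat).
Hypotheses (dep_root : dep r = 0) (parent_root : p r = r).
Hypothesis dep_parent : forall x, x != r -> dep x = (dep (p x)).+1.
Implicit Types (x y : D).

(** The condition [x != y] removes the loop caused by [p r = r]. *)
Definition nb x y := (x != y) && ((p x == y) || (p y == x)).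

Lemma nb_sym : symmetric nb.
Proof. by move=> x y; rewrite /nb eq_sym orbC. Qed.

Lemma parent_neq x : x != r -> p x != x.
Proof. by move=> /dep_parent e; apply/eqP => e'; move: e; rewrite e'; lia. Qed.

Lemma nb_parent x : x != r -> nb x (p x).
Proof. by move=> xr; rewrite /nb eq_sym (parent_neq xr) eqxx. Qed.

Lemma nb_dep x y : nb x y -> dep y <= (dep x).+1.
Proof.
move=> /andP[xy /orP[/eqP e|/eqP e]].
  have [xr|xr] := eqVneq x r; first by move: xy; rewrite -e xr parent_root eqxx.
  by have := dep_parent xr; rewrite e; lia.
have [yr|yr] := eqVneq y r; first by rewrite yr dep_root.
by have := dep_parent yr; rewrite e; lia.
Qed.

Section Exact.
Variables (V : finType) (e : rel V).
Implicit Types (phi : D -> V).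

(** Pattern vertices of depth [L] may have further neighbours, so an exact copy determines only
    balls of radius less than [L]. *)
Definition exact phi := injective phi /\
  forall x z, dep x < L -> e (phi x) z = [exists y, (z == phi y) && nb x y].

Lemma exact_nb phi x y : exact phi -> dep x < L -> e (phi x) (phi y) = nb x y.
Proof.
move=> [ip ex] xL; rewrite ex//; apply/existsP/idP => [[y' /andP[/eqP/ip -> //]]|h].
by exists y; rewrite eqxx.
Qed.

Definition nbrs z := [set w | e z w].

(** Ends of walks of length [d] that step only out of vertices of degree at most [k]. The cap on
    degrees bounds their number by [k ^ d] in any graph. *)
Fixpoint near_sphere (k d : nat) z : {set V} :=
  if d is d'.+1 then \bigcup_(y in near_sphere k d' z | #|nbrs y| <= k) nbrs y else [set z].

Definition near_ball k l z := \bigcup_(d < l) near_sphere k d z.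

Lemma card_near_sphere k d z : #|near_sphere k d z| <= k ^ d.
Proof.
elim: d => [|d IH] /=; first by rewrite cards1.
apply: (@leq_trans (\sum_(y in near_sphere k d z | #|nbrs y| <= k) #|nbrs y|)).
  apply: (big_ind2 (fun (A : {set V}) m => #|A| <= m)) => [|A a B b Aa Bb|//].
    by rewrite cards0.
  by apply: leq_trans (leq_card_setU _ _) _; exact: leq_add.
apply: (@leq_trans (\sum_(y in near_sphere k d z) k)).
  by rewrite big_mkcondr /=; apply: leq_sum => y _; case: ifP.
by rewrite sum_nat_const expnSr leq_mul2r IH orbT.
Qed.

Lemma card_near_ball k l z : #|near_ball k l z| <= \sum_(d < l) k ^ d.
Proof.
apply: (@leq_trans (\sum_(d < l) #|near_sphere k d z|)).
  apply: (big_ind2 (fun (A : {set V}) m => #|A| <= m)) => [|A a B b Aa Bb|//].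
    by rewrite cards0.
  by apply: leq_trans (leq_card_setU _ _) _; exact: leq_add.
by apply: leq_sum => d _; exact: card_near_sphere.
Qed.

(* Interior vertices of an exactly embedded pattern have at most #|D|
   neighbours, so the root is reached from any of them through few choices. *)
Lemma exact_near phi x : exact phi -> dep x < L -> phi r \in near_ball #|D| L (phi x).
Proof.
move=> ex xL; have H d y : dep y = d -> d < L -> forall z k,
    phi y \in near_sphere #|D| k z -> phi r \in near_sphere #|D| (k + d) z.
  elim: d y => [|d IH] y yd dL z k h.
    have [<-|yr] := eqVneq y r; first by rewrite addn0.
    by have := dep_parent yr; rewrite yd.
  have [yr|yr] := eqVneq y r; first by rewrite yr dep_root in yd.
  have := dep_parent yr; rewrite yd => -[pd].
  rewrite addnS -addSn; apply: (IH (p y)) => //; first exact: ltnW.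
  apply/bigcupP; exists (phi y); last by rewrite inE exact_nb ?yd ?nb_parent.
  rewrite h /=; apply: leq_trans (leq_imset_card phi _).
  apply: subset_leq_card; apply/subsetP => w; rewrite inE ex.2 ?yd// => /existsP[y' /andP[/eqP-> _]].
  exact: imset_f.
apply/bigcupP; exists (Ordinal xL) => //=.
by apply: (H _ x erefl xL _ 0); rewrite /= inE.
Qed.

End Exact.

Section Ball.
Variables (n : nat) (E : {set {set 'I_n}}) (U : {set 'I_n}) (phi : D -> 'I_n).
Hypotheses (ex : exact (adj_in E U) phi) (rU : phi r \in U).

Lemma reach_exact i : i <= L -> reach E U (phi r) i = [set phi x | x in [set x | dep x <= i]].
Proof.
elim: i => [_|i IH iL] /=.
  rewrite (setIidPl _) ?sub1set//; apply/setP => z; rewrite inE.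
  apply/eqP/imsetP => [->|[x]]; first by exists r; rewrite ?inE ?dep_root.
  rewrite inE leqn0 => /eqP x0 ->; have [->//|/dep_parent] := eqVneq x r.
  by rewrite x0.
rewrite IH ?(ltnW iL)//; apply/setP => z; rewrite in_setU inE; apply/orP/imsetP.
  case=> [/imsetP[x]|/existsP[w /andP[/imsetP[x]]]]; rewrite inE => xi ->.
    by exists x; rewrite // inE leqW.
  rewrite ex.2 ?(leq_ltn_trans xi)// => /existsP[y /andP[/eqP-> /nb_dep xy]].
  by exists y; rewrite // inE (leq_trans xy).
move=> [x]; rewrite inE leq_eqVlt => /orP[/eqP xi|xi] ->; last first.
  by left; apply: imset_f; rewrite inE.
right; apply/existsP; have xr : x != r by apply: contra_eqN xi => /eqP ->; rewrite dep_root.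
have := dep_parent xr; rewrite xi => -[pi].
exists (phi (p x)); apply/andP; split; first by apply: imset_f; rewrite inE pi.
by rewrite (exact_nb _ ex) -?pi// nb_sym nb_parent.
Qed.

(** Since [l < L], the vertices at depth [l] are interior, so the edges among them are known as
    well. *)
Lemma ball_iso_exact l (VH : finType) (eH : rel VH) (rH : VH) : l < L ->
  ball_iso E U (phi r) l eH rH <->
  exists g : VH -> D, [/\ injective g, forall u, dep (g u) <= l,
    forall y, dep y <= l -> exists u, g u = y, g rH = r & forall u w, eH u w = nb (g u) (g w)].
Proof.
move=> lL; rewrite /ball_iso (reach_exact (ltnW lL)).
have inj := ex.1; split=> [[f [fi fB fr fe]]|[g [gi gd gs gr ge]]].
  have [g hg] : exists g : VH -> D, forall h, (dep (g h) <= l) && (f (phi (g h)) == h).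
    apply: (@fin_all_exists _ (fun _ => D) (fun h y => (dep y <= l) && (f (phi y) == h))) => h.
    have : h \in [set: VH] by [].
    rewrite -fB => /imsetP[z /imsetP[y]]; rewrite inE => yl -> ->.
    by exists y; rewrite yl eqxx.
  have gd h : dep (g h) <= l by have /andP[] := hg h.
  have fg h : f (phi (g h)) = h by have /andP[_ /eqP] := hg h.
  have inB y : dep y <= l -> phi y \in [set phi x | x in [set x | dep x <= l]].
    by move=> yl; apply: imset_f; rewrite inE.
  exists g; split=> //.
  - by move=> x y e; rewrite -(fg x) e fg.
  - move=> y yl; exists (f (phi y)); apply: inj; apply: fi; rewrite ?inB ?gd//.
  - by apply: inj; apply: fi; rewrite ?inB ?gd ?dep_root// fg fr.
  - move=> x y; rewrite -{1}(fg x) -{1}(fg y) fe ?inB ?gd// (exact_nb _ ex)//.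
    exact: leq_ltn_trans (gd x) lL.
(* Left inverse of [phi \o g], with default value [rH] outside the ball. *)
pose f v := odflt rH [pick h | phi (g h) == v].
have fg h : f (phi (g h)) = h.
  rewrite /f; case: pickP => [h' /eqP/inj/gi //|/(_ h)]; by rewrite eqxx.
have gB v : v \in [set phi x | x in [set x | dep x <= l]] -> exists h, v = phi (g h).
  by move=> /imsetP[y]; rewrite inE => /gs[h <-] ->; exists h.
exists f; split.
- by move=> u v /gB[h ->] /gB[h' ->]; rewrite !fg => ->.
- apply/setP => h; rewrite inE; apply/imsetP; exists (phi (g h)); rewrite ?fg//.
  by apply: imset_f; rewrite inE.
- by rewrite -gr fg.
- move=> u v /gB[h ->] /gB[h' ->]; rewrite !fg ge (exact_nb _ ex)//.
  exact: leq_ltn_trans (gd h) lL.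
Qed.

End Ball.
End Pattern.

(** * Injections that are increasing on given groups *)

Section Increasing.
Variables (D V : finType) (G : seq {set D}) (ord : D -> nat) (rk : V -> nat).
Hypothesis disjG : forall i j, i < size G -> j < size G -> i != j ->
  [disjoint (nth set0 G i) & (nth set0 G j)].
Implicit Types (S : {set D}) (phi : {ffun D -> V}).

Definition inc_on S phi := [forall x in S, forall y in S, (ord x < ord y) ==> (rk (phi x) <= rk (phi y))].
(* Increasing siblings make a rooted copy of a plane tree unique. *)
Definition inc_embeddings (s : seq {set D}) :=
  [set phi : {ffun D -> V} | injectiveb phi && all (fun S => inc_on S phi) s].

(** Rearrangement inequality: a permutation of [S] that maximizes [F] has no inversion, as undoing
    one would increase [F]. *)
Lemma sort_on S phi : exists2 s : {perm D}, perm_on S s & inc_on S [ffun x => phi (s x)].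
Proof.
pose F (s : {perm D}) := \sum_x ord x * rk (phi (s x)).
have P1 : perm_on S (1%g : {perm D}) by apply: perm_on1.
case: (@arg_maxnP _ (1%g : {perm D}) (fun s => perm_on S s) F P1) => s Ps smax.
exists s => //; apply/forall_inP => x xS; apply/forall_inP => y yS; apply/implyP => lt.
rewrite !ffunE leqNgt; apply/negP => inv.
have xy : y != x by apply: contraTneq lt => ->; rewrite ltnn.
pose s' := (tperm x y * s)%g.
have Ps' : perm_on S s'.
  by apply: perm_onM => //; apply/subsetP => z; rewrite inE; case: tpermP => [->|->|_ _ /eqP].
have := smax s' Ps'; apply/negP; rewrite -ltnNge /F.
rewrite (bigD1 x)//= (bigD1 y)//= [X in _ < X](bigD1 x)//= [X in _ < _ + X](bigD1 y)//=.
rewrite /s' !permM tpermL tpermR.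
rewrite [X in _ < _ + (_ + X)](eq_bigr (fun z => ord z * rk (phi (s z)))); last first.
  by move=> z /andP[zx zy]; rewrite permM tpermD// eq_sym.
move: inv lt; set a := rk (phi (s x)); set b := rk (phi (s y)).
set c := ord x; set d := ord y; move=> h1 h2; rewrite !addnA ltn_add2r; nia.
Qed.

(** Every embedding is one that increases on [S], composed with a permutation of [S]; groups
    disjoint from [S] are unaffected. *)
Lemma card_inc_step (s : seq {set D}) S : (forall T : {set D}, T \in s -> [disjoint T & S]) ->
  #|inc_embeddings s| <= #|inc_embeddings (S :: s)| * (#|S|)`!.
Proof.
move=> dis; rewrite -(card_perm S) -[#|perm_on S|]cardsE -cardsX.
pose h (q : {ffun D -> V} * {perm D}) : {ffun D -> V} := [ffun x => q.1 (q.2^-1%g x)].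
apply: leq_trans (leq_imset_card h _); apply: subset_leq_card; apply/subsetP => phi.
rewrite inE => /andP[/injectiveP ip /allP inc].
have [t Pt it] := sort_on S phi; apply/imsetP; exists ([ffun x => phi (t x)], t); last first.
  by apply/ffunP => x; rewrite !ffunE /= permKV.
rewrite inE; apply/andP; split; last by rewrite inE.
rewrite inE /= it /=; apply/andP; split.
  by apply/injectiveP => x y; rewrite !ffunE => /ip /perm_inj.
apply/allP => T Ts; have /forall_inP iT := inc T Ts.
have fix1 x : x \in T -> t x = x.
  by move=> xT; apply: (out_perm Pt); rewrite (disjointFr (dis T Ts) xT).
apply/forall_inP => x xT; apply/forall_inP => y yT; rewrite !ffunE !fix1//.
by have /forall_inP := iT x xT; apply.
Qed.

Lemma card_inc_embeddings :
  #|V| ^_ #|D| <= #|inc_embeddings G| * \prod_(S <- G) (#|S|)`!.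
Proof.
rewrite -card_inj_ffuns; have -> : [set f : {ffun D -> V} | injectiveb f] = inc_embeddings [::].
  by apply/setP => f; rewrite !inE andbT.
have [k] : exists k, k = size G by exists (size G).
elim: G disjG k => [|S s IH] dis k _; first by rewrite big_nil muln1.
rewrite big_cons mulnA; apply: leq_trans (IH _ (size s) erefl) _.
  by move=> i j isz jsz ij; apply: (dis i.+1 j.+1).
rewrite leq_mul2r card_inc_step ?orbT// => T Ts.
have iT := index_mem T s; rewrite Ts in iT.
by have := dis (index T s).+1 0 iT isT isT; rewrite /= nth_index.
Qed.

End Increasing.

(** * Plane forests *)

Notation node := (nat * seq nat)%type.
Notation forest := (seq {fset (seq nat)}).

Section PlaneForests.
Local Open Scope fset_scope.
Implicit Types (A : {fset (seq nat)}) (As : forest) (u v : seq nat) (q : node).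

Lemma take_belast_rcons u i : take (size (rcons u i)).-1 (rcons u i) = u.
Proof. by rewrite size_rcons /= -cats1 take_size_cat. Qed.

Lemma tchildP u v : reflect (exists i, v = rcons u i) (tchild u v).
Proof.
apply: (iffP andP) => [[/eqP sz /eqP tk]|[i ->]]; last first.
  by rewrite size_rcons eqxx -cats1 take_size_cat.
case: (lastP v) sz tk => [//|w i]; rewrite size_rcons => -[sz].
by rewrite -cats1 -sz take_size_cat// => ->; exists i; rewrite cats1.
Qed.

Lemma UHtree_children A u i : UHtree A -> (rcons u i \in A) = (i < nchildren A u).
Proof.
move=> [_ cl]; pose C := [fset v in A | tchild u v].
have inC j : rcons u j \in C = (rcons u j \in A).
  by rewrite !inE; case: (_ \in A) => //=; apply/tchildP; exists j.
have uq k : uniq [seq rcons u j | j <- iota 0 k].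
  by rewrite map_inj_uniq ?iota_uniq// => a b /rcons_inj[].
apply/idP/idP => [uA|]; rewrite /nchildren -/C.
  rewrite -(size_iota 0 i.+1) -(size_map (rcons u)).
  apply: uniq_leq_size (uq _) _ => v /mapP[j]; rewrite mem_iota add0n => /andP[_ ji] ->.
  by rewrite inC; have [_ ] := cl u i uA; apply; rewrite -ltnS.
move=> lt; apply: contraLR lt => nuA; rewrite -leqNgt.
rewrite -[X in _ <= X](size_iota 0 i) -(size_map (rcons u)).
apply: uniq_leq_size (fset_uniq _) _ => v vC.
have : v \in C by [].
rewrite !inE => /andP[vA /tchildP[j ev]]; rewrite ev in vA *.
apply: map_f; rewrite mem_iota add0n ltnNge; apply: contra nuA => ij.
by have [_] := cl u j vA; apply.
Qed.

Definition nodes As : {fset node} :=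
  seq_fset tt (flatten [seq [seq (i, u) | u <- enum_fset (nth fset0 As i)] | i <- iota 0 (size As)]).

Lemma in_nodes As q : (q \in nodes As) = (q.1 < size As) && (q.2 \in nth fset0 As q.1).
Proof.
rewrite seq_fsetE; apply/flatten_mapP/andP => [[i]|[h1 h2]].
  by rewrite mem_iota add0n => /andP[_ iA] /mapP[u uA ->].
exists q.1; first by rewrite mem_iota.
by case: q h1 h2 => i u /= _ h; apply: map_f.
Qed.

(** Covers both limits: a single tree is a Galton--Watson pattern, and [L.+1] trees hung on a spine
    form a ball of the Skeleton tree. *)
Definition valid_forest (L : nat) As := [/\ 0 < size As, size As <= L.+1 &
  forall i, i < size As -> UHtree (nth fset0 As i) /\ depth_le (nth fset0 As i) (L - i)].

(** The root of a tree hangs from the previous root on the spine; [0.-1 = 0] makes the overall root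
    its own parent. *)
Definition par q : node :=
  if q.2 is [::] then (q.1.-1, [::]) else (q.1, take (size q.2).-1 q.2).

Definition root_node : node := (0, [::]).

Lemma par_rcons i u j : par (i, rcons u j) = (i, u).
Proof.
by rewrite /par /= take_belast_rcons; case: (rcons u j) (size_rcons u j).
Qed.

Section Concrete.
Variables (L : nat) (As : forest).
Hypothesis vA : valid_forest L As.

Lemma root_in : root_node \in nodes As.
Proof. by rewrite in_nodes; case: vA => s0 _ /(_ 0 s0)[[h _] _]; rewrite s0. Qed.

Lemma par_in q : q \in nodes As -> par q \in nodes As.
Proof.
rewrite !in_nodes; case: vA => s0 _ h; case: q => i u /= /andP[iA uA].
case: (lastP u) uA => [_|w j wA].
  have lt : i.-1 < size As by apply: leq_ltn_trans iA; rewrite leq_pred.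
  by rewrite /par /= lt; have [[]] := h _ lt.
by rewrite par_rcons /= iA; have [[_ /(_ w j wA)[]]] := h _ iA.
Qed.

Definition rootD : nodes As := [` root_in].
Definition parD (x : nodes As) : nodes As := [` par_in (valP x)].
Definition depD (x : nodes As) : nat := (val x).1 + size (val x).2.

Lemma depD_root : depD rootD = 0. Proof. by []. Qed.

Lemma parD_root : parD rootD = rootD. Proof. exact: val_inj. Qed.

Lemma depD_par x : x != rootD -> depD x = (depD (parD x)).+1.
Proof.
rewrite /depD -(inj_eq val_inj) /=; case: (val x) => i u /=.
case: (lastP u) => [|w j _]; first by case: i => //= i _; rewrite /par /= addn0 addn0.
by rewrite par_rcons /= size_rcons addnS.
Qed.

Lemma depD_le x : depD x <= L.
Proof.
rewrite /depD; case: (val x) (valP x) => i u /=; rewrite in_nodes => /andP[iA uA].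
case: vA => s0 sL /(_ _ iA)[_ /(_ _ uA)]; move: iA sL => /=; lia.
Qed.

Lemma nbD x y : nb parD x y = skel_edge (val x) (val y).
Proof.
rewrite /nb -!(inj_eq val_inj) /=; case: (val x) (val y) => i u [j v]; rewrite /skel_edge /=.
have par0 k : par (k, [::]) = (k.-1, [::]) by [].
have tch w k t : tchild w (rcons t k) = (t == w).
  by apply/tchildP/eqP => [[m /rcons_inj[]]//|->]; exists k.
have tc0 w : tchild w [::] = false by apply/tchildP => -[k]; case: w.
have nr w (k : nat) : ([::] == rcons w k) = false by case: w.
have rn w (k : nat) : (rcons w k == [::]) = false by case: w.
rewrite /tedge; case: (lastP u) => [|u' a]; case: (lastP v) => [|v' b];
  rewrite ?par_rcons ?par0 ?tch ?tc0 ?nr ?rn ?andbF ?orbF ?andbT /= -!pair_eqE /= ?nr ?rn ?eqxx ?andbF ?andbT ?orbF ?orFb /=.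
- by lia.
- rewrite (eq_sym j) andbC; case: (eqVneq i j) => //= _.
  by rewrite andbC.
have nn (w : seq nat) k : (w == rcons w k) = false.
  by apply/eqP => /(congr1 size); rewrite size_rcons; lia.
rewrite (eq_sym j); case: (eqVneq i j) => //= _; rewrite eqseq_rcons.
by case: (eqVneq u' v') => [->|_] /=; [rewrite !nn andbF|rewrite orbC].
Qed.

(** The next spine vertex has an empty address and is excluded, because it is not among the Poisson
    offspring. *)
Definition kids (x : nodes As) : {set nodes As} :=
  [set y | ((val y).2 != [::]) && (parD y == x)].

Lemma kidsP x y : reflect (exists j, val y = ((val x).1, rcons (val x).2 j)) (y \in kids x).
Proof.
rewrite inE -(inj_eq val_inj) /=; apply: (iffP andP) => [[]|[j ->]].
  case: (val y) => i u /=; case: (lastP u) => [//|w j _]; rewrite par_rcons => /eqP <-.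
  by exists j.
by rewrite par_rcons /=; case: (val x) => i u /=; split=> //; case: u.
Qed.

Lemma card_kids x : #|kids x| = nchildren (nth fset0 As (val x).1) (val x).2.
Proof.
have xin := valP x; rewrite in_nodes in xin; have /andP[iA uA] := xin.
have [_ _ /(_ _ iA)[uh _]] := vA.
set c := nchildren _ _.
pose h (j : 'I_c) : nodes As := insubd rootD ((val x).1, rcons (val x).2 j).
have hv j : val (h j) = ((val x).1, rcons (val x).2 j).
  by rewrite insubdK// in_nodes /= iA (UHtree_children _ _ uh) ltn_ord.
rewrite -[RHS]card_ord -[RHS]cardsT -(card_imset _ (_ : injective h)).
  congr #|pred_of_set _|; apply/setP => y; apply/kidsP/imsetP => [[j ey]|[j _ ->]].
    have jc : j < c.
      by have := valP y; rewrite ey in_nodes /= iA (UHtree_children _ _ uh).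
    by exists (Ordinal jc) => //; apply: val_inj; rewrite ey hv.
  by exists (nat_of_ord j); rewrite hv.
by move=> j j' /(congr1 val); rewrite !hv => -[/rcons_inj[]] /val_inj.
Qed.

Definition kid_groups := [seq kids x | x <- enum {: nodes As}].
Definition last_index (y : nodes As) : nat := last 0 (val y).2.

Lemma disjoint_kids x x' : x != x' -> [disjoint kids x & kids x']%B.
Proof.
move=> xx'; apply/pred0P => y /=; apply/negP; rewrite !inE => /andP[/andP[_ /eqP e] /andP[_ /eqP e']].
by rewrite -e -e' eqxx in xx'.
Qed.

Definition embeddings (V : finType) (rk : V -> nat) := inc_embeddings last_index rk kid_groups.

Lemma card_embeddings (V : finType) (rk : V -> nat) :
  #|V| ^_ #|{: nodes As}| <= #|embeddings rk| * \prod_(x : nodes As) (#|kids x|)`!.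
Proof.
have := @card_inc_embeddings _ V kid_groups last_index rk.
rewrite big_map big_enum; apply => i j; rewrite size_map => il jl ij.
rewrite !(nth_map rootD) -?enumT//; apply: disjoint_kids.
by rewrite nth_uniq ?enum_uniq.
Qed.

End Concrete.

(** * A copy is determined by the image of its root *)

Section Explore.
Variables (V : finType) (rk : V -> nat) (kid : V -> {set V}) (next : V -> V) (L : nat).
Hypothesis rk_inj : injective rk.

(** A copy as seen by a search from its root. For graphs [kid] is the neighbourhood; for maps [kid]
    is the preimage and [next], which follows the spine, is the map itself. The parent is excluded
    from the children in both cases. *)
Definition explored As (phi : node -> V) := [/\
  {in nodes As &, injective phi},
  forall i u, (i, u) \in nodes As -> i + size u < L -> forall z,
    (z \in kid (phi (i, u))) && (((i, u) == root_node) || (z != phi (par (i, u)))) <->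
    exists2 j, rcons u j \in nth fset0 As i & z = phi (i, rcons u j),
  forall i, i.+1 < size As -> phi (i.+1, [::]) = next (phi (i, [::])) &
  forall i u j j', (i, rcons u j) \in nodes As -> (i, rcons u j') \in nodes As ->
    j < j' -> rk (phi (i, rcons u j)) < rk (phi (i, rcons u j'))].

(** Induction on depth: the two copies of a vertex have the same set of children, and both list it
    in strictly increasing order of [rk], so the lists coincide. *)
Lemma explored_sub As1 As2 phi1 phi2 : valid_forest L As1 -> valid_forest L As2 ->
  size As1 = size As2 -> explored As1 phi1 -> explored As2 phi2 -> phi1 root_node = phi2 root_node ->
  forall q, q \in nodes As1 -> q \in nodes As2 /\ phi1 q = phi2 q.
Proof.
move=> v1 v2 es [i1 k1 n1 s1] [i2 k2 n2 s2] er.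
have H d : forall q, q.1 + size q.2 <= d -> q \in nodes As1 -> q \in nodes As2 /\ phi1 q = phi2 q.
  elim: d => [|d IH] [i u] /=.
    by rewrite leqn0 addn_eq0 size_eq0 => /andP[/eqP-> /eqP->] _; split; [exact: (root_in v2)|exact: er].
  case: (lastP u) => [|w j].
    case: i => [|i]; first by split; [exact: (root_in v2)|exact: er].
    rewrite addn0 ltnS => id; rewrite !in_nodes /= => /andP[iA _].
    have [_ _ /(_ i.+1)] := v2; rewrite -es iA => /(_ isT)[[-> _] _]; split=> //.
    rewrite n1// n2 -?es//; congr next; apply: (IH (i, [::]) _ _).2; rewrite ?addn0//.
    by have := par_in v1 (_ : (i.+1, [::]) \in nodes As1); apply; rewrite in_nodes /= iA; have [_ _ /(_ _ iA)[[]]] := v1.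
  rewrite size_rcons addnS ltnS => id wj1.
  have w1 : (i, w) \in nodes As1 by have := par_in v1 wj1; rewrite par_rcons.
  have [w2 ew] := IH (i, w) id w1.
  have iL : i + size w < L.
    move: wj1; rewrite in_nodes => /andP[iA wA]; have [_ _ /(_ _ iA)[_ /(_ _ wA)]] := v1.
    rewrite /= size_rcons; lia.
  have ep : (i, w) <> root_node -> phi1 (par (i, w)) = phi2 (par (i, w)).
    move=> nr; apply: (IH _ _ (par_in v1 w1)).2; apply: leq_trans id.
    rewrite /par /=; case: (w) => [|a w']; first by rewrite !addn0 leq_pred.
    by rewrite leq_add2l size_takel// leqW.
  have [iA1 _] : i < size As1 /\ True by move: w1; rewrite in_nodes => /andP[].
  have iA2 : i < size As2 by rewrite -es.
  have [uh1 _] : UHtree (nth fset0 As1 i) /\ depth_le (nth fset0 As1 i) (L - i) by have [_ _ /(_ _ iA1)] := v1.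
  have [uh2 _] : UHtree (nth fset0 As2 i) /\ depth_le (nth fset0 As2 i) (L - i) by have [_ _ /(_ _ iA2)] := v2.
  set c1 := nchildren (nth fset0 As1 i) w; set c2 := nchildren (nth fset0 As2 i) w.
  pose S1 := [seq rk (phi1 (i, rcons w j)) | j <- iota 0 c1].
  pose S2 := [seq rk (phi2 (i, rcons w j)) | j <- iota 0 c2].
  have sorted_gen (phi : node -> V) (As : forest) : i < size As -> UHtree (nth fset0 As i) ->
      (forall i u j j', (i, rcons u j) \in nodes As -> (i, rcons u j') \in nodes As ->
       j < j' -> rk (phi (i, rcons u j)) < rk (phi (i, rcons u j'))) ->
      sorted ltn [seq rk (phi (i, rcons w j)) | j <- iota 0 (nchildren (nth fset0 As i) w)].
    move=> iA uh sphi; set c := nchildren _ _.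
    apply: (@homo_sorted_in _ _ (fun a => a < c) _ ltn ltn); last exact: iota_ltn_sorted.
      by move=> a b aA bA; apply: sphi; rewrite in_nodes /= iA UHtree_children.
    by apply/allP => a; rewrite mem_iota.
  have sub (phi phi' : node -> V) (As As' : forest) : i < size As -> i < size As' ->
     UHtree (nth fset0 As i) -> UHtree (nth fset0 As' i) ->
     (i, w) \in nodes As -> (i, w) \in nodes As' -> phi (i, w) = phi' (i, w) ->
     ((i, w) <> root_node -> phi (par (i, w)) = phi' (par (i, w))) ->
     (forall z, (z \in kid (phi (i, w))) && (((i, w) == root_node) || (z != phi (par (i, w)))) <->
      exists2 j, rcons w j \in nth fset0 As i & z = phi (i, rcons w j)) ->
     (forall z, (z \in kid (phi' (i, w))) && (((i, w) == root_node) || (z != phi' (par (i, w)))) <->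
      exists2 j, rcons w j \in nth fset0 As' i & z = phi' (i, rcons w j)) ->
     {subset [seq rk (phi (i, rcons w j)) | j <- iota 0 (nchildren (nth fset0 As i) w)] <=
       [seq rk (phi' (i, rcons w j)) | j <- iota 0 (nchildren (nth fset0 As' i) w)]}.
    move=> iA iA' uh uh' wA wA' e e' k k' x /mapP[a]; rewrite mem_iota add0n /= => aA ->.
    have /k : exists2 j, rcons w j \in nth fset0 As i & phi (i, rcons w a) = phi (i, rcons w j).
      by exists a; rewrite // UHtree_children.
    rewrite e => /andP[h1 h2].
    have /k'[b bA' ->] : (phi (i, rcons w a) \in kid (phi' (i, w))) && (((i, w) == root_node) || (phi (i, rcons w a) != phi' (par (i, w)))).
      by rewrite h1 /=; case: eqP h2 => //= nr; rewrite e'.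
    by apply: map_f; rewrite mem_iota add0n /= -UHtree_children.
  have eS : S1 = S2.
    apply: (irr_sorted_eq ltn_trans ltnn).
    - exact: sorted_gen.
    - exact: sorted_gen.
    move=> x; apply/idP/idP.
      by apply: sub => //; [exact: k1|exact: k2].
    by apply: sub => //; [move/ep|exact: k2|exact: k1].
  have ec : c1 = c2 by have := congr1 size eS; rewrite !size_map !size_iota.
  have jc : j < c1 by move: wj1; rewrite in_nodes /= iA1 UHtree_children.
  split; first by rewrite in_nodes /= iA2 UHtree_children// -/c2 -ec.
  apply: rk_inj; have := congr1 (fun s => nth 0 s j) eS.
  by rewrite /S1 /S2 !(nth_map 0) ?size_iota -?ec// !nth_iota -?ec.
by move=> q; apply: H (leqnn _).
Qed.

Lemma explored_uniq As1 As2 phi1 phi2 : valid_forest L As1 -> valid_forest L As2 ->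
  size As1 = size As2 -> explored As1 phi1 -> explored As2 phi2 -> phi1 root_node = phi2 root_node ->
  As1 = As2 /\ {in nodes As1, phi1 =1 phi2}.
Proof.
move=> v1 v2 es e1 e2 er.
have h12 := explored_sub v1 v2 es e1 e2 er.
have h21 := explored_sub v2 v1 (esym es) e2 e1 (esym er).
split; last by move=> q /h12[].
apply: (@eq_from_nth _ fset0) => // i iA; apply/fsetP => u.
have iA2 : i < size As2 by rewrite -es.
apply/idP/idP => uA.
  by have [] := h12 (i, u); rewrite !in_nodes /= ?iA ?iA2.
by have [] := h21 (i, u); rewrite !in_nodes /= ?iA ?iA2.
Qed.

End Explore.

(** * Truncated patterns against the finite trees of the limit laws *)

Section Isomorphism.
Variables (L l : nat) (As : forest) (VH : finType) (eH : rel VH) (rH : VH).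
Hypothesis vA : valid_forest L As.

Definition pattern_iso := exists g : VH -> nodes As, [/\ injective g, forall a, depD (g a) <= l,
    forall y, depD y <= l -> exists a, g a = y, g rH = rootD vA &
    forall a b, eH a b = nb (parD vA) (g a) (g b)].

Lemma pattern_skel_iso (Bs : forest) :
  (forall q, (q \in nodes As) && (q.1 + size q.2 <= l) = (q.1 <= l) && (q.2 \in nth fset0 Bs q.1)) ->
  pattern_iso <-> skel_iso l Bs eH rH.
Proof.
move=> h; split=> [[g [gi gd gs gr ge]]|[f [fi fd fs fr fe]]].
  exists (fun x => val (g x)); split.
  - by move=> x y /val_inj/gi.
  - by move=> x; have := h (val (g x)); rewrite (valP (g x)) /= -/(depD _) gd => /esym/andP.
  - move=> i u il uB; have := h (i, u); rewrite /= il uB /= => /andP[iu d].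
    by have [x gx] := gs [` iu] d; exists x; rewrite gx.
  - by rewrite gr.
  - by move=> x y; rewrite ge nbD.
have inn x : f x \in nodes As.
  by have [h1 h2] := fd x; have := h (f x); rewrite h1 h2 => /andP[].
exists (fun x => [` inn x]); split.
- by move=> x y /(congr1 val) /fi.
- by move=> x; have [h1 h2] := fd x; have := h (f x); rewrite h1 h2 => /andP[].
- move=> y yl; have := h (val y); rewrite (valP y) /= -/(depD _) yl => /esym/andP[h1 h2].
  have [x ex] := fs (val y).1 (val y).2 h1 h2; exists x; apply: val_inj; rewrite /= ex.
  exact: (esym (surjective_pairing _)).
- by apply: val_inj; rewrite /= fr.
- by move=> x y; rewrite nbD fe.
Qed.

Lemma pattern_tree_iso A :
  (forall q, (q \in nodes As) && (q.1 + size q.2 <= l) = (q.1 == 0) && (q.2 \in A)) ->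
  pattern_iso <-> tree_iso A eH rH.
Proof.
move=> h; have sk u v : skel_edge (0, u) (0, v) = tedge u v by rewrite /skel_edge /= !andbF orbF.
split=> [[g [gi gd gs gr ge]]|[f [fi fd fs fr fe]]].
  have g0 x : (val (g x)).1 = 0 /\ (val (g x)).2 \in A.
    by have := h (val (g x)); rewrite (valP (g x)) /= -/(depD _) gd => /esym/andP[/eqP].
  have gp x : val (g x) = (0, (val (g x)).2) by case: (val (g x)) (g0 x) => i u [/= -> _].
  exists (fun x => (val (g x)).2); split.
  - by move=> x y e; apply: gi; apply: val_inj; rewrite gp [RHS]gp e.
  - by move=> x; have [] := g0 x.
  - move=> u uA; have := h (0, u); rewrite /= uA /= => /andP[iu d].
    by have [x gx] := gs [` iu] d; exists x; rewrite gx.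
  - by rewrite gr.
  - by move=> x y; rewrite ge nbD gp [in X in skel_edge _ X]gp sk.
have inn x : (0, f x) \in nodes As by have := h (0, f x); rewrite /= fd => /andP[].
exists (fun x => [` inn x]); split.
- by move=> x y /(congr1 val) [] /fi.
- by move=> x; have := h (0, f x); rewrite /= fd => /andP[].
- move=> y yl; have := h (val y); rewrite (valP y) /= -/(depD _) yl => /esym/andP[/eqP h1 h2].
  have [x ex] := fs (val y).2 h2; exists x; apply: val_inj; rewrite /= ex -h1.
  exact: (esym (surjective_pairing _)).
- by apply: val_inj; rewrite /= fr.
- by move=> x y; rewrite nbD fe /= sk.
Qed.

End Isomorphism.

End PlaneForests.

(** * Structures in a graph *)

Lemma card_family_prod (I X : finType) (F : I -> pred X) :
  #|(family F : simpl_pred {ffun I -> X})| = \prod_i #|F i|.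
Proof. by rewrite card_family foldrE big_map enumT. Qed.

Section Structures.
Variables (L : nat) (As : forest).
Hypothesis vA : valid_forest L As.
Notation D := (nodes As).
Notation r := (rootD vA).
Notation p := (parD vA).
Notation h := #|{: D}|.
Implicit Types (x y : D).

Definition interior := [set x : D | depD x < L].
Definition near_bound := \sum_(d < L) h ^ d.

Definition extend (V : Type) (phi : D -> V) (q : node) := phi (insubd r q).

Lemma extend_val V (phi : D -> V) x : extend phi (val x) = phi x.
Proof. by rewrite /extend valKd. Qed.

Lemma extend_in V (phi : D -> V) q (qD : q \in D) : extend phi q = phi [` qD]%fset.
Proof. by rewrite -(extend_val phi [` qD]%fset). Qed.

Lemma embeddings_inj (V : finType) (rk : V -> nat) phi :
  phi \in embeddings vA rk -> injective phi.
Proof. by rewrite inE => /andP[/injectiveP]. Qed.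

Lemma embeddings_inc (V : finType) (rk : V -> nat) phi : injective rk ->
  phi \in embeddings vA rk -> forall i u j j', (i, rcons u j) \in D -> (i, rcons u j') \in D ->
    j < j' -> rk (extend phi (i, rcons u j)) < rk (extend phi (i, rcons u j')).
Proof.
move=> rki phiE i u j j' jD jD' lt; have ip := embeddings_inj phiE.
rewrite (extend_in _ jD) (extend_in _ jD') ltn_neqAle (inj_eq rki) (inj_eq ip).
have uD : (i, u) \in D by have := par_in vA jD; rewrite par_rcons.
apply/andP; split.
  by apply/eqP => /(congr1 val) [] /rcons_inj[] e; move: lt; rewrite e ltnn.
have inK a (aD : (i, rcons u a) \in D) : [` aD]%fset \in kids vA [` uD]%fset.
  by apply/kidsP; exists a.
move: phiE; rewrite inE => /andP[_ /allP/(_ (kids vA [` uD]%fset))].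
rewrite map_f ?mem_enum// => /(_ isT)/forall_inP/(_ _ (inK j jD))/forall_inP/(_ _ (inK j' jD')).
by rewrite /last_index /= !last_rcons lt.
Qed.

Lemma parD_neq x : x != r -> p x != x.
Proof. exact: (parent_neq (depD_root vA) (@depD_par _ _ vA)). Qed.

Lemma nb_parD x : x != r -> nb p x (p x).
Proof. exact: (nb_parent (depD_root vA) (@depD_par _ _ vA)). Qed.

Lemma kids_nb x y : y \in kids vA x -> nb p x y /\ y != r.
Proof.
move=> yx; have yr : y != r by apply: contraTneq yx => ->; rewrite inE.
split=> //; move: yx; rewrite inE => /andP[_ /eqP <-].
by rewrite nb_sym nb_parD.
Qed.

Lemma parD_depD x : x != r -> depD (p x) < L.
Proof. by move=> /depD_par <-; exact: depD_le. Qed.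

Section Graphs.
Variable n : nat.
Notation V := 'I_n.
Notation rk := (@nat_of_ord n).
Implicit Types (E : {set {set V}}) (v z : V).

Definition has_structure E v := exists phi : {ffun D -> V},
  [/\ phi \in embeddings vA rk, exact p (@depD As) L (adj E) phi & phi r = v].

Lemma exact_explored E (phi : {ffun D -> V}) : size As = 1 -> phi \in embeddings vA rk ->
  exact p (@depD As) L (adj E) phi ->
  explored rk (nbrs (adj E)) id L As (extend phi).
Proof.
move=> sz phiE ex; have ip := embeddings_inj phiE.
have dp := depD_par (vA := vA); split.
- move=> q q' qD qD'; rewrite (extend_in _ qD) (extend_in _ qD') => /ip e.
  exact: (congr1 val e).
- move=> i u uD iL z; rewrite (extend_in _ uD); set x := [` uD]%fset.
  have xL : depD x < L by [].
  have xroot : ((i, u) == root_node) = (x == r) by rewrite -(inj_eq val_inj).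
  have -> : extend phi (par (i, u)) = phi (p x) by rewrite (extend_in _ (par_in vA uD)); congr (phi _); apply: val_inj.
  rewrite inE ex.2// xroot; split=> [/andP[/existsP[y /andP[/eqP -> xy]] h2]|[j uj ->]].
    have yk : y \in kids vA x.
      move: (xy) => /andP[nxy /orP[/eqP e|/eqP e]].
        by move: h2; rewrite -e eqxx orbF => /eqP e'; move: nxy; rewrite -e e' parD_root eqxx.
      rewrite inE e eqxx andbT.
      have yr : y != r by apply: contraNneq nxy => yr; rewrite -e yr parD_root.
      apply: contraNneq yr => y2; apply/eqP/val_inj => /=.
      have := valP y; rewrite in_nodes sz ltnS leqn0 => /andP[/eqP y1 _].
      by rewrite [LHS]surjective_pairing [X in (X, _)]y1 [X in (_, X)]y2.
    have /kidsP[j ey] := yk; exists j; last by rewrite -ey extend_val.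
    by have := valP y; rewrite ey in_nodes => /andP[].
  have jD : (i, rcons u j) \in D by rewrite in_nodes /= uj andbT; by have := uD; rewrite in_nodes => /andP[].
  have yk : [` jD]%fset \in kids vA x by apply/kidsP; exists j.
  have [xy yr] := kids_nb yk; rewrite (extend_in _ jD); apply/andP; split.
    by apply/existsP; exists [` jD]%fset; rewrite eqxx.
  rewrite (inj_eq ip); have [//|xr] := eqVneq x r; apply/eqP => e.
  move: yk; rewrite inE => /andP[_ /eqP e2].
  by have := dp _ xr; have := dp _ yr; rewrite e2 e; lia.
- by move=> i; rewrite sz.
- by move=> i u j j' jD jD'; apply: embeddings_inc => //; exact: ord_inj.
Qed.

(** * Copies in a uniform sequence of edges *)

Section EdgeSequence.
Variable m : nat.
Definition edge := {e : {set V} | #|e| == 2}.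
Implicit Types (w : {ffun 'I_m -> edge}) (phi : {ffun D -> V}).

Definition graph_of w : {set {set V}} := [set val (w i) | i : 'I_m].
Notation D0 := {x : D | x != r}.

(** [iota] records the time at which each tree edge appears. Given [iota], the conditions at
    different times are independent: a prescribed edge at the times in its image, an edge avoiding
    the interior at all others. The sequences thus form a product set. *)
Definition edge_spec phi (iota : {ffun D0 -> 'I_m}) (i : 'I_m) : pred edge :=
  [pred e : edge | if [pick x | iota x == i] is Some x then val e == [set phi (val x); phi (p (val x))]
    else [disjoint val e & [set phi x | x in interior]]%B].

Definition sees phi w := [exists iota : {ffun D0 -> 'I_m}, injectiveb iota && (w \in family (edge_spec phi iota))].

Definition structure_roots w :=
  [set v | [exists phi in embeddings vA rk, (phi r == v) && sees phi w]].

Lemma edge_specP phi (iota : {ffun D0 -> 'I_m}) w : injective iota ->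
  w \in family (edge_spec phi iota) ->
  (forall x : D0, val (w (iota x)) = [set phi (val x); phi (p (val x))]) /\
  (forall i z, z \in val (w i) -> z \in [set phi x | x in interior] -> exists x : D0, i = iota x).
Proof.
move=> ii /familyP fw; split=> [x|i z zi zJ].
  have := fw (iota x); rewrite inE; case: pickP => [y /eqP/ii -> /eqP //|/(_ x)].
  by rewrite eqxx.
have := fw i; rewrite inE; case: pickP => [x /eqP <- _|_]; first by exists x.
by move=> /disjointFr/(_ zi); rewrite zJ.
Qed.

Lemma sees_exact phi w : injective phi -> sees phi w ->
  exact p (@depD As) L (adj (graph_of w)) phi.
Proof.
move=> ip /existsP[iota /andP[/injectiveP ii fw]]; have [h1 h2] := edge_specP ii fw.
split=> // x z xL; apply/imsetP/existsP => [[i _ ei]|[y /andP[/eqP -> /andP[xy]]]].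
  have [y iy] : exists y : D0, i = iota y.
    by apply: (h2 i (phi x)); rewrite -?ei ?set21//; apply: imset_f; rewrite inE.
  move: ei; rewrite iy h1 => /eq_set2[[/ip ex ->]|[/ip ex ->]].
    exists (p (val y)); rewrite eqxx ex /=.
    exact: nb_parD (valP y).
  exists (val y); rewrite eqxx ex /= nb_sym.
  exact: nb_parD (valP y).
move=> /orP[/eqP e|/eqP e].
  have xr : x != r by apply: contraNneq xy => xr; rewrite -e xr parD_root.
  by exists (iota (exist _ x xr)) => //; rewrite h1 /= e.
have yr : y != r by apply: contraNneq xy => yr; rewrite -e yr parD_root.
by exists (iota (exist _ y yr)) => //; rewrite h1 /= e setUC.
Qed.

Lemma structure_roots_sub w v : v \in structure_roots w -> has_structure (graph_of w) v.
Proof.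
rewrite inE => /existsP[phi /and3P[phiE /eqP e s]]; exists phi; split=> //.
by apply: sees_exact => //; exact: embeddings_inj phiE.
Qed.

Lemma sees_uniq (phi phi' : {ffun D -> V}) w : size As = 1 ->
  phi \in embeddings vA rk -> phi' \in embeddings vA rk -> sees phi w -> sees phi' w ->
  phi r = phi' r -> phi = phi'.
Proof.
move=> sz pE pE' s s' er.
have e1 := exact_explored sz pE (sees_exact (embeddings_inj pE) s).
have e2 := exact_explored sz pE' (sees_exact (embeddings_inj pE') s').
have er' : extend phi root_node = extend phi' root_node.
  by rewrite -[root_node]/(val r) !extend_val.
have [_ e] := explored_uniq (@ord_inj n) vA vA erefl e1 e2 er'.
by apply/ffunP => x; rewrite -(extend_val phi) -(extend_val phi') e//; exact: valP.
Qed.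

Lemma card_interior_set phi : injective phi -> #|[set phi x | x in interior]| = #|interior|.
Proof. exact: card_imset. Qed.

Lemma card_edge_spec phi (iota : {ffun D0 -> 'I_m}) : injective phi -> injective iota ->
  #|(family (edge_spec phi iota) : simpl_pred {ffun 'I_m -> edge})| =
  'C(n - #|interior|, 2) ^ (m - h.-1).
Proof.
move=> ip ii; rewrite card_family_prod (bigID (fun i => i \in codom iota)) /=.
rewrite big1 => [|i /codomP[x ->]]; last first.
  have xx : #|[set phi (val x); phi (p (val x))]| == 2.
    rewrite cards2 (inj_eq ip) [val x == _]eq_sym.
    by rewrite (parD_neq (valP x)).
  rewrite (@eq_card _ _ (pred1 (exist (fun e : {set V} => #|e| == 2) _ xx : edge))) ?card1// => e; rewrite !inE.
  case: pickP => [y /eqP/ii ->|/(_ x)]; last by rewrite eqxx.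
  by rewrite -(inj_eq val_inj).
rewrite mul1n (eq_bigr (fun _ => 'C(n - #|interior|, 2))) => [|i ni].
  rewrite prod_nat_const; congr (_ ^ _).
  have -> : #|[pred i | i \notin codom iota]| = #|~: [set i in codom iota]|.
    by apply: eq_card => i; rewrite !inE.
  rewrite cardsCs setCK card_ord cardsE card_codom//.
  by congr (m - _); rewrite card_sig cardC1.
have -> : #|edge_spec phi iota i| = #|[set val e | e in [set e : edge | e \in edge_spec phi iota i]]|.
  by rewrite card_imset ?cardsE//; exact: val_inj.
have -> : n - #|interior| = #|~: [set phi x | x in interior]|.
  by rewrite [RHS]cardsCs setCK card_ord card_interior_set.
rewrite -cards_draws; congr #|pred_of_set _|; apply/setP => e; rewrite inE.
have np : [pick x | iota x == i] = None.
  by case: pickP => // x /eqP xi; rewrite -xi codom_f in ni.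
apply/imsetP/andP => [[e']|[sub c2]].
  rewrite inE unfold_in /= np => dj ->; split; last exact: (valP e').
  by rewrite -disjoints_subset.
exists (exist _ e c2) => //; rewrite inE unfold_in /= np.
by rewrite disjoints_subset.
Qed.

(** Every tree edge has an interior end, so its time lies in the image of the other enumeration;
    matching it there with a reversed edge contradicts the depths. *)
Lemma sees_iota_uniq phi (iota iota' : {ffun D0 -> 'I_m}) w : injective phi ->
  injective iota -> injective iota' ->
  w \in family (edge_spec phi iota) -> w \in family (edge_spec phi iota') -> iota = iota'.
Proof.
move=> ip ii ii' fw fw'; have [h1 h2] := edge_specP ii fw; have [h1' h2'] := edge_specP ii' fw'.
apply/ffunP => x; have [y ey] : exists y : D0, iota x = iota' y.
  apply: (h2' _ (phi (p (val x)))); first by rewrite h1 set22.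
  by apply: imset_f; rewrite inE; apply: parD_depD; exact: (valP x).
have := h1 x; rewrite ey h1' => /eq_set2[[/ip/val_inj -> //]|[/ip e1 /ip e2]].
have := @depD_par _ _ vA _ (valP x); have := @depD_par _ _ vA _ (valP y).
rewrite e2 -e1 => a b; have := etrans a (congr1 S b) => /eqP.
by rewrite -[X in X == _]addn0 -addn2 eqn_add2l.
Qed.

Lemma card_sees phi : injective phi ->
  #|[set w | sees phi w]| >= m ^_ h.-1 * 'C(n - #|interior|, 2) ^ (m - h.-1).
Proof.
move=> ip; pose I := [set iota : {ffun D0 -> 'I_m} | injectiveb iota].
have cI : #|I| = m ^_ h.-1 by rewrite /I card_inj_ffuns card_ord card_sig cardC1.
rewrite -cI -sum_nat_const.
rewrite (eq_bigr (fun iota => #|[set w | w \in family (edge_spec phi iota)]|)); last first.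
  by move=> iota; rewrite inE => /injectiveP ii; rewrite -(card_edge_spec ip ii); apply: eq_card => w; rewrite inE.
rewrite sum_card_pairs; apply: (@card_leq_inj _ _ snd) => [[i w] [i' w']|[i w]].
  rewrite !inE /= => /andP[/injectiveP ii fw] /andP[/injectiveP ii' fw'] e; subst w'.
  by rewrite (sees_iota_uniq ip ii ii' fw fw').
rewrite !inE /= => /andP[h1 h2]; apply/existsP; exists i; rewrite h1; exact: h2.
Qed.

(** By uniqueness of the copy at a root, pairs of an embedding and a sequence seeing it inject into
    pairs of a sequence and a root. *)
Lemma sum_structure_roots : size As = 1 ->
  #|embeddings vA rk| * (m ^_ h.-1 * 'C(n - #|interior|, 2) ^ (m - h.-1)) <=
  \sum_(w : {ffun 'I_m -> edge}) #|structure_roots w|.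
Proof.
move=> sz; rewrite -sum_nat_const.
apply: (@leq_trans (\sum_(phi in embeddings vA rk) #|[set w | sees phi w]|)).
  by apply: leq_sum => phi /embeddings_inj; exact: card_sees.
rewrite (eq_bigl (fun w => w \in [set: {ffun 'I_m -> edge}])); last by move=> w; rewrite inE.
rewrite !sum_card_pairs; apply: (@card_leq_inj _ _ (fun q : {ffun D -> V} * {ffun 'I_m -> edge} => (q.2, q.1 r))) => [[f w] [f' w']|[f w]].
  rewrite inE /= => /andP[fE]; rewrite inE => s.
  rewrite inE /= => /andP[fE']; rewrite inE => s' [e er]; subst w'.
  by rewrite (sees_uniq sz fE fE' s s' er).
rewrite inE /= => /andP[fE]; rewrite inE => s.
rewrite inE /= in_setT /= inE; apply/existsP; exists f.
by rewrite fE eqxx.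
Qed.

(** A copy destroyed by the change has an interior vertex among the at most four ends of the old and
    new edge. Its root is near that end in the sense of [near_ball], so each end spoils at most
    [near_bound] roots. *)
Lemma structure_roots_change w w' i : (forall j, j != i -> w j = w' j) ->
  #|structure_roots w| <= #|structure_roots w'| + 4 * near_bound.
Proof.
move=> ww'; rewrite -leq_subLR.
apply: (@leq_trans #|structure_roots w :\: structure_roots w'|).
  by rewrite cardsD leq_sub2l// subset_leq_card// subsetIr.
pose B := \bigcup_(z in val (w i) :|: val (w' i)) near_ball (adj (graph_of w)) h L z.
apply: (@leq_trans #|B|); last first.
  apply: (@leq_trans (\sum_(z in val (w i) :|: val (w' i)) #|near_ball (adj (graph_of w)) h L z|)).
    apply: (big_ind2 (fun (A : {set V}) m => #|A| <= m)) => [|A a C b Aa Cb|//].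
      by rewrite cards0.
    by apply: leq_trans (leq_card_setU _ _) _; exact: leq_add.
  apply: (@leq_trans (\sum_(z in val (w i) :|: val (w' i)) near_bound)).
    by apply: leq_sum => z _; exact: card_near_ball.
  rewrite sum_nat_const leq_mul2r; apply/orP; right.
  by apply: leq_trans (leq_card_setU _ _) _; rewrite (eqP (valP (w i))) (eqP (valP (w' i))).
apply: subset_leq_card; apply/subsetP => v; rewrite inE => /andP[nv].
rewrite inE => /existsP[phi /and3P[phiE /eqP ev s]]; have ip := embeddings_inj phiE.
have ex := sees_exact ip s; apply/bigcupP.
suff [x xL xin] : exists2 x, depD x < L & phi x \in val (w i) :|: val (w' i).
  exists (phi x) => //; rewrite -ev.
  exact: (exact_near (depD_root vA) (@depD_par _ _ vA) ex xL).
have /existsP[iota /andP[inj fw]] := s; have [h1 h2] := edge_specP (injectiveP _ inj) fw.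
have [/codomP[x ix]|ni] := boolP (i \in codom iota).
  exists (p (val x)); first by apply: parD_depD; exact: (valP x).
  by rewrite inE ix h1 set22.
have [/pred0P dj|/pred0Pn[z /andP[z1 /imsetP[x xJ ez]]]] := boolP [disjoint val (w' i) & [set phi x | x in interior]]%B; last first.
  by exists x; [rewrite inE in xJ|rewrite inE -ez; apply/orP; right; exact: z1].
case/negP: nv; rewrite inE; apply/existsP; exists phi; rewrite phiE ev eqxx /=.
apply/existsP; exists iota; rewrite inj /=; apply/familyP => j.
have [->|ji] := eqVneq j i; last by rewrite -ww'//; move/familyP: fw.
rewrite inE; case: pickP => [x /eqP e|_]; first by rewrite -e codom_f in ni.
exact/pred0P.
Qed.

End EdgeSequence.
End Graphs.
End Structures.

(** * Structures in the graph of a map *)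

Lemma node_spine (q : node) : q.2 = [::] -> q = (q.1, [::]).
Proof. by case: q => i u /= ->. Qed.

Section Maps.
Variables (L : nat) (As : forest).
Hypothesis vA : valid_forest L As.
Hypothesis full_spine : size As = L.+1.
Notation D := (nodes As).
Notation r := (rootD vA).
Notation p := (parD vA).
Notation h := #|{: D}|.
Implicit Types (x y : D).

(** The pattern as part of a functional graph: arrows run away from the root along the spine and
    towards the parent elsewhere. *)
Definition next_node (q : node) : node :=
  if q.2 is [::] then (q.1.+1, [::]) else par q.
Definition nextD x : D := insubd r (next_node (val x)).

Lemma spine_in i : i <= L -> (i, [::]) \in D.
Proof.
move=> iL; rewrite in_nodes /= full_spine ltnS iL /=.
by have [_ _ /(_ i)] := vA; rewrite full_spine ltnS iL => /(_ isT)[[]].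
Qed.

Definition lastD : D := [` spine_in (leqnn L)]%fset.

Lemma nextD_spine x : (val x).2 = [::] -> x != lastD -> val (nextD x) = ((val x).1.+1, [::]).
Proof.
move=> x2 xl; rewrite /nextD /next_node x2 insubdK//; apply: spine_in.
have := valP x; rewrite in_nodes full_spine ltnS => /andP[le _].
rewrite ltn_neqAle le andbT; apply: contra xl => /eqP e; apply/eqP/val_inj => /=.
by rewrite [LHS]surjective_pairing [X in (X, _)]e [X in (_, X)]x2.
Qed.

Lemma nextD_off x : (val x).2 != [::] -> nextD x = p x.
Proof.
move=> x2; apply: val_inj; rewrite /nextD /next_node.
by case: ((val x).2) x2 => // a u _; rewrite insubdK//; exact: (par_in vA (valP x)).
Qed.

Lemma parD_spine x y : (val x).2 = [::] -> val y = ((val x).1.+1, [::]) -> p y = x.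
Proof.
move=> x2 ey; apply: val_inj; rewrite /= /par [fsval y]ey /=.
exact: esym (node_spine x2).
Qed.

(** The arrow leaving [lastD] has to be dropped: its target is not in the pattern, and [nextD] takes
    the default value [r] there. *)
Lemma nb_nextD x y : nb p x y = (x != lastD) && (nextD x == y) || (y != lastD) && (nextD y == x).
Proof.
have h1 a b : a != lastD -> nextD a = b -> nb p a b.
  move=> al <-; have [a2|a2] := eqVneq (val a).2 [::].
    have en := nextD_spine a2 al; rewrite nb_sym -{2}(parD_spine a2 en).
    by apply: nb_parD; rewrite -(inj_eq val_inj) en.
  by rewrite nextD_off//; apply: nb_parD; apply: contraNneq a2 => ->.
apply/idP/orP => [/andP[xy]|[/andP[al /eqP]|/andP[al /eqP]]].
- have key a b : a != b -> p a = b -> (a != lastD) && (nextD a == b) || (b != lastD) && (nextD b == a).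
    move=> ab pab; have ar : a != r by apply: contraNneq ab => ar; rewrite -pab ar parD_root.
    have [a2|a2] := eqVneq (val a).2 [::].
      apply/orP; right; have eb : val b = ((val a).1.-1, [::]) by rewrite -pab /= /par [X in X.2]/= [(fsval a).2]a2.
      have a1 : (val a).1 = (val b).1.+1.
        rewrite eb prednK// lt0n; apply: contra ar => /eqP a1; apply/eqP/val_inj.
        by rewrite [LHS](node_spine a2) a1.
      have bl : b != lastD.
        apply/eqP => /(congr1 (fun z : D => (val z).1)) /= bL.
        have := valP a; rewrite in_nodes full_spine ltnS => /andP[le _].
        by move: le; rewrite [(val a).1]a1 [(val b).1]bL ltnn.
      rewrite bl; apply/eqP/val_inj; rewrite nextD_spine// ?eb//.
      by rewrite [RHS](node_spine a2) a1 eb.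
    apply/orP; left; rewrite nextD_off// pab eqxx andbT.
    by apply: contraNneq a2 => ->.
  case/orP => /eqP e; first by apply/orP; apply: key.
  by apply/orP; rewrite orbC; apply: key; rewrite // eq_sym.
- exact: h1.
- by move=> e; rewrite nb_sym; exact: h1.
Qed.

Lemma interior_not_last x : depD x < L -> x != lastD.
Proof. by apply: contraTneq => ->; rewrite /depD /= addn0 ltnn. Qed.

(** * Copies in a uniform map *)

Section Random.
Variable V : finType.
Variable rk : V -> nat.
Hypothesis rk_inj : injective rk.
Implicit Types (f : {ffun V -> V}) (phi : {ffun D -> V}) (v z : V).

Definition map_rel f : rel V := fun z w => (z != w) && ((f z == w) || (f w == z)).

(* The last spine vertex and the vertices outside the pattern are left free, except that they must
   not become further neighbours of interior vertices. *)
Definition map_spec phi v : pred V :=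
  [pred w | if [pick x | (x != lastD) && (phi x == v)] is Some x then w == phi (nextD x)
    else w \notin [set phi x | x in interior L As]].

Definition map_sees phi f := f \in family (map_spec phi).

Definition map_roots f := [set v | [exists phi in embeddings vA rk, (phi r == v) && map_sees phi f]].

Lemma map_seesP phi f : injective phi -> map_sees phi f ->
  (forall x, x != lastD -> f (phi x) = phi (nextD x)) /\
  (forall v, f v \in [set phi x | x in interior L As] -> exists2 x, x != lastD & v = phi x).
Proof.
move=> ip /familyP fam; split=> [x xl|v fv].
  have := fam (phi x); rewrite inE; case: pickP => [y /andP[_ /eqP/ip ->] /eqP//|/(_ x)].
  by rewrite xl eqxx.
have := fam v; rewrite inE; case: pickP => [x /andP[xl /eqP <-] _|_]; first by exists x.
by rewrite fv.
Qed.

Lemma map_sees_exact phi f : injective phi -> map_sees phi f ->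
  exact p (@depD As) L (map_rel f) phi.
Proof.
move=> ip s; have [h1 h2] := map_seesP ip s; split=> // x z xL.
have xl := interior_not_last xL.
apply/andP/existsP => [[xz /orP[/eqP e|/eqP e]]|[y /andP[/eqP -> xy]]].
- by exists (nextD x); rewrite -h1// e eqxx nb_nextD xl eqxx.
- have /h2[y yl ez] : f z \in [set phi x | x in interior L As] by rewrite e; apply: imset_f; rewrite inE.
  by exists y; rewrite ez eqxx nb_nextD; apply/orP; right; rewrite yl -(inj_eq ip) -h1// -ez e eqxx.
- split; first by rewrite (inj_eq ip); case/andP: xy.
  move: xy; rewrite nb_nextD => /orP[/andP[_ /eqP <-]|/andP[yl /eqP <-]].
    by rewrite h1// eqxx.
  by rewrite [X in _ || (X == _)]h1// eqxx orbT.
Qed.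

(** The spine predecessor is also a preimage of a spine vertex; it is discarded as the parent, which
    leaves exactly the children in the hanging tree. *)
Lemma map_sees_explored phi f : phi \in embeddings vA rk -> map_sees phi f ->
  explored rk (fun z => [set w | f w == z]) f L As (extend vA phi).
Proof.
move=> phiE s; have ip := embeddings_inj phiE; have [h1 h2] := map_seesP ip s; split.
- move=> q q' qD qD'; rewrite (extend_in _ _ qD) (extend_in _ _ qD') => /ip e.
  exact: (congr1 val e).
- move=> i u uD iL z; rewrite (extend_in _ _ uD); set x := [` uD]%fset.
  have xL : depD x < L by [].
  have xl := interior_not_last xL.
  have xroot : ((i, u) == root_node) = (x == r) by rewrite -(inj_eq val_inj).
  have -> : extend vA phi (par (i, u)) = phi (p x) by rewrite (extend_in _ _ (par_in vA uD)); congr (phi _); apply: val_inj.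
  rewrite inE xroot; split=> [/andP[/eqP fz h]|[j uj ->]].
    have /h2[y yl ez] : f z \in [set phi x | x in interior L As] by rewrite fz; apply: imset_f; rewrite inE.
    have ny : nextD y = x by apply: ip; rewrite -h1// -ez.
    have y2 : (val y).2 != [::].
      apply/eqP => y2; have en := nextD_spine y2 yl; have py := parD_spine y2 en.
      rewrite ny in py en; move: h; rewrite ez py eqxx orbF => /eqP xr.
      by move: en; rewrite xr.
    have yk : y \in kids vA x by rewrite inE y2 -nextD_off// ny eqxx.
    have /kidsP[j ey] := yk; exists j; last by rewrite ez -ey extend_val.
    by have := valP y; rewrite ey in_nodes => /andP[].
  have jD : (i, rcons u j) \in D by rewrite in_nodes /= uj andbT; have := uD; rewrite in_nodes => /andP[].
  have yk : [` jD]%fset \in kids vA x by apply/kidsP; exists j.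
  have [xy yr] := kids_nb yk; rewrite (extend_in _ _ jD).
  move: (yk); rewrite inE => /andP[y2 /eqP py]; apply/andP; split.
    by rewrite h1 ?nextD_off ?py//; apply: contraNneq y2 => ->.
  rewrite (inj_eq ip); have [//|xr] := eqVneq x r; apply/eqP => e.
  have := depD_par xr; have := depD_par yr; rewrite py e => ->.
  by move=> /eqP; rewrite -[X in X == _]addn0 -addn2 eqn_add2l.
- move=> i; rewrite full_spine => iL; rewrite (extend_in _ _ (spine_in (iL : i < L))).
  rewrite (extend_in _ _ (spine_in (ltnW (iL : i < L)))).
  set x := [` spine_in (ltnW (iL : i < L))]%fset.
  have xl : x != lastD by apply: interior_not_last; rewrite /depD /= addn0.
  by rewrite h1//; congr (phi _); apply: val_inj; rewrite nextD_spine.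
- by move=> i u j j' jD jD'; apply: embeddings_inc.
Qed.

Lemma map_sees_uniq (phi phi' : {ffun D -> V}) f :
  phi \in embeddings vA rk -> phi' \in embeddings vA rk -> map_sees phi f -> map_sees phi' f ->
  phi r = phi' r -> phi = phi'.
Proof.
move=> pE pE' s s' er.
have e1 := map_sees_explored pE s; have e2 := map_sees_explored pE' s'.
have er' : extend vA phi root_node = extend vA phi' root_node.
  by rewrite -[root_node]/(val r) !extend_val.
have [_ e] := explored_uniq rk_inj vA vA erefl e1 e2 er'.
by apply/ffunP => x; rewrite -(extend_val vA phi) -(extend_val vA phi') e//; exact: valP.
Qed.

Lemma card_map_sees phi : injective phi ->
  #|[set f | map_sees phi f]| = (#|V| - #|interior L As|) ^ (#|V| - h.-1).
Proof.
move=> ip; have -> : #|[set f | map_sees phi f]| = #|(family (map_spec phi) : simpl_pred {ffun V -> V})|.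
  by apply: eq_card => f; rewrite inE.
rewrite card_family_prod; pose S := [set phi x | x in [set~ lastD]].
rewrite (bigID (fun v => v \in S)) /= big1 => [|v /imsetP[x]]; last first.
  rewrite !inE => xl ->; rewrite -(card1 (phi (nextD x))); apply: eq_card => w; rewrite !inE.
  case: pickP => [y /andP[_ /eqP/ip ->]//|/(_ x)]; by rewrite xl eqxx.
rewrite mul1n (eq_bigr (fun _ => #|V| - #|interior L As|)) => [|v nv].
  rewrite prod_nat_const; congr (_ ^ _).
  have -> : #|[pred v | v \notin S]| = #|~: S| by apply: eq_card => v; rewrite !inE.
  by rewrite [LHS]cardsCs setCK card_imset// cardsC1.
have -> : #|V| - #|interior L As| = #|~: [set phi x | x in interior L As]|.
  by rewrite [RHS]cardsCs setCK card_imset.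
apply: eq_card => w; rewrite !inE; case: pickP => // x /andP[xl /eqP e].
by rewrite -e imset_f ?inE in nv.
Qed.

Lemma sum_map_roots :
  #|embeddings vA rk| * (#|V| - #|interior L As|) ^ (#|V| - h.-1) <=
  \sum_(f : {ffun V -> V}) #|map_roots f|.
Proof.
rewrite -sum_nat_const.
apply: (@leq_trans (\sum_(phi in embeddings vA rk) #|[set f | map_sees phi f]|)).
  by apply: leq_sum => phi /embeddings_inj ip; rewrite card_map_sees.
rewrite (eq_bigl (fun f => f \in [set: {ffun V -> V}])); last by move=> f; rewrite inE.
rewrite !sum_card_pairs; apply: (@card_leq_inj _ _ (fun q : {ffun D -> V} * {ffun V -> V} => (q.2, q.1 r))) => [[g f] [g' f']|[g f]].
  rewrite inE /= => /andP[fE]; rewrite inE => s.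
  rewrite inE /= => /andP[fE']; rewrite inE => s' [e er]; subst f'.
  by rewrite (map_sees_uniq fE fE' s s' er).
rewrite inE /= => /andP[fE]; rewrite inE => s.
rewrite inE /= in_setT /= inE; apply/existsP; exists g.
by rewrite fE eqxx.
Qed.

(** As for edge sequences, except that only [i], [f i] and [f' i] are touched. *)
Lemma map_roots_change f f' i : (forall j, j != i -> f j = f' j) ->
  #|map_roots f| <= #|map_roots f'| + 3 * near_bound L As.
Proof.
move=> ff'; rewrite -leq_subLR.
apply: (@leq_trans #|map_roots f :\: map_roots f'|).
  by rewrite cardsD leq_sub2l// subset_leq_card// subsetIr.
pose S := [set i; f i; f' i].
pose B := \bigcup_(z in S) near_ball (map_rel f) h L z.
apply: (@leq_trans #|B|); last first.
  apply: (@leq_trans (\sum_(z in S) #|near_ball (map_rel f) h L z|)).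
    apply: (big_ind2 (fun (A : {set V}) m => #|A| <= m)) => [|A a C b Aa Cb|//].
      by rewrite cards0.
    by apply: leq_trans (leq_card_setU _ _) _; exact: leq_add.
  apply: (@leq_trans (\sum_(z in S) near_bound L As)).
    by apply: leq_sum => z _; exact: card_near_ball.
  rewrite sum_nat_const leq_mul2r; apply/orP; right.
  apply: leq_trans (leq_card_setU _ _) _; rewrite cards1 cards2 addn1.
  by case: (i != f i).
apply: subset_leq_card; apply/subsetP => v; rewrite inE => /andP[nv].
rewrite inE => /existsP[phi /and3P[phiE /eqP ev s]]; have ip := embeddings_inj phiE.
have ex := map_sees_exact ip s; apply/bigcupP; have [h1 h2] := map_seesP ip s.
suff [x xL xin] : exists2 x, depD x < L & phi x \in S.
  exists (phi x) => //; rewrite -ev.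
  exact: (exact_near (depD_root vA) (@depD_par _ _ vA) ex xL).
(* If [i] is the image of a pattern vertex of depth [L] other than [lastD], that vertex lies off the
   spine and its image under [f] is an interior parent. *)
have [|ni] := boolP [exists x, (x != lastD) && (phi x == i)].
  case/existsP => x /andP[xl /eqP ix].
  have [xL|xL] := ltnP (depD x) L; first by exists x; rewrite // ix !inE eqxx.
  exists (nextD x); last by rewrite -h1// ix !inE eqxx orbT.
  have [x2|x2] := eqVneq (val x).2 [::].
    have le : depD x < depD lastD.
      rewrite {2}/depD /= addn0 /depD x2 addn0 ltn_neqAle.
      have := valP x; rewrite in_nodes full_spine ltnS => /andP[-> _]; rewrite andbT.
      apply: contra xl => /eqP e; apply/eqP/val_inj.
      by rewrite [LHS](node_spine x2) e.
    by move: le xL; rewrite {2}/depD /= addn0 ltnNge => /negbTE ->.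
  by rewrite nextD_off//; apply: parD_depD; apply: contraNneq x2 => ->.
have [/imsetP[x xJ ex']|nJ] := boolP (f' i \in [set phi x | x in interior L As]).
  by exists x; [rewrite inE in xJ|rewrite -ex' !inE eqxx orbT].
case/negP: nv; rewrite inE; apply/existsP; exists phi; rewrite phiE ev eqxx /=.
apply/familyP => j; have [->|ji] := eqVneq j i; last by rewrite -ff'//; move/familyP: s.
rewrite inE; case: pickP => [x e|_ //].
by case/existsP: ni; exists x.
Qed.

End Random.
End Maps.

End Combinatorics.

From mathcomp Require Import all_order all_algebra all_classical all_reals all_analysis ring lra.
Import Combinatorics.
Import Order.TTheory GRing.Theory Num.Theory.
Import numFieldNormedType.Exports.
Local Close Scope group_scope.
Local Open Scope ring_scope.

(** * Planarity of leaf extensions *)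

Section PlanarLeaf.
Variable R : realType.
Implicit Types (g h : R -> (R * R)%type) (q : (R * R)%type) (s t d e r u v c : R).

Definition supdist q q' : R := Num.max `|q.1 - q'.1| `|q.2 - q'.2|.

Lemma supdist_lt q q' e :
  (supdist q q' < e) = (`|q.1 - q'.1| < e) && (`|q.2 - q'.2| < e).
Proof. by rewrite /supdist gt_max. Qed.

Lemma supdist_le q q' e :
  (supdist q q' <= e) = (`|q.1 - q'.1| <= e) && (`|q.2 - q'.2| <= e).
Proof. by rewrite /supdist ge_max. Qed.

Lemma supdistC q q' : supdist q q' = supdist q' q.
Proof. by rewrite /supdist [in LHS]distrC [X in Num.max _ X]distrC. Qed.

Lemma supdist_ge0 q q' : 0 <= supdist q q'.
Proof. by rewrite /supdist le_max normr_ge0. Qed.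

Lemma supdistxx q : supdist q q = 0.
Proof. by rewrite /supdist !subrr normr0 maxxx. Qed.

Lemma supdist_triangle q1 q2 q3 : supdist q1 q3 <= supdist q1 q2 + supdist q2 q3.
Proof.
rewrite supdist_le; apply/andP; split.
  apply: (le_trans (ler_distD q2.1 _ _)); apply: lerD; by rewrite /supdist le_max lexx.
apply: (le_trans (ler_distD q2.2 _ _)); apply: lerD; by rewrite /supdist le_max lexx orbT.
Qed.

Lemma supdist_eq0 q q' : supdist q q' = 0 -> q = q'.
Proof.
move=> h; have : supdist q q' <= 0 by rewrite h.
rewrite supdist_le !normr_le0 !subr_eq0 => /andP[/eqP a /eqP b].
by case: q q' a b {h} => [a b] [c d] /= -> ->.
Qed.

Lemma within_itv_contP g :
  ({within `[0, 1], continuous g})%classic <->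
  (forall s, s \in `[0, 1] -> forall e, 0 < e ->
    exists2 d : R, 0 < d & forall t, t \in `[0, 1] -> `|s - t| < d -> supdist (g s) (g t) < e).
Proof.
split=> [/subspace_continuousP cg s s01 e e0|H].
  have /cvg_ballP/(_ e e0) := cg s s01.
  rewrite near_withinE => /nbhs_ballP[d /= d0 hd]; exists d => // t t01 st.
  have [] := hd t st t01.
  by rewrite supdist_lt => /= -> ->.
apply/subspace_continuousP => s s01; apply/cvg_ballP => e e0.
rewrite near_withinE; have [d d0 hd] := H s s01 e e0.
apply/nbhs_ballP; exists d => //= t st t01.
by have := hd t t01 st; rewrite supdist_lt => /andP[]; split.
Qed.

Definition simple_arc g :=
  [/\ ({within `[0, 1], continuous g})%classic & {in `[0, 1] &, injective g}].

Lemma within_itv_cont_supdist g q : ({within `[0, 1], continuous g})%classic ->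
  forall s, s \in `[0, 1] -> forall e, 0 < e ->
  exists2 d : R, 0 < d & forall t, t \in `[0, 1] -> `|s - t| < d ->
    `|supdist (g s) q - supdist (g t) q| < e.
Proof.
move=> /within_itv_contP cg s s01 e e0; have [d d0 hd] := cg s s01 e e0.
exists d => // t t01 st; have lt := hd t t01 st; rewrite ltr_norml.
have := supdist_triangle (g s) (g t) q.
have := supdist_triangle (g t) (g s) q; rewrite (supdistC (g t) (g s)).
by move=> *; apply/andP; split; lra.
Qed.

Lemma sup_last (P : R -> Prop) : P 0 -> (forall t, P t -> t \in `[0, 1]) ->
  exists s : R, [/\ s \in `[0, 1], forall t, P t -> t <= s &
    forall d, 0 < d -> exists2 t : R, P t & s - d < t].
Proof.
move=> P0 Pin; pose A := [set t | P t]%classic.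
have hs : has_sup A.
  split; first by exists 0.
  by exists 1 => t /Pin; rewrite in_itv => /andP[].
have ub t : P t -> t <= sup A by move=> Pt; apply: (sup_upper_bound hs).
exists (sup A); split=> //.
- rewrite in_itv /= ub //=; apply: ge_sup; first by exists 0.
  by move=> t /Pin; rewrite in_itv => /andP[].
- by move=> d d0; have [t At lt] := sup_adherent d0 hs; exists t.
Qed.

(** [s] is the supremum of the times spent in the closed square of radius [r]; continuity puts [g s]
    on its boundary. *)
Lemma last_exit g q r : ({within `[0, 1], continuous g})%classic ->
  g 0 = q -> 0 < r -> r < supdist (g 1) q ->
  exists s : R, [/\ 0 < s, s < 1, supdist (g s) q = r &
    forall t, s < t -> t <= 1 -> r < supdist (g t) q].
Proof.
move=> cg g0 r0 r1; have ch := within_itv_cont_supdist q cg.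
have [] := @sup_last (fun t => t \in `[0, 1] /\ supdist (g t) q <= r).
- by rewrite g0 supdistxx ltW// in_itv /= lexx ler01.
- by move=> t [].
move=> s [s01 sub sadh].
have s01' := s01; move: s01'; rewrite in_itv /= => /andP[s0 s1].
have after t : s < t -> t <= 1 -> r < supdist (g t) q.
  move=> st t1; rewrite ltNge; apply/negP => le.
  have : t <= s by apply: sub; split=> //; rewrite in_itv /= t1 (le_trans s0 (ltW st)).
  by rewrite leNgt st.
have ler : supdist (g s) q <= r.
  rewrite leNgt; apply/negP => lt.
  have [d d0 hd] := ch s s01 (supdist (g s) q - r) (ltac:(lra)).
  have [t [t01 tr] ht] := sadh d d0.
  have ts := sub t (conj t01 tr).
  have := hd t t01; rewrite ger0_norm ?subr_ge0// => /(_ (ltac:(lra))).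
  rewrite ltr_norml => /andP[_]; lra.
have sn1 : s < 1.
  by rewrite lt_neqAle s1 andbT; apply/eqP => e; move: ler; rewrite e leNgt r1.
have ger : r <= supdist (g s) q.
  rewrite leNgt; apply/negP => lt.
  have [d d0 hd] := ch s s01 (r - supdist (g s) q) (ltac:(lra)).
  pose t := Num.min (s + d / 2) 1.
  have st : s < t by rewrite /t lt_min sn1 andbT; lra.
  have t1 : t <= 1 by rewrite /t ge_min lexx orbT.
  have td : t <= s + d / 2 by rewrite /t ge_min lexx.
  have t01 : t \in `[0, 1] by rewrite in_itv /= t1 (le_trans s0 (ltW st)).
  have := hd t t01; rewrite distrC ger0_norm ?subr_ge0 ?(ltW st)// => /(_ (ltac:(lra))).
  have := after t st t1; rewrite ltr_norml => ? /andP[? _]; clear g0; lra.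
have e : supdist (g s) q = r by apply/eqP; rewrite eq_le ler ger.
exists s; split=> //.
rewrite lt_neqAle s0 andbT; apply/eqP => e0.
by move: e; rewrite -e0 g0 supdistxx => e; move: r0; rewrite -e ltxx.
Qed.

(** Compactness: the distance to [q] attains a positive minimum, and half of it serves. *)
Lemma arc_avoids_square g q : ({within `[0, 1], continuous g})%classic ->
  (forall t, t \in `[0, 1] -> g t <> q) ->
  exists2 r : R, 0 < r & forall t, t \in `[0, 1] -> r < supdist (g t) q.
Proof.
move=> cg ne.
have ch : ({within `[0, 1], continuous (fun t => supdist (g t) q : R)})%classic.
  apply/subspace_continuousP => s s01; apply/cvg_ballP => e e0.
  rewrite near_withinE; have [d d0 hd] := within_itv_cont_supdist q cg s01 e0.
  by apply/nbhs_ballP; exists d => //= t st t01; apply: hd.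
have [c c01 hc] := EVT_min (@ler01 R) ch.
have pos : 0 < supdist (g c) q.
  rewrite lt_neqAle supdist_ge0 andbT; apply/eqP => e.
  by apply: (ne c c01); apply: supdist_eq0.
exists (supdist (g c) q / 2); first by lra.
by move=> t t01; have := hc t t01; lra.
Qed.

Definition ray q (d : (R * R)%type) (u : R) : (R * R)%type :=
  (q.1 + u * (d.1 - q.1), q.2 + u * (d.2 - q.2)).

Lemma supdist_ray2 q (d : (R * R)%type) u v : supdist (ray q d u) (ray q d v) = `|u - v| * supdist d q.
Proof.
rewrite /supdist /= maxr_pMr ?normr_ge0//.
by congr Num.max; rewrite -normrM; congr `|_|; ring.
Qed.

Lemma ray0 q (d : (R * R)%type) : ray q d 0 = q.
Proof. by case: q => a b; rewrite /ray /= !mul0r !addr0. Qed.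

Lemma ray1 q (d : (R * R)%type) : ray q d 1 = d.
Proof. by case: q d => a b [x y]; rewrite /ray /= !mul1r !subrKC. Qed.

Lemma supdist_ray q (d : (R * R)%type) u : 0 <= u -> supdist (ray q d u) q = u * supdist d q.
Proof.
by move=> u0; rewrite -[X in supdist _ X](ray0 q d) supdist_ray2 subr0 ger0_norm.
Qed.

Lemma ray_inj q (d d' : (R * R)%type) u u' : 0 < u -> 0 < u' -> 0 < supdist d q ->
  supdist d q = supdist d' q -> ray q d u = ray q d' u' -> u = u' /\ d = d'.
Proof.
move=> u0 u0' r0 e E; have eu : u = u'.
  have := supdist_ray q d (ltW u0); rewrite E (supdist_ray q d' (ltW u0')) e => h.
  have n : supdist d' q != 0 by rewrite -e gt_eqF.
  exact: (mulIf n (esym h)).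
split=> //; move: E; rewrite -eu => -[/addrI h1 /addrI h2].
have un : u != 0 by rewrite gt_eqF.
move: h1 h2 => /(mulfI un)/addIr h1 /(mulfI un)/addIr h2.
by case: d d' h1 h2 {e r0} => [? ?] [? ?] /= -> ->.
Qed.

Definition straighten q g (s t : R) : (R * R)%type :=
  if t <= s then ray q (g s) (t / s) else g t.

(** The segment stays in the closed square through [g s] and the rest of the arc strictly outside,
    so the two pieces cannot cross. *)
Lemma straighten_simple q g s : simple_arc g -> 0 < s -> s < 1 ->
  0 < supdist (g s) q ->
  (forall t, s < t -> t <= 1 -> supdist (g s) q < supdist (g t) q) ->
  simple_arc (straighten q g s).
Proof.
move=> [cg ig] s0 s1 r0 ht; split; last first.
  move=> t t'; rewrite !in_itv /= => /andP[t0 t1] /andP[t0' t1'].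
  rewrite /straighten; have [ts|st] := leP t s; have [ts'|st'] := leP t' s => E.
  - move: E => /(congr1 (supdist^~ q)); rewrite !supdist_ray ?divr_ge0 ?(ltW s0)// => h.
    have sn : s != 0 by rewrite gt_eqF.
    have rn : supdist (g s) q != 0 by rewrite gt_eqF.
    by move: h => /(mulIf rn)/(mulIf (invr_neq0 sn)).
  - have := ht t' st' t1'; rewrite -E supdist_ray ?divr_ge0 ?(ltW s0)// ltNge.
    by rewrite ger_pMl// ler_pdivrMr// mul1r ts.
  - have := ht t st t1; rewrite E supdist_ray ?divr_ge0 ?(ltW s0)// ltNge.
    by rewrite ger_pMl// ler_pdivrMr// mul1r ts'.
  - by apply: ig => //; rewrite in_itv /= ?t0 ?t0' ?t1 ?t1'.
apply/within_itv_contP => t t01 e e0.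
have [d1 d10 hd1] := (within_itv_contP g).1 cg t t01 e e0.
have s01 : s \in `[0, 1] by rewrite in_itv /= !ltW.
have [d3 d30 hd3] := (within_itv_contP g).1 cg s s01 e e0.
pose r := supdist (g s) q.
have [d2 d20 hd2] : exists2 d : R, 0 < d & forall t', `|t - t'| < d ->
    supdist (ray q (g s) (t / s)) (ray q (g s) (t' / s)) < e.
  exists (e * s / r) => [|t' lt]; first by rewrite divr_gt0 ?mulr_gt0.
  rewrite supdist_ray2 -mulrBl normrM (gtr0_norm (x := s^-1)) ?invr_gt0// -/r.
  by rewrite mulrAC ltr_pdivrMr// -ltr_pdivlMr.
have es : straighten q g s s = g s by rewrite /straighten lexx divff ?gt_eqF// ray1.
have rs : ray q (g s) (s / s) = g s by rewrite divff ?gt_eqF// ray1.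
have [ts|st|ets] := ltgtP t s.
- exists (Num.min d2 (s - t)) => [|t' t'01]; first by rewrite lt_min d20 subr_gt0.
  rewrite lt_min => /andP[l1 l2]; rewrite /straighten (ltW ts).
  have -> : t' <= s by move: l2; rewrite ltr_norml => /andP[*]; lra.
  exact: hd2.
- exists (Num.min d1 (t - s)) => [|t' t'01]; first by rewrite lt_min d10 subr_gt0.
  rewrite lt_min => /andP[l1 l2]; rewrite /straighten leNgt st /=.
  have -> : t' <= s = false.
    by apply/negbTE; rewrite -ltNge; move: l2; rewrite ltr_norml => /andP[*]; lra.
  exact: hd1.
exists (Num.min d2 d3) => [|t' t'01]; first by rewrite lt_min d20.
rewrite lt_min ets => /andP[l1 l2]; rewrite es /straighten.
case: ifP => _; last exact: hd3.
by rewrite -{1}rs; move: hd2; rewrite ets; apply.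
Qed.

Lemma simple_arc_rev g : simple_arc g -> simple_arc (fun t => g (1 - t)).
Proof.
move=> [cg ig]; have rin t : t \in `[0, 1] -> 1 - t \in `[0, 1].
  by rewrite !in_itv /= => /andP[*]; apply/andP; split; lra.
split; last by move=> t t' /rin ht /rin ht' /(ig _ _ ht ht') h; lra.
apply/within_itv_contP => s s01 e e0.
have [d d0 hd] := (within_itv_contP g).1 cg _ (rin s s01) e e0.
exists d => // t t01 st; apply: hd; first exact: rin.
by rewrite (_ : 1 - s - (1 - t) = - (s - t)) ?normrN//; ring.
Qed.

Lemma uniform_radius (T : finType) (P : T -> R -> Prop) :
  (forall i, exists2 r : R, 0 < r & P i r) ->
  (forall i r r', 0 < r' -> r' <= r -> P i r -> P i r') ->
  exists2 r : R, 0 < r & forall i, P i r.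
Proof.
move=> H mono.
suff [r r0 hr] : exists2 r : R, 0 < r & forall i, i \in enum T -> P i r.
  by exists r => // i; apply: hr; rewrite mem_enum.
elim: (enum T) => [|i l [r r0 hr]]; first by exists 1.
have [r' r0' hr'] := H i; exists (Num.min r r'); first by rewrite lt_min r0.
have m0 : 0 < Num.min r r' by rewrite lt_min r0.
move=> j; rewrite inE => /orP[/eqP ->|/hr].
  by apply: mono hr' => //; rewrite ge_min lexx orbT.
by apply: mono => //; rewrite ge_min lexx.
Qed.

(** Pigeonhole: [n] directions cannot contain all the [n.+1] points [e k] on the right side of the
    square. *)
Lemma free_direction (n : nat) (d : 'I_n -> (R * R)%type) q r : 0 < r ->
  exists2 d0 : (R * R)%type, supdist d0 q = r & forall b, d b <> d0.
Proof.
move=> r0; apply: contrapT => H.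
pose e (k : 'I_n.+1) : (R * R)%type := (q.1 + r, q.2 + r * (k%:R / n.+1%:R)).
have ed k : supdist (e k) q = r.
  rewrite /supdist /= !(addrC q.1) !(addrC q.2) !addrK gtr0_norm//.
  rewrite ger0_norm ?mulr_ge0 ?divr_ge0 ?(ltW r0)//; apply/max_idPl.
  by rewrite ger_pMr// ler_pdivrMr ?ltr0n// mul1r ler_nat ltnW.
have /choice[f hf] : forall k, exists b, d b = e k.
  move=> k; apply: contrapT => nk; apply: H; exists (e k) => // b eb.
  by apply: nk; exists b.
have fi : injective f.
  move=> k k' E; have := hf k; rewrite E hf => -[] /addrI.
  move=> /(mulfI (lt0r_neq0 r0)) /(mulIf (invr_neq0 (lt0r_neq0 (ltr0Sn R n)))).
  by move=> /eqP; rewrite eqr_nat => /eqP h; apply/esym/val_inj.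
by have := leq_card f fi; rewrite !card_ord ltnn.
Qed.

End PlanarLeaf.

Section PlanarClosure.
Variables (R : realType) (n : nat).
Implicit Types (E F : {set {set 'I_n}}) (a b c x y z v : 'I_n).

Lemma planarS E F : F \subset E -> planar R E -> planar R F.
Proof.
move=> /fintype.subsetP sFE [p [g [ip [h1 h2]]]]; exists p, g; split=> //.
have s x y : adj F x y -> adj E x y by exact: sFE.
by split=> [x y /s|x y x' y' /s a b /s]; [exact: h1|exact: h2].
Qed.

Lemma planar0 : planar R (finset.set0 : {set {set 'I_n}}).
Proof.
exists (fun x => (x%:R, 0)), (fun _ _ _ => (0, 0)); split.
  by move=> x y [/eqP]; rewrite eqr_nat => /eqP /val_inj.
by split=> [x y|x y x' y']; rewrite /adj finset.inE.
Qed.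

(* The arcs at x are replaced, up to their last exit from a small square
   centred at p x, by straight segments; a segment in a direction not used by
   any of them is then free for the new edge. *)
Lemma planar_leaf G x v : planar R G -> x != v -> (forall y, ~~ adj G v y) ->
  planar R ((x |: [set v])%SET |: G)%SET.
Proof.
move=> [p [g [ip [h1 h2]]]] xv iso.
pose nb b := (b != x) && adj G x b.
(* A drawing provides arcs from the smaller to the larger vertex only; [A b] runs from [x] to [b] in
   either case. *)
pose A b t : (R * R)%type := if (x < b)%N then g x b t else g b x (1 - t).
have rev01 (t : R) : t \in `]0, 1[ -> 1 - t \in `]0, 1[.
  by rewrite !in_itv /= => /andP[*]; apply/andP; split; lra.
have neqltn b : b != x -> (x < b)%N = false -> (b < x)%N.
  by move=> bx /negbT; rewrite -leqNgt leq_eqVlt => /orP[/eqP/val_inj e|//]; rewrite e eqxx in bx.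
have nbv b : nb b -> b != v.
  by move=> /andP[_ xb]; apply: contraTneq xb => ->; rewrite adj_sym iso.
have Afacts b : nb b -> [/\ simple_arc (A b), A b 0 = p x, A b 1 = p b &
    forall t z, t \in `]0, 1[ -> A b t <> p z].
  move=> /andP[bx xb]; rewrite /A; case: ifP => [lt|/(neqltn _ bx) lt].
    by have [c1 c2 c3 c4 c5] := h1 x b xb lt.
  rewrite adj_sym in xb; have [c1 c2 c3 c4 c5] := h1 b x xb lt.
  split; rewrite ?subr0 ?subrr//; first exact: simple_arc_rev.
  by move=> t z /rev01; exact: c5.
have Adis b b' t t' : nb b -> nb b' -> b != b' -> t \in `]0, 1[ -> t' \in `]0, 1[ ->
    A b t <> A b' t'.
  move=> /andP[bx xb] /andP[bx' xb'] bb' t0 t0'; rewrite /A.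
  case: ifP => [lt|/(neqltn _ bx) lt]; case: ifP => [lt'|/(neqltn _ bx') lt'];
    apply: h2 => //; rewrite 1?adj_sym//; try exact: rev01; case; move=> *; subst;
    by rewrite ?eqxx in bx bx' bb'.
have Aout b a c t t' : nb b -> adj G a c -> (a < c)%N -> a != x -> c != x ->
    t \in `]0, 1[ -> t' \in `]0, 1[ -> A b t <> g a c t'.
  move=> /andP[bx xb] ac lac ax cx t0 t0'; rewrite /A.
  case: ifP => [lt|/(neqltn _ bx) lt]; apply: h2 => //; rewrite 1?adj_sym//; try exact: rev01;
    case; move=> *; subst; by rewrite ?eqxx in ax cx.
(* The square of radius [r] at [p x] contains no other vertex and meets no arc that is not incident
   to [x]. *)
have [r r0 [hr1 hr2]] : exists2 r : R, 0 < r &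
    (forall z, z != x -> r < supdist (p z) (p x)) /\
    (forall a c t, adj G a c -> (a < c)%N -> a != x -> c != x -> t \in `[0, 1] ->
       r < supdist (g a c t) (p x)).
  have [r1 r10 hr1] : exists2 r : R, 0 < r & forall z, z != x -> r < supdist (p z) (p x).
    apply: uniform_radius => [z|z s s' _ le H /H]; last exact: le_lt_trans.
    have [->|zx] := eqVneq z x; first by exists 1.
    have pos : 0 < supdist (p z) (p x).
      rewrite lt_neqAle supdist_ge0 andbT; apply/eqP => /esym/supdist_eq0/ip e.
      by rewrite e eqxx in zx.
    by exists (supdist (p z) (p x) / 2) => [|_]; lra.
  have [r2 r20 hr2] : exists2 r : R, 0 < r & forall ac : 'I_n * 'I_n, forall t,
      adj G ac.1 ac.2 -> (ac.1 < ac.2)%N -> ac.1 != x -> ac.2 != x -> t \in `[0, 1] ->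
       r < supdist (g ac.1 ac.2 t) (p x).
    apply: uniform_radius => [[a c]|z s s' _ le H t *] /=; last first.
      by apply: (le_lt_trans le); apply: H.
    have [/andP[ac /and3P[lac ax cx]]|no] := boolP (adj G a c && [&& (a < c)%N, a != x & c != x]); last first.
      by exists 1 => // t h3 h4 h5 h6; rewrite h3 h4 h5 h6 in no.
    have [c1 c2 c3 c4 c5] := h1 a c ac lac.
    have [|s s0 hs] := arc_avoids_square (q := p x) c1.
      move=> t; rewrite in_itv /= => /andP[]; rewrite le_eqVlt => /orP[/eqP<- _|t0].
        by rewrite c3 => /ip e; rewrite e eqxx in ax.
      rewrite le_eqVlt => /orP[/eqP->|t1]; first by rewrite c4 => /ip e; rewrite e eqxx in cx.
      by apply: c5; rewrite in_itv /= t0.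
    by exists s => // t _ _ _ _; exact: hs.
  exists (Num.min r1 r2); first by rewrite lt_min r10.
  split=> [z zx|a c t ac lac ax cx t01].
    by apply: le_lt_trans (hr1 z zx); rewrite ge_min lexx.
  by apply: le_lt_trans (hr2 (a, c) t ac lac ax cx t01); rewrite ge_min lexx orbT.
have /choice[s hs] : forall b, exists s : R, nb b -> [/\ 0 < s, s < 1, supdist (A b s) (p x) = r &
    forall t, s < t -> t <= 1 -> r < supdist (A b t) (p x)].
  move=> b; have [nbb|_] := boolP (nb b); last by exists 0.
  have [[ca _] a0 a1 _] := Afacts b nbb.
  have [|s hs] := last_exit ca a0 r0; last by exists s.
  by rewrite a1 hr1//; case/andP: nbb.
have [d0 d0r d0n] := free_direction (fun b => A b (s b)) (p x) r0.
pose D b := if b == v then d0 else A b (s b).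
(* The new vertex sits halfway to the boundary in the free direction [d0]. It is isolated in [G], so
   moving it disturbs no arc. *)
pose p' z := if z == v then ray (p x) d0 2^-1 else p z.
pose A' b := if b == v then (fun t : R => ray (p x) d0 (t / 2)) else straighten (p x) (A b) (s b).
pose NB b := (b == v) || nb b.
have DR b : NB b -> supdist (D b) (p x) = r.
  by rewrite /NB /D; case: eqP => //= _ /hs[].
have Dinj b b' : NB b -> NB b' -> D b = D b' -> b = b'.
  rewrite /NB /D; case: eqP => [->|_] /=; case: eqP => [->|_] //=.
  - by move=> _ _ /esym/d0n.
  - by move=> _ _ /d0n.
  move=> nb1 nb2 e; apply/eqP; apply: contraT => ne.
  have [s0 s1 _ _] := hs b nb1; have [s0' s1' _ _] := hs b' nb2.
  by case: (Adis b b' (s b) (s b') nb1 nb2 ne _ _ e); rewrite in_itv /= ?s0 ?s0'.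
have vx : v != x by rewrite eq_sym.
(* Inside the square a point of a new arc lies on the ray of that arc's own direction, outside it
   lies on the original arc. The parameter on the new edge stays below [2^-1] before its end [v]. *)
have cls b t : NB b -> t \in `]0, 1[ ->
    (exists u : R, [/\ 0 < u, u <= 1, A' b t = ray (p x) (D b) u & b = v -> u < 2^-1]) \/
    [/\ nb b, A' b t = A b t & r < supdist (A' b t) (p x)].
  rewrite /NB /A' /D in_itv /= => + /andP[t0 t1]; case: eqP => [->|bv] /=.
    by move=> _; left; exists (t / 2); split=> // *; lra.
  move=> nbb; have [s0 s1 sr sa] := hs b nbb; rewrite /straighten.
  have [ts|st] := leP t (s b); last by right; split=> //; apply: sa => //; exact: ltW.
  by left; exists (t / s b); split=> //; [rewrite divr_gt0|rewrite ler_pdivrMr// mul1r].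
have F3 b t z : NB b -> t \in `]0, 1[ -> A' b t <> p' z.
  move=> NBb t01; rewrite /p'.
  case: (cls b t NBb t01) => [[u [u0 u1 -> uv]]|[nbb e lt]].
    case: eqP => [_ E|_].
      have [eu eD] : u = 2^-1 /\ D b = d0 by apply: (ray_inj (q := p x)) E; rewrite ?DR ?d0r.
      have bv : b = v by apply: Dinj; rewrite /NB ?eqxx// /D eqxx.
      by have := uv bv; rewrite eu ltxx.
    have [->|zx] := eqVneq z x => E.
      have := supdist_ray (p x) (D b) (ltW u0); rewrite E supdistxx DR// => h.
      have : 0 < u * r by rewrite mulr_gt0.
      by rewrite -h ltxx.
    have := hr1 z zx; rewrite -E supdist_ray ?(ltW u0)// DR// ltNge.
    by rewrite ger_pMl// u1.
  case: eqP => [_ E|_ E].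
    move: lt; rewrite E supdist_ray ?invr_ge0// d0r => h; lra.
  by have [_ _ _ /(_ t z t01)] := Afacts b nbb; rewrite -e E.
have F1 b : NB b -> simple_arc (A' b).
  rewrite /NB /A'; case: eqP => [_ _|bv /=].
    have r2 (u w : R) : supdist (ray (p x) d0 (u / 2)) (ray (p x) d0 (w / 2)) = `|u - w| / 2 * r.
      by rewrite supdist_ray2 d0r -mulrBl normrM (gtr0_norm (x := 2^-1)) ?invr_gt0.
    split.
      apply/within_itv_contP => t t01 e e0; exists (e / r); first by rewrite divr_gt0.
      move=> w w01 lt; rewrite r2; move: lt; rewrite ltr_pdivlMr// => lt.
      apply: le_lt_trans lt; rewrite ler_wpM2r ?(ltW r0)//.
      have := normr_ge0 (t - w); lra.
    move=> t w t01 w01 /= E; have := r2 t w; rewrite E supdistxx => /esym/eqP.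
    rewrite !mulf_eq0 (gt_eqF r0) invr_eq0 pnatr_eq0 !orbF normr_eq0 subr_eq0.
    by move/eqP.
  move=> nbb; have [s0 s1 sr sa] := hs b nbb; have [sA _ _ _] := Afacts b nbb.
  by apply: straighten_simple; rewrite ?sr.
have F2 b : NB b -> A' b 0 = p' x /\ A' b 1 = p' b.
  rewrite /NB /A' /p' (negbTE xv); case: eqP => [_ _|bv /=].
    by rewrite mul0r ray0 mul1r.
  move=> nbb; have [s0 s1 sr sa] := hs b nbb; have [sA a0 a1 _] := Afacts b nbb.
  by rewrite /straighten (ltW s0) leNgt s1 mul0r ray0 /= a1.
have F4 b b' t t' : NB b -> NB b' -> b != b' -> t \in `]0, 1[ -> t' \in `]0, 1[ ->
    A' b t <> A' b' t'.
  move=> N1 N2 ne t0 t0'.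
  case: (cls b t N1 t0) => [[u [u0 u1 eu _]]|[nb1 e1 lt1]];
  case: (cls b' t' N2 t0') => [[w [w0 w1 ew _]]|[nb2 e2 lt2]].
  - rewrite eu ew => /(ray_inj u0 w0); rewrite !DR// => /(_ r0 erefl)[_ /Dinj h].
    by rewrite h// eqxx in ne.
  - move=> E; move: lt2; rewrite -E eu supdist_ray ?(ltW u0)// DR// ltNge.
    by rewrite ger_pMl// u1.
  - move=> E; move: lt1; rewrite E ew supdist_ray ?(ltW w0)// DR// ltNge.
    by rewrite ger_pMl// w1.
  - by rewrite e1 e2; apply: Adis.
have F5 b a c t t' : NB b -> adj G a c -> (a < c)%N -> a != x -> c != x ->
    t \in `]0, 1[ -> t' \in `]0, 1[ -> A' b t <> g a c t'.
  move=> N1 ac lac ax cx t0 t0'.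
  case: (cls b t N1 t0) => [[u [u0 u1 eu _]]|[nb1 e1 lt1]]; last by rewrite e1; apply: Aout.
  move=> E; have : t' \in `[0, 1] by move: t0'; rewrite !in_itv /= => /andP[*]; rewrite !ltW.
  move=> /(hr2 a c t' ac lac ax cx); rewrite -E eu supdist_ray ?(ltW u0)// DR// ltNge.
  by rewrite ger_pMl// u1.
pose g' a c := if a == x then A' c else if c == x then (fun t : R => A' a (1 - t)) else g a c.
have kind a c : adj ((x |: [set v])%SET |: G)%SET a c -> (a < c)%N ->
   [\/ a = x /\ NB c, [/\ a <> x, c = x & NB a] | [/\ a != x, c != x, a != v, c != v & adj G a c]].
  rewrite /adj finset.in_setU1 => + lac.
  have ac : a != c by rewrite neq_ltn lac.
  have [ea|ax] := eqVneq a x => H.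
    rewrite ea in H lac; constructor 1; split=> //; rewrite /NB /nb; have [//|cv] := eqVneq c v.
    rewrite /= eq_sym; move: H => /orP[/eqP/finset.setP/(_ v)|xc].
      by rewrite !finset.inE eqxx orbT (negbTE vx) /= eq_sym (negbTE cv).
    by rewrite /adj xc andbT; apply: contraTneq lac => ->; rewrite ltnn.
  have [ec|cx] := eqVneq c x.
    constructor 2; split=> //; first exact/eqP.
    rewrite /NB /nb; have [//|av] := eqVneq a v; rewrite ax /=.
    move: H; rewrite ec => /orP[/eqP/finset.setP/(_ v)|xc].
      by rewrite !finset.inE eqxx orbT (negbTE vx) orbF eq_sym (negbTE av).
    by rewrite adj_sym.
  constructor 3; move: H => /orP[/eqP/finset.setP/(_ x)|ec].
    by rewrite !finset.inE eqxx !(eq_sym x) (negbTE ax) (negbTE cx).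
  split=> //; first by apply: contraTneq ec => ->; exact: iso.
  by apply: contraTneq ec => ->; have := iso a; rewrite adj_sym.
exists p', g'; split; last split.
- move=> z w; rewrite /p'.
  have pv y : y != v -> p y <> ray (p x) d0 2^-1.
    move=> yv E; have := supdist_ray (p x) d0 (u := 2^-1); rewrite -E d0r invr_ge0 => /(_ (ler0n _ _)).
    have [->|yx] := eqVneq y x; first by rewrite supdistxx => ?; lra.
    by have := hr1 y yx => ? ?; lra.
  case: eqVneq => [->|zv]; case: eqVneq => [-> //|wv].
  + by move=> /esym/(pv _ wv).
  + by move=> /(pv _ zv).
  + exact: ip.
- move=> a c /kind h lac; rewrite /g'; case: (h lac) => [[-> N]|[ax -> N]|[ax cx av cv ac]].
  + by rewrite eqxx; have [] := F1 c N; have [] := F2 c N; split=> // t z; exact: F3.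
  + rewrite eqxx (introF eqP ax); have [c1 c2] := simple_arc_rev (F1 a N).
    have [e1 e2] := F2 a N; split=> //; rewrite ?subr0 ?subrr// => t z /rev01; exact: F3.
  + rewrite (negbTE ax) (negbTE cx) /p' (negbTE av) (negbTE cv).
    have [c1 c2 c3 c4 c5] := h1 a c ac lac; split=> // t z t01.
    case: eqP => [_ E|_ E]; last exact: (c5 t z t01 E).
    have : t \in `[0, 1] by move: t01; rewrite !in_itv /= => /andP[*]; rewrite !ltW.
    move=> /(hr2 a c t ac lac ax cx); rewrite E supdist_ray ?invr_ge0// d0r => ?; lra.
- move=> a c a' c' k0 lac k0' lac' ne t t' t01 t01'.
  have k := kind _ _ k0 lac; have k' := kind _ _ k0' lac'.
  rewrite /g'; case: k k' ne lac lac' => [[-> N]|[ax -> N]|[ax cx av cv ac]];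
    case=> [[-> N']|[ax' -> N']|[ax' cx' av' cv' ac']];
    rewrite ?eqxx ?(introF eqP ax) ?(introF eqP ax') ?(negbTE ax) ?(negbTE cx) ?(negbTE ax') ?(negbTE cx') => ne lac lac'.
  + by apply: F4 => //; apply: contra_notN ne => /eqP ->.
  + apply: F4 => //; last exact: rev01.
    by apply: contraTneq lac => ->; rewrite -leqNgt ltnW.
  + exact: F5.
  + apply: F4 => //; try exact: rev01.
    by apply: contraTneq lac => ->; rewrite -leqNgt ltnW.
  + by apply: F4 => //; try exact: rev01; apply: contra_notN ne => /eqP ->.
  + by apply: F5 => //; try exact: rev01.
  + by move=> /esym; apply: F5.
  + by move=> /esym; apply: F5; rewrite ?rev01.
  + exact: h2.
Qed.

End PlanarClosure.

(** * Bounded differences *)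

Section McDiarmid.
Variables (R : realType) (I X : finType).
Hypothesis X_gt0 : (0 < #|X|)%N.
Notation Omega := {ffun I -> X}.
Implicit Types (w : Omega) (g : Omega -> R) (i j : I) (y : X).

Definition upd w i y : Omega := [ffun j => if j == i then y else w j].

Lemma upd_upd w i y y' : upd (upd w i y) i y' = upd w i y'.
Proof. by apply/ffunP => j; rewrite !ffunE; case: eqP. Qed.

Lemma upd_id w i : upd w i (w i) = w.
Proof. by apply/ffunP => j; rewrite !ffunE; case: eqP => [->|]. Qed.

Lemma upd_comm w i j y y' : i != j -> upd (upd w i y) j y' = upd (upd w j y') i y.
Proof.
move=> ij; apply/ffunP => k; rewrite !ffunE.
by case: eqP => [->|//]; rewrite eq_sym (negbTE ij).
Qed.

(** Conditional expectation given all coordinates but [i]. *)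
Definition resample i g w : R := (#|X|%:R)^-1 * \sum_y g (upd w i y).

Let X0 : (#|X|%:R : R) != 0. Proof. by rewrite pnatr_eq0 -lt0n. Qed.

(** Exchanging the value at [i] with the fresh value [y] is an involution. *)
Lemma sum_resample i g : \sum_w resample i g w = \sum_w g w.
Proof.
rewrite -mulr_sumr pair_big /=.
have hK : involutive (fun p : Omega * X => (upd p.1 i p.2, p.1 i)).
  by move=> [w y] /=; rewrite upd_upd upd_id ffunE eqxx.
rewrite (reindex _ (onW_bij _ (inv_bij hK))) /=.
under eq_bigr => p _ do rewrite upd_upd upd_id.
rewrite -(pair_big xpredT xpredT (fun w _ => g w)) /=.
under eq_bigr => w _ do rewrite sumr_const -mulr_natl.
by rewrite -mulr_sumr mulrA mulVf ?mul1r.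
Qed.

Lemma sum_upd_const (k : R) : (#|X|%:R)^-1 * (\sum_(y : X) k) = k.
Proof. by rewrite sumr_const -[k *+ _]mulr_natl mulrA mulVf ?mul1r. Qed.

Definition lipschitz_coord (c : R) g := forall w i y, g w - g (upd w i y) <= c.

Lemma lipschitz_resample c i g : 0 <= c -> lipschitz_coord c g ->
  lipschitz_coord c (resample i g).
Proof.
move=> c0 lg w j y; rewrite /resample -mulrBr -sumrB.
rewrite -[leRHS](sum_upd_const c) ler_wpM2l ?invr_ge0//; apply: ler_sum => y' _.
have [->|ji] := eqVneq j i; first by rewrite upd_upd subrr.
by rewrite (upd_comm _ _ _ ji); exact: lg.
Qed.

(** Follows from [expR (x / 2) <= 1 / (1 - x / 2)]: after squaring, a polynomial inequality
    remains. *)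
Lemma expR_le_quad (x : R) : `|x| <= 4^-1 -> expR x <= 1 + x + x ^+ 2.
Proof.
rewrite ler_norml => /andP[x0 x1].
have pos : 0 < 1 - x / 2 by lra.
have h : expR (x / 2) <= (1 - x / 2)^-1.
  rewrite -[leLHS]invrK -expRN lef_pV2 ?posrE ?expR_gt0//.
  by have := expR_ge1Dx (- (x / 2)).
have -> : expR x = expR (x / 2) ^+ 2 by rewrite expr2 -expRD -splitr.
apply: (@le_trans _ _ ((1 - x / 2)^-1 ^+ 2)).
  by rewrite lerXn2r// nnegrE ?expR_ge0// invr_ge0 (ltW pos).
rewrite exprVn -[leLHS]mul1r ler_pdivrMr ?exprn_gt0//; nra.
Qed.

(** With the other coordinates fixed, [g] deviates from its mean [m] by at most [c]; in the
    quadratic bound of the exponential the linear term averages to zero. *)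
Lemma resample_expR c t i g w : 0 <= t -> t * c <= 4^-1 -> lipschitz_coord c g ->
  resample i (fun w => expR (- t * g w)) w <=
  expR (t ^+ 2 * c ^+ 2) * expR (- t * resample i g w).
Proof.
move=> t0 tc lg; set m := resample i g w.
have near y : `|m - g (upd w i y)| <= c.
  have cst (k : R) : m - k = (#|X|%:R)^-1 * \sum_y' (g (upd w i y') - k).
    by rewrite sumrB mulrBr sum_upd_const.
  have h y1 y2 : g (upd w i y1) - g (upd w i y2) <= c.
    by rewrite -(upd_upd w i y1 y2); exact: lg.
  rewrite ler_norml; apply/andP; split.
    rewrite lerNl opprB -[leRHS](sum_upd_const c) -opprB cst -mulrN ler_wpM2l ?invr_ge0//.
    by rewrite -sumrN; apply: ler_sum => y' _; rewrite opprB.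
  by rewrite cst -[leRHS](sum_upd_const c) ler_wpM2l ?invr_ge0//; apply: ler_sum.
have c0 : 0 <= c.
  by have /card_gt0P[y _] := X_gt0; apply: le_trans (near y); rewrite normr_ge0.
apply: (@le_trans _ _ ((#|X|%:R)^-1 * \sum_y (expR (- t * m) *
    (1 + t * (m - g (upd w i y)) + (t * c) ^+ 2)))).
  rewrite ler_wpM2l ?invr_ge0//; apply: ler_sum => y _.
  have -> : - t * g (upd w i y) = - t * m + t * (m - g (upd w i y)) by ring.
  rewrite expRD ler_wpM2l ?expR_ge0//.
  have b : `|t * (m - g (upd w i y))| <= t * c.
    by rewrite normrM ger0_norm// ler_wpM2l.
  apply: le_trans (expR_le_quad (le_trans b tc)) _.
  by rewrite lerD2l -real_normK ?num_real// ler_pXn2r ?nnegrE ?mulr_ge0.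
rewrite -mulr_sumr mulrCA mulrC ler_wpM2r ?expR_ge0//.
have z : (#|X|%:R)^-1 * \sum_y (m - g (upd w i y)) = 0.
  by rewrite sumrB mulrBr sum_upd_const subrr.
rewrite big_split /= big_split /= -mulr_sumr !mulrDr !sum_upd_const mulrCA z mulr0 addr0 exprMn.
exact: expR_ge1Dx.
Qed.

Definition resample_all (s : seq I) g := foldr resample g s.

Lemma sum_resample_all s g : \sum_w resample_all s g w = \sum_w g w.
Proof. by elim: s => //= i s <-; rewrite sum_resample. Qed.

Lemma lipschitz_resample_all c s g : 0 <= c -> lipschitz_coord c g ->
  lipschitz_coord c (resample_all s g).
Proof. by move=> c0 lg; elim: s => //= i s; exact: lipschitz_resample. Qed.

Lemma resample_all_inv s g i : i \in s -> forall w y,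
  resample_all s g (upd w i y) = resample_all s g w.
Proof.
elim: s => // j s IH; rewrite inE => /orP[/eqP <-|/IH{}IH] w y /=; rewrite /resample; congr (_ * _);
  apply: eq_bigr => y' _; first by rewrite upd_upd.
have [->|ij] := eqVneq i j; first by rewrite upd_upd.
by rewrite (upd_comm _ _ _ ij) IH.
Qed.

Lemma resample_all_cst g w w' : resample_all (enum I) g w = resample_all (enum I) g w'.
Proof.
pose u (s : seq I) := foldr (fun i v => upd v i (w' i)) w s.
have inv s : resample_all (enum I) g (u s) = resample_all (enum I) g w.
  by elim: s => //= i s IH; rewrite resample_all_inv ?mem_enum.
rewrite -(inv (enum I)); congr resample_all; apply/ffunP => i.
have : i \in enum I by rewrite mem_enum.
elim: (enum I) => //= j s IH; rewrite inE ffunE; case: eqP => [->//|_ /=]; exact: IH.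
Qed.

Lemma sum_expR_resample_all c t s g : 0 <= c -> 0 <= t -> t * c <= 4^-1 ->
  lipschitz_coord c g ->
  \sum_w expR (- t * g w) <=
  expR (t ^+ 2 * c ^+ 2) ^+ size s * \sum_w expR (- t * resample_all s g w).
Proof.
move=> c0 t0 tc lg; elim: s => [|i s IH] /=; first by rewrite mul1r.
apply: (le_trans IH); rewrite [_ ^+ (size s).+1]exprSr -[leRHS]mulrA ler_wpM2l ?exprn_ge0 ?expR_ge0//.
rewrite -(sum_resample i) mulr_sumr; apply: ler_sum => w _.
by apply: resample_expR => //; exact: lipschitz_resample_all.
Qed.

(** Exponential moment method for the lower tail; the parameter [t] is chosen in [card_tail]. *)
Lemma mcdiarmid c t a g : 0 <= c -> 0 <= t -> t * c <= 4^-1 -> lipschitz_coord c g ->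
  #|[pred w | g w <= (#|{: Omega}|%:R)^-1 * (\sum_w g w) - a]|%:R <=
  #|{: Omega}|%:R * expR (#|I|%:R * (t ^+ 2 * c ^+ 2) - t * a).
Proof.
move=> c0 t0 tc lg; set mu := _ * _.
have cst w : resample_all (enum I) g w = mu.
  rewrite /mu -(sum_resample_all (enum I)).
  under eq_bigr => w' _ do rewrite (resample_all_cst g w' w).
  rewrite sumr_const -[resample_all _ _ _ *+ _]mulr_natl mulrA mulVf ?mul1r// pnatr_eq0 -lt0n.
  by apply/card_gt0P; exists w.
have := sum_expR_resample_all (enum I) c0 t0 tc lg.
rewrite -cardE -expRM_natl.
under [X in _ <= _ * X]eq_bigr => w _ do rewrite cst.
rewrite sumr_const -[expR _ *+ _]mulr_natl => H.
have le : #|[pred w | g w <= mu - a]|%:R * expR (- t * (mu - a)) <= \sum_w expR (- t * g w).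
  rewrite mulr_natl -sumr_const [leRHS](bigID [pred w | g w <= mu - a]) /=.
  rewrite -[leLHS]addr0; apply: lerD; last by apply: sumr_ge0 => *; exact: expR_ge0.
  by apply: ler_sum => w h; rewrite ler_expR !mulNr lerN2 ler_wpM2l.
rewrite -(ler_pM2r (expR_gt0 (- t * (mu - a)))); apply: (le_trans le); apply: (le_trans H).
rewrite -[leRHS]mulrA -expRD mulrCA -expRD ler_wpM2l// ler_expR.
by rewrite le_eqVlt; apply/orP; left; apply/eqP; ring.
Qed.

End McDiarmid.

(** * Galton--Watson weights *)

Section Weights.
Variable R : realType.
Implicit Types (A : {fset (seq nat)}) (As : forest) (u v : seq nat).

Notation pois := (poisson_pmf (1 : R)).

Lemma poisson1E k : pois k = (k`!%:R)^-1 * expR (-1).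
Proof. by rewrite /poisson_pmf ltr01 expr1n mul1r. Qed.

Lemma nchildrenE A u c : UHtree A -> (forall i, (rcons u i \in A) = (i < c)%N) -> nchildren A u = c.
Proof.
move=> uh H; apply/eqP; rewrite eqn_leq; apply/andP; split; rewrite leqNgt.
  by rewrite -UHtree_children// H ltnn.
by rewrite -H UHtree_children// ltnn.
Qed.

Definition level A l : {fset (seq nat)} := [fset u in A | size u == l]%fset.

Lemma in_level A l u : (u \in level A l) = (u \in A) && (size u == l).
Proof. by rewrite !inE. Qed.

Section Extension.
Variables (l : nat) (A : {fset (seq nat)}) (K : nat).
Hypotheses (uhA : UHtree A) (dA : depth_le A l).
Implicit Types (c : {ffun level A l -> 'I_K.+1}).

(** Offspring numbers are capped at [K], so the extensions by one generation form a finite set; [K]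
    tends to infinity later. *)
Definition offspring c u : nat := if insub u is Some y then c y else 0%N.

Definition extension c : {fset (seq nat)} :=
  (A `|` seq_fset tt (flatten [seq [seq rcons u i | i <- iota 0 (offspring c u)] | u <- enum_fset (level A l)]))%fset.

Lemma in_extension c v : v \in extension c <->
  v \in A \/ exists u i, [/\ u \in level A l, (i < offspring c u)%N & v = rcons u i].
Proof.
rewrite inE seq_fsetE; split=> [/orP[->|/flatten_mapP[u ul /mapP[i]]]|[->//|[u [i [ul ic ->]]]]].
- by left.
- by rewrite mem_iota add0n => /andP[_ ic] ->; right; exists u, i.
- apply/orP; right; apply/flatten_mapP; exists u => //.
  by apply: map_f; rewrite mem_iota.
Qed.

Lemma in_extension_rcons c u i :
  (rcons u i \in extension c) = if (size u < l)%N then rcons u i \in A else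
    (u \in level A l) && (i < offspring c u)%N.
Proof.
apply/idP/idP => [/in_extension[uA|[w [j [wl jc /rcons_inj[-> ->]]]]]|].
- by have := dA uA; rewrite size_rcons => lt; rewrite lt.
- rewrite wl jc; move: wl; rewrite in_level => /andP[_ /eqP ->].
  by rewrite ltnn.
case: ifP => _ H; apply/in_extension; first by left.
by case/andP: H => h1 h2; right; exists u, i.
Qed.

Lemma extension_trunc c v : (v \in extension c) && (size v <= l)%N = (v \in A).
Proof.
apply/andP/idP => [[/in_extension[//|[u [i [ul _ ->]]]]]|vA].
  by move: ul; rewrite in_level size_rcons => /andP[_ /eqP ->]; rewrite ltnn.
by split; [apply/in_extension; left|exact: dA].
Qed.

Lemma UHtree_extension c : UHtree (extension c).
Proof.
have [A0 cl] := uhA; split; first by apply/in_extension; left.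
move=> u i; rewrite in_extension_rcons; case: ifP => ul.
  move=> uA; have [u' h] := cl u i uA; split; first by apply/in_extension; left.
  by move=> j ji; rewrite in_extension_rcons ul h.
move=> /andP[uL ic]; split; first by apply/in_extension; left; move: uL; rewrite in_level => /andP[].
by move=> j ji; rewrite in_extension_rcons ul uL (leq_ltn_trans ji).
Qed.

Lemma depth_extension c : depth_le (extension c) l.+1.
Proof.
move=> v /in_extension[/dA/leqW//|[u [i [ul _ ->]]]].
by move: ul; rewrite in_level size_rcons => /andP[_ /eqP ->].
Qed.

Lemma nchildren_extension_lt c u : (size u < l)%N -> nchildren (extension c) u = nchildren A u.
Proof.
move=> ul; apply: nchildrenE => [|i]; first exact: UHtree_extension.
by rewrite in_extension_rcons ul UHtree_children.
Qed.

Lemma nchildren_extension_level c (u : level A l) : nchildren (extension c) (val u) = c u.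
Proof.
have := valP u; rewrite in_level => /andP[_ /eqP ul].
apply: nchildrenE => [|i]; first exact: UHtree_extension.
by rewrite in_extension_rcons ul ltnn (valP u) /offspring valK.
Qed.

Lemma extension_inj : injective extension.
Proof.
move=> c c' e; apply/ffunP => u; apply: val_inj => /=.
by rewrite -nchildren_extension_level e nchildren_extension_level.
Qed.

Lemma big_extension (T : Type) (idx : T) (op : Monoid.com_law idx) (F : seq nat -> T) c (P : pred (seq nat)) :
  (forall v, P v -> size v <= l)%N ->
  \big[op/idx]_(v <- enum_fset (extension c) | P v) F v = \big[op/idx]_(v <- enum_fset A | P v) F v.
Proof.
move=> Pl; rewrite -[LHS]big_filter -[RHS]big_filter; apply: perm_big; apply: uniq_perm.
- by rewrite filter_uniq ?fset_uniq.
- by rewrite filter_uniq ?fset_uniq.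
move=> v; rewrite !mem_filter; case Pv: (P v) => //=.
by rewrite -[RHS](extension_trunc c) Pl ?andbT.
Qed.

Lemma gw_weight_extension c :
  gw_weight (1 : R) l.+1 (extension c) = gw_weight 1 l A * \prod_(u : level A l) pois (c u).
Proof.
rewrite /gw_weight (bigID (fun u => size u < l)%N) /=; congr (_ * _).
  rewrite (eq_bigl (fun v => size v < l)%N) => [|v]; last by rewrite andb_idl// => /leqW.
  rewrite big_extension; last by move=> v /ltnW.
  by apply: eq_bigr => u ul; rewrite nchildren_extension_lt.
rewrite (eq_bigl (fun v => size v == l)) => [|v]; last by rewrite -leqNgt ltnS eqn_leq.
rewrite big_extension; last by move=> v /eqP ->.
rewrite -[LHS]big_filter; under [RHS]eq_bigr => u _ do rewrite -nchildren_extension_level.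
rewrite -(big_seq_fsetE _ (level A l) xpredT (fun u => pois (nchildren (extension c) u))).
apply: perm_big; apply: uniq_perm; rewrite ?filter_uniq ?fset_uniq//.
by move=> v; rewrite mem_filter in_level andbC.
Qed.

Lemma card_level_extension c : #|` level (extension c) l.+1| = (\sum_(u : level A l) c u)%N.
Proof.
pose s := flatten [seq [seq rcons u i | i <- iota 0 (offspring c u)] | u <- enum_fset (level A l)].
have us : uniq s.
  apply: allpairs_uniq_dep => [||[u i] [v j] _ _ /rcons_inj[-> ->]//]; first exact: fset_uniq.
  by move=> u _; exact: iota_uniq.
have -> : #|` level (extension c) l.+1| = size s.
  apply: perm_size; apply: uniq_perm; [by []|exact: us|].
  move=> v; rewrite in_level.
  apply/andP/flatten_mapP => [[/in_extension[vA|[u [i [ul ic ->]]]] sv]|[u ul /mapP[i]]].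
  - by have := dA vA; rewrite (eqP sv) ltnn.
  - by exists u => //; apply: map_f; rewrite mem_iota.
  - rewrite mem_iota add0n => /andP[_ ic] ->; split; first by apply/in_extension; right; exists u, i.
    by move: ul; rewrite in_level size_rcons => /andP[_ /eqP ->].
rewrite size_flatten /shape -map_comp sumnE big_map.
rewrite big_seq_fsetE /=.
by apply: eq_bigr => u _; rewrite size_map size_iota /offspring valK.
Qed.

(** One step of the branching process: the offspring numbers at level [l] are independent, so the
    sum factors into truncated generating functions. *)
Lemma sum_extension (s : R) :
  \sum_c gw_weight 1 l.+1 (extension c) * s ^+ #|` level (extension c) l.+1| =
  gw_weight 1 l A * (\sum_(k < K.+1) pois k * s ^+ k) ^+ #|` level A l|.
Proof.
under eq_bigr => c _ do rewrite gw_weight_extension card_level_extension -mulrA -prodrXr -big_split /=.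
rewrite -mulr_sumr -(bigA_distr_bigA (fun (u : level A l) (k : 'I_K.+1) => pois k * s ^+ k)).
by rewrite prodr_const -cardfE.
Qed.

End Extension.

Lemma poisson1_gen (s : R) :
  ((fun K => \sum_(k < K.+1) pois k * s ^+ k) @ \oo --> expR (s - 1))%classic.
Proof.
have H : (series (exp_coeff s) @ \oo --> expR s)%classic by exact: is_cvg_series_exp_coeff.
have e K : \sum_(k < K.+1) pois k * s ^+ k = expR (-1) * series (exp_coeff s) K.+1.
  rewrite /series /= big_mkord mulr_sumr; apply: eq_bigr => k _.
  by rewrite poisson1E /exp_coeff /= mulrAC mulrC [X in _ * X]mulrC.
rewrite (_ : (fun K => _) = (fun K => expR (-1) * series (exp_coeff s) K.+1)); last exact/funext.
rewrite expRD mulrC; apply: cvgMl_tmp.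
by rewrite (cvg_shiftS (series (exp_coeff s))).
Qed.

Lemma cvg_sum_seq (T : Type) (s : seq T) (f : T -> nat -> R) (g : T -> R) :
  (forall i, f i @ \oo --> g i)%classic ->
  ((fun n => \sum_(i <- s) f i n) @ \oo --> \sum_(i <- s) g i)%classic.
Proof.
move=> h; elim: s => [|i s IH].
  rewrite big_nil (_ : (fun n => _) = (fun=> 0)); first exact: cvg_cst.
  by apply/funext => n; rewrite big_nil.
rewrite big_cons (_ : (fun n => _) = (fun n => f i n + \sum_(i <- s) f i n)); last first.
  by apply/funext => n; rewrite big_cons.
exact: cvgD.
Qed.

Lemma cvg_exprn (u : nat -> R) (a : R) k :
  (u @ \oo --> a)%classic -> ((fun n => u n ^+ k) @ \oo --> a ^+ k)%classic.
Proof.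
move=> h; elim: k => [|k IH].
  by rewrite expr0 (_ : (fun n => _) = (fun=> 1)); [exact: cvg_cst|apply/funext => n].
rewrite exprS (_ : (fun n => _) = (fun n => u n * u n ^+ k)); first exact: cvgM.
by apply/funext => n; rewrite exprS.
Qed.

Lemma gw_weight_ge0 l A : 0 <= gw_weight (1 : R) l A.
Proof. by apply: prodr_ge0 => u _; exact: poisson_pmf_ge0. Qed.

Definition good_tree l A := UHtree A /\ depth_le A l.

Lemma good_root : good_tree 0 [fset [::]]%fset.
Proof.
split; last by move=> u; rewrite inE => /eqP ->.
split; first by rewrite inE.
by move=> u i; rewrite inE; case: u.
Qed.

Lemma gw_weight0 A : gw_weight (1 : R) 0 A = 1.
Proof. by rewrite /gw_weight big_pred0. Qed.

(** Finite approximation of the generating function of the size of generation [l]. At [s = 1] it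
    shows that the weights have total mass almost 1; at [s = 0] only trees with an empty level [l]
    contribute. *)
Lemma gw_generating l (s e : R) : 0 <= s <= 1 -> 0 < e ->
  exists F : seq {fset (seq nat)}, [/\ uniq F, forall A, A \in F -> good_tree l A &
    iter l (fun x => expR (x - 1)) s - e <= \sum_(A <- F) gw_weight 1 l A * s ^+ #|` level A l|].
Proof.
elim: l s e => [|l IH] s e s01 e0.
  exists [:: [fset [::]]%fset]; split=> //.
    by move=> A; rewrite inE => /eqP ->; exact: good_root.
  rewrite big_seq1 gw_weight0 mul1r (_ : level _ 0 = [fset [::]]%fset) ?cardfs1 ?expr1 /=.
    by rewrite gerBl ltW.
  by apply/fsetP => u; rewrite in_level !inE; case: eqP => //= ->.
have e20 : 0 < e / 2 by lra.
have hs01 : 0 <= expR (s - 1) <= 1.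
  rewrite expR_ge0 -[X in _ <= X]expR0 ler_expR; lra.
(* The previous generation is evaluated at [expR (s - 1)], the Poisson(1) generating function at
   [s]. *)
have [F [uF gF hF]] := IH (expR (s - 1)) (e / 2) hs01 e20.
rewrite iterSr.
have cv : ((fun K => \sum_(A <- F) gw_weight 1 l A * (\sum_(k < K.+1) pois k * s ^+ k) ^+ #|` level A l|) @ \oo -->
   \sum_(A <- F) gw_weight 1 l A * expR (s - 1) ^+ #|` level A l|)%classic.
  apply: cvg_sum_seq => A; apply: cvgMl_tmp; apply: cvg_exprn.
  exact: poisson1_gen.
have [K hK] : exists K, \sum_(A <- F) gw_weight 1 l A * expR (s - 1) ^+ #|` level A l| - e / 2 <
   \sum_(A <- F) gw_weight 1 l A * (\sum_(k < K.+1) pois k * s ^+ k) ^+ #|` level A l|.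
  have /cvgrPdist_lt/(_ _ e20)[K _ hK] := cv; exists K.
  have := hK K (leqnn K); rewrite /= ltr_norml => /andP[_]; lra.
exists (flatten [seq [seq @extension l A K c | c <- enum {: {ffun level A l -> 'I_K.+1}}] | A <- F]); split.
- apply: allpairs_uniq_dep => //; first by move=> A _; exact: enum_uniq.
  move=> [A c] [B d] /allpairsPdep[A0 [c0 [A0F _ [eA ec]]]] /allpairsPdep[B0 [d0 [B0F _ [eB ed]]]] /= E.
  subst A0 B0; have gA := gF A A0F; have gB := gF B B0F.
  have eAB : A = B.
    by apply/fsetP => v; rewrite -(extension_trunc gA.2 c) -(extension_trunc gB.2 d) E.
  subst B; congr existT; exact: (extension_inj gA.1 gA.2 E).
- move=> B /flatten_mapP[A /gF[uhA dA] /mapP[c _ ->]].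
  by split; [exact: UHtree_extension|exact: depth_extension].
rewrite big_flatten big_map /=.
have -> : \sum_(A <- F) \sum_(B <- [seq @extension l A K c | c <- enum {: {ffun level A l -> 'I_K.+1}}]) gw_weight 1 l.+1 B * s ^+ #|` level B l.+1| =
  \sum_(A <- F) gw_weight 1 l A * (\sum_(k < K.+1) pois k * s ^+ k) ^+ #|` level A l|.
  rewrite [LHS]big_seq [RHS]big_seq; apply: eq_bigr => A /gF[uhA dA].
  by rewrite big_map big_enum /= sum_extension.
lra.
Qed.

(** The case [s = 1] for a single tree: as [K] grows, its extensions exhaust its weight. *)
Lemma gw_extension_mass l A (e : R) : good_tree l A -> 0 < e ->
  exists F : seq {fset (seq nat)}, [/\ uniq F,
    forall B, B \in F -> good_tree l.+1 B /\ (forall v, (v \in B) && (size v <= l)%N = (v \in A)) &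
    gw_weight 1 l A - e <= \sum_(B <- F) gw_weight 1 l.+1 B].
Proof.
move=> [uhA dA] e0.
have cv : ((fun K => gw_weight 1 l A * (\sum_(k < K.+1) pois k * 1 ^+ k) ^+ #|` level A l|) @ \oo -->
   gw_weight 1 l A * expR (1 - 1) ^+ #|` level A l|)%classic.
  apply: cvgMl_tmp; apply: cvg_exprn.
  exact: poisson1_gen.
have /cvgrPdist_lt/(_ _ e0)[K _ /(_ K (leqnn K))] := cv.
rewrite /= subrr expR0 expr1n mulr1 ltr_norml => /andP[_ hK].
exists [seq @extension l A K c | c <- enum {: {ffun level A l -> 'I_K.+1}}]; split.
- by rewrite map_inj_uniq ?enum_uniq//; exact: extension_inj.
- move=> B /mapP[c _ ->]; split; first by split; [exact: UHtree_extension|exact: depth_extension].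
  exact: extension_trunc.
rewrite big_map big_enum /=.
have := sum_extension K uhA dA 1.
under [X in X = _ -> _]eq_bigr => c _ do rewrite expr1n mulr1.
by move=> ->; lra.
Qed.

(* The iterates are the probabilities of extinction by generation l. *)
Lemma extinction : ((fun l => iter l (fun x : R => expR (x - 1)) 0) @ \oo --> (1 : R))%classic.
Proof.
set q := fun l => _.
have q01 l : 0 <= q l <= 1.
  case: l => [|l] /=; first by rewrite lexx ler01.
  rewrite /q /= expR_ge0 /= -[X in _ <= X]expR0 ler_expR.
  elim: l => [|l IH] /=; first by lra.
  by rewrite subr_le0 -[X in _ <= X]expR0 ler_expR.
have mono : {homo q : m n / (m <= n)%N >-> m <= n}.
  apply: homo_leq => // [x y z|l]; first exact: le_trans.
  elim: l => [|l IH] /=; first by rewrite expR_ge0.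
  by rewrite ler_expR lerB.
have cq : cvgn q.
  apply: nondecreasing_is_cvgn => //; exists 1 => _ [l _ <-]; by have /andP[] := q01 l.
set x := limn q.
have qx : (q @ \oo --> x)%classic := cq.
have x01 : 0 <= x <= 1.
  apply/andP; split.
    by apply: limr_ge => //; near=> l; have /andP[] := q01 l.
  by apply: limr_le => //; near=> l; have /andP[] := q01 l.
have fx : x = expR (x - 1).
  have h1 : ((fun l => q l.+1) @ \oo --> x)%classic by rewrite (cvg_shiftS q).
  have h2 : ((fun l => q l.+1) @ \oo --> expR (x - 1))%classic.
    have h3 : ((fun l => q l - 1) @ \oo --> x - 1)%classic by apply: cvgB => //; exact: cvg_cst.
    exact: (cvg_comp _ expR h3 (@continuous_expR _ (x - 1))).
  exact: (cvg_unique _ h1 h2).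
(* Criticality: by strict convexity of the exponential, 1 is the only fixed point. *)
suff x1 : x = 1 by move: qx; rewrite x1.
have [->//|ne] := eqVneq x 1.
have : 1 + (x - 1) < expR (x - 1) by apply: expR_gt1Dx; rewrite subr_eq0.
by rewrite -fx subrKC ltxx.
Unshelve. all: by end_near.
Qed.

End Weights.

(** * Concentration of structure counts *)

Section Tails.
Variable R : realType.

Lemma eq_imp_le (x y : R) : x = y -> x <= y.
Proof. by move=> ->. Qed.

(** Half of [e] covers the gap between the mean and [w], the other half is the deviation. With
    [t = e / (4 * C ^+ 2)] the exponent [t ^+ 2 * C ^+ 2 - t * e / 2] equals
    [- e ^+ 2 / (16 * C ^+ 2)]. Enlarging the Lipschitz constant [B] to [C = B + e] secures
    [t * C <= 4^-1]. *)
Lemma card_tail (I X : finType) (g : {ffun I -> X} -> nat) (B : nat) (n w e : R) :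
  (0 < #|X|)%N -> #|I|%:R <= n -> 0 < e ->
  (forall (f f' : {ffun I -> X}) i, (forall j, j != i -> f j = f' j) -> (g f <= g f' + B)%N) ->
  (w - e / 2) * n * #|{: {ffun I -> X}}|%:R <= (\sum_f g f)%:R ->
  #|[set f | (g f)%:R < (w - e) * n]|%:R <=
  expR (- (e ^+ 2 / (16 * (B%:R + e) ^+ 2)) * n) * #|{: {ffun I -> X}}|%:R.
Proof.
move=> X0 In e0 lip mean; set C := B%:R + e.
have C0 : 0 < C by rewrite ltr_wpDl.
have n0 : 0 <= n by apply: le_trans In.
pose t := e / (4 * C ^+ 2).
have t0 : 0 <= t by rewrite divr_ge0 ?mulr_ge0 ?exprn_ge0 ?ltW.
have tC : t * C <= 4^-1.
  have -> : t * C = 4^-1 * (e / C) by rewrite /t; field; rewrite gt_eqF.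
  by rewrite ger_pMr ?invr_gt0// ler_pdivrMr// mul1r /C lerDr.
have lipg : lipschitz_coord C (fun f => (g f)%:R : R).
  move=> f i y; have := lip f (upd f i y) i.
  have h j : j != i -> f j = upd f i y j by rewrite ffunE => /negbTE ->.
  move=> /(_ h) le; rewrite lerBlDl; apply: (@le_trans _ _ (g (upd f i y) + B)%:R).
    by rewrite ler_nat.
  by rewrite natrD lerD2l /C lerDl ltW.
have := mcdiarmid X0 (e / 2 * n) (ltW C0) t0 tC lipg.
set O := #|{: {ffun I -> X}}|%:R : R; set mu := _^-1 * _ => H.
have O0 : 0 < O by rewrite ltr0n card_ffun expn_gt0 X0.
have mule : (w - e / 2) * n <= mu.
  by rewrite /mu [leRHS]mulrC ler_pdivlMr// -natr_sum.
apply: (@le_trans _ _ (#|[pred f : {ffun I -> X} | (g f)%:R <= mu - e / 2 * n]|%:R)).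
  rewrite ler_nat; apply: subset_leq_card; apply/fintype.subsetP => f.
  rewrite !inE => /ltW h; apply: (le_trans h); rewrite lerBrDr; apply: le_trans mule.
  by rewrite -mulrDl; apply: eq_imp_le; congr (_ * _); lra.
apply: (le_trans H); rewrite mulrC ler_wpM2r ?(ltW O0)// ler_expR.
have le1 : #|I|%:R * (t ^+ 2 * C ^+ 2) <= n * (t ^+ 2 * C ^+ 2).
  by rewrite ler_wpM2r// mulr_ge0// exprn_ge0// ltW.
apply: (le_trans (lerB le1 (lexx _))).
have -> : n * (t ^+ 2 * C ^+ 2) - t * (e / 2 * n) = - (e ^+ 2 / (16 * C ^+ 2)) * n.
  by rewrite /t; field; rewrite gt_eqF.
by [].
Qed.

Lemma leq_expn_base a b k : (a <= b)%N -> (a ^ k <= b ^ k)%N.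
Proof. by case: k => // k; rewrite leq_exp2r. Qed.

Lemma leq_expn_ffact n h : ((n - h) ^ h <= n ^_ h)%N.
Proof.
rewrite ffact_prod -[X in (_ ^ X)%N]card_ord -prod_nat_const; apply: leq_prod => i _.
by rewrite leq_sub2l// ltnW.
Qed.

Lemma expR_le_1B (y : R) : y < 1 -> expR (- (y / (1 - y))) <= 1 - y.
Proof.
move=> y1; have p : 0 < 1 - y by lra.
rewrite expRN -[leRHS]invrK lef_pV2 ?posrE ?expR_gt0 ?invr_gt0//.
apply: le_trans (expR_ge1Dx _); apply: eq_imp_le; field; lra.
Qed.

Lemma cvg_shift_ratio (c d : R) :
  ((fun n => (n%:R - c) / (n%:R - d) : R) @ \oo --> (1 : R))%classic.
Proof.
have h : ((fun n => 1 + (d - c) * (n%:R - d)^-1 : R) @ \oo --> (1 + (d - c) * 0 : R))%classic.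
  apply: cvgD; first exact: cvg_cst.
  apply: cvgMl_tmp; apply/gtr0_cvgV0; first by near=> n; rewrite subr_gt0; near: n; exact: nbhs_infty_gtr.
  rewrite (_ : (fun n => _) = (fun n => - d + n%:R)); last by apply/funext => n; rewrite addrC.
  apply/cvgryPge => A; near=> n; rewrite addrC lerBrDr; near: n; exact: nbhs_infty_ger.
rewrite mulr0 addr0 in h; apply: cvg_trans h; apply: near_eq_cvg; near=> n.
have : n%:R - d != 0 :> R by rewrite gt_eqF// subr_gt0; near: n; exact: nbhs_infty_gtr.
by move=> ?; field.
Unshelve. all: by end_near.
Qed.

(** Puts the exact count into a form with a visible limit: when [m / n] tends to 1/2, the first two
    factors tend to 1 and the exponential to [expR (- a)]. *)
Lemma numeric_mean_A (n m h a P S : nat) : (0 < P)%N -> (0 < h)%N -> (h < n)%N -> (h < m)%N -> (a.+1 < n)%N ->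
  (n ^_ h * (m ^_ h.-1 * 'C(n - a, 2) ^ (m - h.-1)) <= P * S)%N ->
  (1 - h%:R / n%:R) ^+ h * ((2 * (m%:R - h%:R)) / n%:R) ^+ h.-1 *
   expR (- (2 * m%:R * a%:R / (n%:R - 1 - a%:R))) / P%:R * n%:R * ('C(n, 2) ^ m)%:R
  <= S%:R :> R.
Proof.
move=> P_gt0 h0 hn hm an; set B := 'C(n - a, 2); set N := 'C(n, 2) => key.
have P0 : 0 < P%:R :> R by rewrite ltr0n.
have n0 : 0 < n%:R :> R by rewrite ltr0n; lia.
rewrite -(ler_pM2l P0) -[leRHS]natrM; apply: le_trans (_ : (n ^_ h * (m ^_ h.-1 * B ^ (m - h.-1)))%:R <= _); last by rewrite ler_nat.
have N2 : N%:R * 2 = n%:R * (n%:R - 1) :> R.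
  have := bin_ffact n 2; rewrite (_ : 2`! = 2%N)//= ffactnS ffactn1 => /(congr1 (fun k => k%:R : R)).
  by rewrite !natrM => ->; rewrite -subn1 natrB//; lia.
have B2 : B%:R * 2 = (n%:R - a%:R) * (n%:R - a%:R - 1) :> R.
  have := bin_ffact (n - a) 2; rewrite (_ : 2`! = 2%N)//= ffactnS ffactn1 => /(congr1 (fun k => k%:R : R)).
  by rewrite !natrM => ->; rewrite -subn1 !natrB ?subn_gt0 ?(ltnW an)// ltnW// ltnW.
clearbody B N.
have an' : a%:R + 1 < n%:R :> R by rewrite natr1 ltr_nat.
have a0 : 0 <= a%:R :> R by [].
have N0 : 0 < N%:R :> R.
  have : 0 < N%:R * 2 :> R by rewrite N2 mulr_gt0//; lra.
  lra.
set y : R := a%:R / (n%:R - 1).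
have y1 : y < 1 by rewrite /y ltr_pdivrMr; lra.
have BN : (1 - y) ^+ 2 * N%:R <= B%:R :> R.
  rewrite -(ler_pM2r (ltr0n R 2)) -mulrA N2 B2.
  have -> : (1 - y) ^+ 2 * (n%:R * (n%:R - 1)) = (n%:R - a%:R - 1) ^+ 2 * (n%:R / (n%:R - 1)).
    by rewrite /y; field; lra.
  have -> : (n%:R - a%:R) * (n%:R - a%:R - 1) = (n%:R - a%:R - 1) ^+ 2 * ((n%:R - a%:R) / (n%:R - a%:R - 1)) :> R.
    by field; lra.
  apply: ler_wpM2l; first by apply: exprn_ge0; lra.
  rewrite ler_pdivrMr; last by lra.
  rewrite mulrAC ler_pdivlMr; last by lra.
  rewrite -subr_ge0 (_ : _ - _ = a%:R)//; ring.
have Nn : N%:R * (2 / n%:R ^+ 2) <= 1 :> R.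
  rewrite mulrA N2 ler_pdivrMr ?exprn_gt0// mul1r expr2 ler_wpM2l//; lra.
have BNexp : expR (- (2 * m%:R * a%:R / (n%:R - 1 - a%:R))) * N%:R ^+ (m - h.-1) <= B%:R ^+ (m - h.-1) :> R.
  apply: (@le_trans _ _ (((1 - y) ^+ 2 * N%:R) ^+ (m - h.-1))); last first.
    by apply: lerXn2r; rewrite ?nnegrE// mulr_ge0// exprn_ge0; lra.
  rewrite exprMn; apply: ler_wpM2r; first exact: exprn_ge0.
  rewrite -exprM; apply: (@le_trans _ _ ((1 - y) ^+ (2 * m))); last first.
    apply: ler_wiXn2l; [lra| |by rewrite leq_mul2l leq_subr].
    by rewrite gerBl divr_ge0//; lra.
  apply: (@le_trans _ _ (expR (- (y / (1 - y))) ^+ (2 * m))); last first.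
    by apply: lerXn2r; rewrite ?nnegrE ?expR_ge0//; [lra|exact: expR_le_1B].
  rewrite -expRM_natl ler_expR natrM; apply: eq_imp_le; rewrite /y; field.
  by apply/andP; split; lra.
rewrite natrM natrM.
have f1 : ((1 - h%:R / n%:R) * n%:R) ^+ h <= (n ^_ h)%:R :> R.
  have -> : (1 - h%:R / n%:R) * n%:R = (n - h)%:R :> R.
    by rewrite mulrBl mul1r divfK ?gt_eqF// natrB// ltnW.
  by rewrite -natrX ler_nat leq_expn_ffact.
have f2 : (m%:R - h%:R) ^+ h.-1 <= (m ^_ h.-1)%:R :> R.
  rewrite -natrB 1?ltnW// -natrX ler_nat; apply: leq_trans (leq_expn_ffact _ _).
  by apply: leq_expn_base; rewrite leq_sub2l ?leq_pred.
have mh : h%:R <= m%:R :> R by rewrite ler_nat ltnW.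
have hn' : h%:R <= n%:R :> R by rewrite ler_nat ltnW.
set e := expR _ in BNexp *.
have e0 : 0 <= e by exact: expR_ge0.
apply: le_trans (_ : ((1 - h%:R / n%:R) * n%:R) ^+ h * ((m%:R - h%:R) ^+ h.-1 * (e * N%:R ^+ (m - h.-1))) <= _); last first.
  rewrite natrX; apply: ler_pM => //; rewrite ?exprn_ge0// ?mulr_ge0 ?exprn_ge0 ?subr_ge0//.
    by rewrite ler_pdivrMr ?mul1r.
  by apply: ler_pM => //; rewrite ?exprn_ge0 ?mulr_ge0 ?exprn_ge0 ?subr_ge0.
have eN : (N ^ m)%:R = N%:R ^+ (m - h.-1) * N%:R ^+ h.-1 :> R.
  have em : (m - h.-1 + h.-1 = m)%N by rewrite subnK// (leq_trans (leq_pred _) (ltnW hm)).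
  by rewrite -[in LHS]em expnD natrM !natrX.
rewrite eN.
have -> : P%:R * ((1 - h%:R / n%:R) ^+ h * (2 * (m%:R - h%:R) / n%:R) ^+ h.-1 * e / P%:R * n%:R * (N%:R ^+ (m - h.-1) * N%:R ^+ h.-1)) =
   ((1 - h%:R / n%:R) ^+ h * (m%:R - h%:R) ^+ h.-1 * e * N%:R ^+ (m - h.-1)) * (n%:R * ((2 / n%:R) * N%:R) ^+ h.-1) :> R.
  rewrite (_ : 2 * (m%:R - h%:R) / n%:R = (m%:R - h%:R) * (2 / n%:R)); last by field; rewrite gt_eqF.
  rewrite !exprMn; field; rewrite gt_eqF//.
have -> : ((1 - h%:R / n%:R) * n%:R) ^+ h * ((m%:R - h%:R) ^+ h.-1 * (e * N%:R ^+ (m - h.-1))) =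
   ((1 - h%:R / n%:R) ^+ h * (m%:R - h%:R) ^+ h.-1 * e * N%:R ^+ (m - h.-1)) * n%:R ^+ h :> R.
  by rewrite exprMn; ring.
apply: ler_wpM2l.
  rewrite !mulr_ge0 ?exprn_ge0 ?subr_ge0//; by rewrite ler_pdivrMr ?mul1r.
have eh : n%:R ^+ h = n%:R * n%:R ^+ h.-1 :> R by rewrite -exprS prednK.
rewrite eh; apply: ler_wpM2l; first exact: ltW.
apply: lerXn2r; rewrite ?nnegrE ?mulr_ge0 ?invr_ge0 ?(ltW n0)//.
have Nn' : n%:R * (N%:R * (2 / n%:R ^+ 2)) <= n%:R * 1 :> R by rewrite ler_pM2l.
rewrite mulr1 in Nn'; apply: le_trans Nn'; apply: eq_imp_le; field; rewrite gt_eqF//.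
Qed.

Lemma numeric_mean_B (n h a P S : nat) : (0 < P)%N -> (0 < h)%N -> (h < n)%N -> (a < n)%N ->
  (n ^_ h * (n - a) ^ (n - h.-1) <= P * S)%N ->
  (1 - h%:R / n%:R) ^+ h * expR (- (n%:R * a%:R / (n%:R - a%:R))) / P%:R * n%:R * (n ^ n)%:R
  <= S%:R :> R.
Proof.
move=> P_gt0 h0 hn an key.
have P0 : 0 < P%:R :> R by rewrite ltr0n.
have n0 : 0 < n%:R :> R by rewrite ltr0n; lia.
rewrite -(ler_pM2l P0) -[leRHS]natrM; apply: le_trans (_ : (n ^_ h * (n - a) ^ (n - h.-1))%:R <= _); last by rewrite ler_nat.
have an' : a%:R < n%:R :> R by rewrite ltr_nat.
have a0 : 0 <= a%:R :> R by [].
have hn' : h%:R <= n%:R :> R by rewrite ler_nat ltnW.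
set y : R := a%:R / n%:R.
have y1 : y < 1 by rewrite /y ltr_pdivrMr// mul1r.
have y0 : 0 <= y by rewrite divr_ge0.
have BNexp : expR (- (n%:R * a%:R / (n%:R - a%:R))) * n%:R ^+ (n - h.-1) <= (n - a)%:R ^+ (n - h.-1) :> R.
  have -> : (n - a)%:R = (1 - y) * n%:R :> R.
    by rewrite mulrBl mul1r divfK ?gt_eqF// natrB// ltnW.
  rewrite exprMn; apply: ler_wpM2r; first exact: exprn_ge0.
  apply: (@le_trans _ _ ((1 - y) ^+ n)); last first.
    by apply: ler_wiXn2l; [lra|rewrite gerBl|rewrite leq_subr].
  apply: (@le_trans _ _ (expR (- (y / (1 - y))) ^+ n)); last first.
    by apply: lerXn2r; rewrite ?nnegrE ?expR_ge0//; [lra|exact: expR_le_1B].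
  rewrite -expRM_natl ler_expR; apply: eq_imp_le; rewrite /y; field.
  by apply/andP; split; rewrite gt_eqF// subr_gt0.
have f1 : ((1 - h%:R / n%:R) * n%:R) ^+ h <= (n ^_ h)%:R :> R.
  have -> : (1 - h%:R / n%:R) * n%:R = (n - h)%:R :> R.
    by rewrite mulrBl mul1r divfK ?gt_eqF// natrB// ltnW.
  by rewrite -natrX ler_nat leq_expn_ffact.
set e := expR _ in BNexp *.
have e0 : 0 <= e by exact: expR_ge0.
rewrite natrM natrX natrX.
apply: le_trans (_ : ((1 - h%:R / n%:R) * n%:R) ^+ h * (e * n%:R ^+ (n - h.-1)) <= _); last first.
  apply: ler_pM => //; rewrite ?exprn_ge0 ?mulr_ge0 ?exprn_ge0 ?subr_ge0//.
  by rewrite ler_pdivrMr ?mul1r.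
have eN : n%:R ^+ n = n%:R ^+ (n - h.-1) * n%:R ^+ h.-1 :> R by rewrite -exprD subnK// (leq_trans (leq_pred _) (ltnW hn)).
have eh : n%:R ^+ h = n%:R * n%:R ^+ h.-1 :> R by rewrite -exprS prednK.
rewrite eN exprMn eh; apply: eq_imp_le; field.
by rewrite !gt_eqF.
Qed.

Section Structure.
Variables (L : nat) (As : forest).
Hypothesis vA : valid_forest L As.
Notation h := #|{: nodes As}|.
Notation a := #|interior L As|.

Definition forest_weight (L : nat) (As : forest) : R :=
  \prod_(i < size As) gw_weight 1 (L - i) (nth fset0 As i).

Definition kids_fact : nat := (\prod_(x : nodes As) (#|kids vA x|)`!)%N.

Lemma kids_fact_gt0 : (0 < kids_fact)%N.
Proof. by apply: prodn_gt0 => x; exact: fact_gt0. Qed.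

(** Each interior node contributes [expR (-1)] over the factorial of its offspring number; nodes of
    depth [L] have no children, so their factorials are 1. *)
Lemma forest_weightE : forest_weight L As = expR (-1) ^+ a / kids_fact%:R.
Proof.
have -> : forest_weight L As =
    \prod_(x : nodes As | (depD x < L)%N) poisson_pmf 1 (nchildren (nth fset0 As (val x).1) (val x).2).
  rewrite -(big_seq_fsetE _ (nodes As) (fun q => q.1 + size q.2 < L)%N (fun q => poisson_pmf 1 (nchildren (nth fset0 As q.1) q.2))).
  pose s := flatten [seq [seq (i, u) | u <- enum_fset (nth fset0 As i)] | i <- iota 0 (size As)].
  have us : uniq s.
    apply: allpairs_uniq_dep => [||[i u] [j v] _ _ [-> ->]//]; first exact: iota_uniq.
    by move=> i _; exact: fset_uniq.
  have pe : perm_eq (enum_fset (nodes As)) s.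
    by apply: uniq_perm; [exact: fset_uniq|exact: us|move=> q; exact: seq_fsetE].
  rewrite (perm_big _ pe) /= /s big_flatten big_map /=.
  rewrite /forest_weight -(big_mkord xpredT (fun i => gw_weight 1 (L - i) (nth fset0 As i))) /index_iota subn0.
  apply: eq_bigr => i _; rewrite big_map /gw_weight; apply: eq_bigl => u /=.
  by rewrite ltn_subRL.
rewrite (eq_bigr (fun x => expR (-1) * ((#|kids vA x|)`!%:R)^-1)); last first.
  by move=> x _; rewrite -(card_kids vA) poisson1E mulrC.
rewrite big_split /= prodr_const; congr (_ ^+ _ * _).
  by apply: eq_card => x; rewrite !inE.
rewrite /kids_fact natr_prod [in RHS](bigID (fun x => depD x < L)%N) /=.
rewrite [X in _ * X]big1 ?mulr1 ?prodfV// => x xL.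
have -> : #|kids vA x| = 0%N.
  apply/eqP; rewrite cards_eq0 -finset.subset0; apply/fintype.subsetP => y yx.
  have [_ yr] := kids_nb yx; move: yx; rewrite inE => /andP[_ /eqP py].
  by have := depD_par yr; have := depD_le vA y; rewrite py; move: xL; rewrite -leqNgt => ? ? ?; exfalso; lia.
by rewrite fact0.
Qed.

End Structure.

Lemma card_edge n : #|{: edge n}| = 'C(n, 2).
Proof.
rewrite card_sig -[X in 'C(X, _)]card_ord -card_draws.
by apply: eq_card => e; rewrite !inE.
Qed.

Section ModelA.
Variables (L : nat) (As : forest).
Hypotheses (vA : valid_forest L As) (sz : size As = 1%N).
Notation h := #|{: nodes As}|.
Notation a := #|interior L As|.

Lemma mean_lower_A n m : (h < n)%N -> (h < m)%N -> (a.+1 < n)%N ->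
  (1 - h%:R / n%:R) ^+ h * ((2 * (m%:R - h%:R)) / n%:R) ^+ h.-1 *
   expR (- (2 * m%:R * a%:R / (n%:R - 1 - a%:R))) / (kids_fact vA)%:R * n%:R * #|{: {ffun 'I_m -> edge n}}|%:R
  <= (\sum_(w : {ffun 'I_m -> edge n}) #|structure_roots vA w|)%:R :> R.
Proof.
move=> hn hm an; set P := kids_fact vA.
have h0 : (0 < h)%N by apply/card_gt0P; exists (rootD vA).
have key : (n ^_ h * (m ^_ h.-1 * 'C(n - a, 2) ^ (m - h.-1)) <=
    P * \sum_(w : {ffun 'I_m -> edge n}) #|structure_roots vA w|)%N.
  have := sum_structure_roots vA n m sz.
  have := card_embeddings vA (@nat_of_ord n); rewrite card_ord -/(kids_fact vA) -/P.
  move=> h1 h2; apply: leq_trans (leq_mul (leqnn P) h2).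
  by rewrite [leqRHS]mulnA leq_mul2r; apply/orP; right; rewrite mulnC; exact: h1.
have -> : #|{: {ffun 'I_m -> edge n}}| = ('C(n, 2) ^ m)%N by rewrite card_ffun card_edge card_ord.
exact: numeric_mean_A (kids_fact_gt0 vA) h0 hn hm an key.
Qed.

Lemma tail_A (m : nat -> nat) (e : R) :
  ((fun n => (m n)%:R / n%:R : R) @ \oo --> (2^-1 : R))%classic -> 0 < e ->
  exists2 c : R, 0 < c & (\forall n \near \oo,
    #|[set w : {ffun 'I_(m n) -> edge n} | #|structure_roots vA w|%:R < (forest_weight L As - e) * n%:R]%SET|%:R
    <= expR (- c * n%:R) * #|{: {ffun 'I_(m n) -> edge n}}|%:R)%classic.
Proof.
move=> mcv e0; set P := kids_fact vA.
have P0 : 0 < P%:R :> R by rewrite ltr0n kids_fact_gt0.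
exists (e ^+ 2 / (16 * ((4 * near_bound L As)%:R + e) ^+ 2)).
  by rewrite divr_gt0 ?exprn_gt0// mulr_gt0// exprn_gt0// ltr_wpDl.
have gcv : ((fun n => (1 - h%:R / n%:R) ^+ h * ((2 * ((m n)%:R - h%:R)) / n%:R) ^+ h.-1 *
   expR (- (2 * (m n)%:R * a%:R / (n%:R - 1 - a%:R))) / P%:R : R) @ \oo --> forest_weight L As)%classic.
  have inv0 : ((fun n => n%:R^-1 : R) @ \oo --> (0 : R))%classic.
    apply/gtr0_cvgV0; first by near=> n; rewrite ltr0n; near: n; exact: nbhs_infty_gt.
    exact: cvgr_idn.
  rewrite (forest_weightE vA).
  rewrite (_ : _ ^+ a = (1 - h%:R * 0) ^+ h * (2 * (2^-1 - h%:R * 0)) ^+ h.-1 * expR (- (2 * 2^-1 * a%:R * 1))); last first.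
    rewrite !mulr0 !subr0 expr1n divff// expr1n !mul1r mulr1 -expRM_natl; congr expR; ring.
  apply: cvgMr_tmp; apply: cvgM; first apply: cvgM.
  - by apply: cvg_exprn; apply: cvgB; [exact: cvg_cst|apply: cvgMl_tmp].
  - apply: cvg_exprn; rewrite (_ : (fun n => _) = (fun n => 2 * ((m n)%:R / n%:R - h%:R * n%:R^-1))).
      by apply: cvgMl_tmp; apply: cvgB => //; apply: cvgMl_tmp.
    by apply/funext => n; rewrite -mulrA mulrBl.
  - have h3 : ((fun n => - (2 * ((m n)%:R / n%:R) * a%:R * ((n%:R - 0) / (n%:R - (1 + a%:R))))) @ \oo --> - (2 * 2^-1 * a%:R * 1 : R))%classic.
      apply: cvgN; apply: cvgM; last exact: cvg_shift_ratio.
      by apply: cvgMr_tmp; apply: cvgMl_tmp.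
    have := cvg_comp _ (@expR R) h3 (@continuous_expR _ _); apply: cvg_trans.
    apply: near_eq_cvg; near=> n; congr expR; congr (- _).
    have nn0 : n%:R != 0 :> R by rewrite pnatr_eq0 -lt0n; near: n; exact: nbhs_infty_gt.
    have na : n%:R - 1 - a%:R != 0 :> R.
      rewrite gt_eqF// -addrA -opprD subr_gt0 addrC natr1 ltr_nat.
      by near: n; exact: nbhs_infty_gt.
    by rewrite /=; field; rewrite na nn0.
have e20 : 0 < e / 2 by lra.
have /cvgrPdist_lt/(_ _ e20) ev := gcv.
have e80 : 0 < (8^-1 : R) by [].
have /cvgrPdist_lt/(_ _ e80) mv := mcv.
near=> n.
have n0 : (0 < n)%N by near: n; exact: nbhs_infty_gt.
have n0' : 0 < n%:R :> R by rewrite ltr0n.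
have mn : `|2^-1 - (m n)%:R / n%:R| < 8^-1 :> R by near: n.
have [mlo mhi] : (4^-1 : R) * n%:R < (m n)%:R /\ (m n)%:R < n%:R :> R.
  move: mn; rewrite ltr_norml => /andP[m1 m2]; split.
    by rewrite -ltr_pdivlMr//; lra.
  by rewrite -[ltRHS]mul1r -ltr_pdivrMr//; lra.
apply: card_tail => //.
- by rewrite card_edge bin_gt0; near: n; exact: nbhs_infty_gt.
- by rewrite card_ord ltW.
- by move=> w w' i; exact: structure_roots_change.
have hn : (h < n)%N by near: n; exact: nbhs_infty_gt.
have an : (a.+1 < n)%N by near: n; exact: nbhs_infty_gt.
have h4 : (4 * h <= n)%N by near: n; exact: nbhs_infty_ge.
have hm : (h < m n)%N.
  rewrite -(ltr_nat R); apply: le_lt_trans mlo; rewrite mulrC ler_pdivlMr// -natrM ler_nat mulnC; lia.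
apply: le_trans (mean_lower_A hn hm an).
rewrite ler_wpM2r// ler_wpM2r//.
have : `|forest_weight L As - ((1 - h%:R / n%:R) ^+ h * ((2 * ((m n)%:R - h%:R)) / n%:R) ^+ h.-1 *
   expR (- (2 * (m n)%:R * a%:R / (n%:R - 1 - a%:R))) / P%:R)| < e / 2 by near: n.
by rewrite ltr_norml => /andP[_]; rewrite ltrBlDr => /ltW ?; rewrite lerBlDr [leRHS]addrC.
Unshelve. all: by end_near.
Qed.

End ModelA.

Section ModelB.
Variables (L : nat) (As : forest).
Hypotheses (vA : valid_forest L As) (full_spine : size As = L.+1).
Notation h := #|{: nodes As}|.
Notation a := #|interior L As|.

Lemma mean_lower_B (V : finType) (rk : V -> nat) : injective rk -> (h < #|V|)%N -> (a < #|V|)%N ->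
  (1 - h%:R / #|V|%:R) ^+ h * expR (- (#|V|%:R * a%:R / (#|V|%:R - a%:R))) / (kids_fact vA)%:R * #|V|%:R * #|{: {ffun V -> V}}|%:R
  <= (\sum_(f : {ffun V -> V}) #|map_roots vA full_spine rk f|)%:R :> R.
Proof.
move=> rki hn an; set P := kids_fact vA; set n := #|V| in hn an *.
have h0 : (0 < h)%N by apply/card_gt0P; exists (rootD vA).
have key : (n ^_ h * (n - a) ^ (n - h.-1) <=
    P * \sum_(f : {ffun V -> V}) #|map_roots vA full_spine rk f|)%N.
  have := sum_map_roots vA full_spine rki.
  have := card_embeddings vA rk; rewrite -/(kids_fact vA) -/P -/n.
  move=> h1 h2; apply: leq_trans (leq_mul (leqnn P) h2).
  by rewrite [leqRHS]mulnA leq_mul2r; apply/orP; right; rewrite mulnC; exact: h1.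
have -> : #|{: {ffun V -> V}}| = (n ^ n)%N by rewrite card_ffun.
exact: numeric_mean_B (kids_fact_gt0 vA) h0 hn an key.
Qed.

(** Uniform in the type [V], which will be the varying vertex set of the largest component. *)
Lemma tail_B (e : R) : 0 < e ->
  exists2 c : R, 0 < c & exists k0 : nat, forall (V : finType) (rk : V -> nat), injective rk -> (k0 <= #|V|)%N ->
    #|[set f : {ffun V -> V} | #|map_roots vA full_spine rk f|%:R < (forest_weight L As - e) * #|V|%:R]|%:R
    <= expR (- c * #|V|%:R) * #|{: {ffun V -> V}}|%:R.
Proof.
move=> e0; set P := kids_fact vA.
have P0 : 0 < P%:R :> R by rewrite ltr0n kids_fact_gt0.
exists (e ^+ 2 / (16 * ((3 * near_bound L As)%:R + e) ^+ 2)).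
  by rewrite divr_gt0 ?exprn_gt0// mulr_gt0// exprn_gt0// ltr_wpDl.
have gcv : ((fun n => (1 - h%:R / n%:R) ^+ h * expR (- (n%:R * a%:R / (n%:R - a%:R))) / P%:R : R) @ \oo --> forest_weight L As)%classic.
  have inv0 : ((fun n => n%:R^-1 : R) @ \oo --> (0 : R))%classic.
    apply/gtr0_cvgV0; first by near=> n; rewrite ltr0n; near: n; exact: nbhs_infty_gt.
    exact: cvgr_idn.
  rewrite (forest_weightE vA).
  rewrite (_ : _ ^+ a = (1 - h%:R * 0) ^+ h * expR (- (a%:R * 1))); last first.
    rewrite !mulr0 !subr0 expr1n !mul1r mulr1 -expRM_natl; congr expR; ring.
  apply: cvgMr_tmp; apply: cvgM.
  - by apply: cvg_exprn; apply: cvgB; [exact: cvg_cst|apply: cvgMl_tmp].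
  - have h3 : ((fun n => - (a%:R * ((n%:R - 0) / (n%:R - a%:R)))) @ \oo --> - (a%:R * 1 : R))%classic.
      by apply: cvgN; apply: cvgMl_tmp; exact: cvg_shift_ratio.
    have := cvg_comp _ (@expR R) h3 (@continuous_expR _ _); apply: cvg_trans.
    apply: near_eq_cvg; near=> n; congr expR; congr (- _).
    by rewrite /= subr0 mulrA [a%:R * _]mulrC.
have e20 : 0 < e / 2 by lra.
have /cvgrPdist_lt/(_ _ e20)[k1 _ hk1] := gcv.
exists (k1 + h + a).+1 => V rk rki kV; apply: card_tail => //.
- by apply: leq_trans kV.
- by move=> w w' i; exact: map_roots_change.
have hn : (h < #|V|)%N by lia.
have an : (a < #|V|)%N by lia.
apply: le_trans (mean_lower_B rki hn an).
rewrite ler_wpM2r// ler_wpM2r//.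
have k1V : (k1 <= #|V|)%N by apply: leq_trans kV; rewrite leqW// -addnA leq_addr.
have := hk1 #|V| k1V; rewrite /= ltr_norml => /andP[_].
by rewrite ltrBlDr => /ltW ?; rewrite lerBlDr [leRHS]addrC.
Unshelve. all: by end_near.
Qed.

End ModelB.
End Tails.

(** * Enumeration of forests *)

Section ForestCount.
Variable R : realType.
Variable n : nat.
Hypothesis n_gt0 : (0 < n)%N.

(** The number of sequences of [j] ordered pairs of vertices that form a forest with [j] edges; it
    is compared with [n ^ (2 * j)]. *)
Definition ordered_forests j : R := 2 ^+ j * (j`!)%:R * #|forests n j|%:R.

Let n0 : 0 < n%:R :> R. Proof. by rewrite ltr0n. Qed.

Let f j : R := #|forests n j|%:R.
Let X j : R := (\sum_(E in forests n j) #|connected_pairs E|)%:R.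

Lemma forests_pairs j : n%:R ^+ 2 * f j - X j <= 2 * j.+1%:R * f j.+1.
Proof.
have := forests_disconnected n j; rewrite -(ler_nat R) !natrM; apply: le_trans.
rewrite lerBlDr /X -natrD -big_split /=.
rewrite (eq_bigr (fun _ => (n ^ 2)%N)) => [|E _].
  by rewrite sum_nat_const natrM natrX mulrC.
by rewrite addnC cardsC card_prod card_ord expnS expn1.
Qed.

Lemma ordered_forestsS j (b : R) : b * f j <= 2 * j.+1%:R * f j.+1 ->
  b * ordered_forests j <= ordered_forests j.+1.
Proof.
move=> H; rewrite /ordered_forests exprS factS natrM -/(f j) -/(f j.+1).
have := H; rewrite -(ler_pM2l (_ : 0 < 2 ^+ j * (j`!)%:R)); last first.
  by rewrite mulr_gt0// ?exprn_gt0// ltr0n fact_gt0.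
by move=> H'; rewrite mulrCA; apply: (le_trans H'); apply: eq_imp_le; ring.
Qed.

(** * Forests with at most (1 - d) n / 2 edges *)

Section Subcritical.
Variable d : R.
Hypotheses (d0 : 0 < d) (d1 : d <= 2^-1) (nlarge : 4 / d ^+ 2 <= n%:R).
(** The solution of [1 + C * (1 - d) / (1 - d / 2) = C], so that the induction in
    [connected_pairs_le] closes with equality. *)
Let C : R := 2 / d - 1.

Let C_ge0 : 0 <= C.
Proof.
have d0' := d0; have d1' := d1; have n0' := n0;  by rewrite /C subr_ge0 ler_pdivlMr// mul1r; lra. Qed.

Let C_le : C <= d / 2 * n%:R.
Proof.
have d0' := d0; have d1' := d1; have n0' := n0; have C0' := C_ge0.
have : d / 2 * (4 / d ^+ 2) <= d / 2 * n%:R by rewrite ler_pM2l//; lra.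
have -> : d / 2 * (4 / d ^+ 2) = 2 / d by field; lra.
by rewrite /C => ?; lra.
Qed.

(** While [2 * j.+1 <= (1 - d) * n] and few pairs are connected, adding an edge damps the previous
    mean number of connected pairs by [(1 - d) / (1 - d / 2) < 1] and adds [n] diagonal pairs. *)
Lemma connected_pairs_le j : 2 * j%:R <= (1 - d) * n%:R -> X j <= C * n%:R * f j.
Proof.
have d0' := d0; have d1' := d1; have n0' := n0; have C0' := C_ge0.
elim: j => [_|j IH jn].
  have -> : X 0 = n%:R.
    rewrite /X (eq_bigr (fun _ => n)) => [|E].
      by rewrite sum_nat_const forests0 mul1n.
    rewrite finset.inE => /and3P[_ /eqP/cards0_eq -> _].
    rewrite -[RHS]card_ord -[RHS]cardsT -(card_imset _ (_ : injective (fun x : 'I_n => (x, x)))); last by move=> x y [].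
    congr #|pred_of_set _|; apply/setP => -[x y]; rewrite finset.inE /=.
    apply/connectP/imsetP => [[[|z p] /=]|[z _ [-> ->]]].
    - by move=> _ ->; exists x.
    - by rewrite {1}/adj finset.inE.
    - by exists [::].
  rewrite /f forests0 mulr1 -[leLHS]mul1r ler_wpM2r// /C lerBrDr ler_pdivlMr//; lra.
have jn' : 2 * j%:R <= (1 - d) * n%:R by apply: le_trans jn; rewrite ler_wpM2l// ler_nat.
have {}IH := IH jn'.
have step := forests_connected n j; rewrite -(ler_nat R) natrD !natrM -/(X j.+1) -/(X j) -/(f j.+1) in step.
have pr := forests_pairs j.
have fj : 0 <= f j by []. have fj1 : 0 <= f j.+1 by [].
have h1 : (1 - d / 2) * n%:R ^+ 2 * f j <= 2 * j.+1%:R * f j.+1.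
  apply: le_trans pr; rewrite mulrBl mul1r mulrBl lerD2l lerN2; apply: (le_trans IH).
  by rewrite expr2 mulrA ler_wpM2r// ler_wpM2r.
have h2 : 2 * j.+1%:R * f j.+1 <= (1 - d) * n%:R * f j.+1 by rewrite ler_wpM2r.
have q0 : 0 < 1 - d / 2 by lra.
have h3 : n%:R * (C * n%:R * f j) <= C * ((1 - d) / (1 - d / 2)) * n%:R * f j.+1.
  have -> : n%:R * (C * n%:R * f j) = C / (1 - d / 2) * ((1 - d / 2) * n%:R ^+ 2 * f j) by field; lra.
  have -> : C * ((1 - d) / (1 - d / 2)) * n%:R * f j.+1 = C / (1 - d / 2) * ((1 - d) * n%:R * f j.+1) by field; lra.
  by apply: ler_wpM2l; [rewrite divr_ge0//; lra|exact: le_trans h1 h2].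
have h4 : n%:R * X j <= n%:R * (C * n%:R * f j) by rewrite ler_pM2l.
apply: (le_trans step); apply: (le_trans (lerD (lexx _) (le_trans h4 h3))).
by apply: eq_imp_le; rewrite /C; field; lra.
Qed.

(** At each step at most a proportion [C / n] of the pairs is connected, so at most [n] steps
    together lose only a constant factor. *)
Lemma ordered_forests_subcritical j : 2 * j%:R <= (1 - d) * n%:R ->
  expR (- (4 / d)) * n%:R ^+ (2 * j) <= ordered_forests j.
Proof.
have d0' := d0; have d1' := d1; have n0' := n0; have C0' := C_ge0.
move=> jn; pose y := C / n%:R.
have y2 : y <= 2^-1 by rewrite ler_pdivrMr//; have := C_le; nra.
have y0 : 0 <= y by rewrite divr_ge0.
have H : (n%:R ^+ 2 * (1 - y)) ^+ j <= ordered_forests j.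
  elim: j jn => [_|j IH jn].
    by rewrite expr0 /ordered_forests expr0 fact0 forests0 !mulr1.
  have jn' : 2 * j%:R <= (1 - d) * n%:R by apply: le_trans jn; rewrite ler_wpM2l// ler_nat.
  rewrite exprS; apply: le_trans (_ : n%:R ^+ 2 * (1 - y) * ordered_forests j <= _).
    by rewrite ler_wpM2l ?IH// mulr_ge0 ?exprn_ge0//; lra.
  apply: ordered_forestsS; apply: le_trans (forests_pairs j).
  rewrite mulrBr mulr1 mulrBl lerD2l lerN2; apply: (le_trans (connected_pairs_le jn')).
  by apply: eq_imp_le; rewrite /y; field; lra.
apply: le_trans H; rewrite exprMn mulrC exprM ler_wpM2l ?exprn_ge0//.
have e1 : expR (- (2 * y)) <= 1 - y.
  apply: le_trans (expR_le_1B _); last by lra.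
  by rewrite ler_expR lerN2 ler_pdivrMr; [nra|lra].
have jn2 : j%:R <= n%:R :> R by have : 0 <= j%:R :> R by []; nra.
apply: (@le_trans _ _ (expR (- (2 * y)) ^+ j)); last first.
  by apply: lerXn2r; rewrite ?nnegrE ?expR_ge0//; lra.
rewrite -expRM_natl ler_expR mulrN lerN2.
apply: (@le_trans _ _ (n%:R * (2 * y))); first by rewrite ler_wpM2r// mulr_ge0.
rewrite /y (_ : n%:R * (2 * (C / n%:R)) = 2 * C); last by field; lra.
by rewrite /C; have : 0 <= d^-1; [rewrite invr_ge0 ltW|]; lra.
Qed.

End Subcritical.

(** For the last few edges a constant factor per edge is affordable: at least [n / 4] components
    remain, and their representatives alone give more than [n ^ 2 / 64] pairs. *)
Lemma ordered_forests_rest j i : (8 <= n)%N -> (j + i)%:R <= 3 / 4 * n%:R :> R ->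
  ordered_forests j * (n%:R ^+ 2 / 64) ^+ i <= ordered_forests (j + i).
Proof.
move=> n8; elim: i => [|i IH] ji; first by rewrite expr0 mulr1 addn0.
have ji' : (j + i)%:R <= 3 / 4 * n%:R :> R by apply: le_trans ji; rewrite ler_nat leq_add2l.
rewrite exprS mulrCA; apply: le_trans (_ : n%:R ^+ 2 / 64 * ordered_forests (j + i) <= _).
  by rewrite ler_wpM2l ?IH// divr_ge0// exprn_ge0.
rewrite addnS; apply: ordered_forestsS.
have n8' : 8 <= n%:R :> R by rewrite ler_nat.
have jin : (j + i).+1%:R <= n%:R :> R.
  by rewrite -natr1; lra.
rewrite ler_nat in jin.
have := forests_components (ltnW jin); rewrite -(ler_nat R) !natrM -/(f _) -/(f _.+1).
apply: le_trans; apply: ler_wpM2r => //; rewrite -subn1.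
rewrite !natrB ?subn_gt0// ?(ltnW jin)//; nra.
Qed.

End ForestCount.

Section ForestAsymptotics.
Variable R : realType.

Lemma forests_many (m : nat -> nat) (c : R) :
  ((fun n => (m n)%:R / n%:R : R) @ \oo --> (2^-1 : R))%classic -> 0 < c ->
  (\forall n \near \oo, expR (- c * n%:R) * ('C(n, 2) ^ (m n))%:R <=
    ((m n)`!)%:R * #|forests n (m n)|%:R :> R)%classic.
Proof.
(* At most [2 * d * n] edges lie beyond the subcritical range, each costing a factor 64, at most
   [expR 63]. With [252 = 2 * 2 * 63] this loss is at most [expR (c * n / 2)]; the other half of
   [c * n] absorbs the constant [expR (4 / d)]. *)
move=> mcv c0; pose d := Num.min (2^-1) (c / 252).
have d0 : 0 < d by rewrite lt_min; apply/andP; split; lra.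
have d2 : d <= 2^-1 by rewrite ge_min lexx.
have dc : d <= c / 252 by rewrite ge_min lexx orbT.
have d20 : 0 < d / 2 by lra.
clearbody d.
have /cvgrPdist_lt/(_ _ d20) mv := mcv.
near=> n.
have n8 : (8 <= n)%N by near: n; exact: nbhs_infty_ge.
have n0 : (0 < n)%N by apply: leq_trans n8.
have n0' : 0 < n%:R :> R by rewrite ltr0n.
have mn : `|2^-1 - (m n)%:R / n%:R| < d / 2 by near: n.
have [mlo mhi] : (2^-1 - d / 2) * n%:R < (m n)%:R /\ (m n)%:R < (2^-1 + d / 2) * n%:R.
  move: mn; rewrite ltr_norml => /andP[m1 m2]; split.
    by rewrite -ltr_pdivlMr//; lra.
  by rewrite -ltr_pdivrMr//; lra.
have nl : 4 / d ^+ 2 <= n%:R by near: n; exact: nbhs_infty_ger.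
have nc : 2 * (4 / d) / c <= n%:R by near: n; exact: nbhs_infty_ger.
have nd : d^-1 <= n%:R by near: n; exact: nbhs_infty_ger.
pose j := Num.truncn ((1 - d) * n%:R / 2).
have x0 : 0 <= (1 - d) * n%:R / 2 by rewrite divr_ge0// mulr_ge0//; lra.
have /andP[j1 j2] := truncn_itv x0; rewrite -/j in j1 j2.
have jm : (j <= m n)%N by rewrite -(ler_nat R); apply: (le_trans j1); apply/ltW/(le_lt_trans _ mlo); nra.
set i := (m n - j)%N.
have ji : (j + i = m n)%N by rewrite subnKC.
have ile : i%:R <= 2 * d * n%:R.
  rewrite /i natrB//; have : 1 <= d * n%:R by rewrite mulrC -ler_pdivrMr// div1r.
  have j3 : (1 - d) * n%:R / 2 < j%:R + 1 by rewrite natr1.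
  by move=> ?; lra.
have mh : (j + i)%:R <= 3 / 4 * n%:R :> R by rewrite ji; apply/ltW/(lt_le_trans mhi); nra.
have h1 : 2 * j%:R <= (1 - d) * n%:R by lra.
have h2 := ordered_forests_subcritical n0 d0 d2 nl h1.
have h3 := ordered_forests_rest n8 mh; rewrite ji in h3.
have p2 : 0 < 2 ^+ m n :> R by rewrite exprn_gt0.
rewrite -(ler_pM2l p2).
rewrite [leRHS](_ : _ = ordered_forests R n (m n)); last by rewrite /ordered_forests mulrA.
apply: le_trans h3.
have h4 : (n%:R ^+ 2 / 64) ^+ i >= n%:R ^+ (2 * i) * expR (- (63 * i%:R)) :> R.
  rewrite expr_div_n -exprM ler_wpM2l ?exprn_ge0//.
  rewrite expRN lef_pV2 ?posrE ?exprn_gt0 ?expR_gt0// mulrC expRM_natl lerXn2r ?nnegrE ?expR_ge0//.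
  by apply: le_trans (expR_ge1Dx _); lra.
apply: le_trans (_ : (expR (- (4 / d)) * n%:R ^+ (2 * j)) * (n%:R ^+ (2 * i) * expR (- (63 * i%:R))) <= _); last first.
  by apply: ler_pM => //; rewrite mulr_ge0 ?expR_ge0 ?exprn_ge0.
have -> : expR (- (4 / d)) * n%:R ^+ (2 * j) * (n%:R ^+ (2 * i) * expR (- (63 * i%:R))) =
    expR (- (4 / d) - 63 * i%:R) * n%:R ^+ (2 * m n) :> R.
  by rewrite -ji mulnDr exprD expRD; ring.
rewrite mulrCA; apply: ler_pM; rewrite ?expR_ge0 ?mulr_ge0 ?(ltW p2)//.
  rewrite ler_expR.
  have a1 : 4 / d <= c * n%:R / 2.
    by move: nc; rewrite ler_pdivrMr// => ?; lra.
  have a2 : 63 * i%:R <= c * n%:R / 2.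
    apply: (@le_trans _ _ (63 * (2 * d * n%:R))); first by rewrite ler_wpM2l.
    have : d * n%:R <= c / 252 * n%:R by rewrite ler_wpM2r.
    by move=> ?; lra.
  lra.
rewrite -natrX -natrM -natrX ler_nat expnM -expnMn leq_exp2r//.
  by rewrite mulnC; have := bin_ffact n 2; rewrite (_ : 2`! = 2%N)// => ->; rewrite ffactnS ffactn1 expnS expn1 leq_mul2l leq_pred orbT.
by rewrite -(ltr_nat R); apply: le_lt_trans mlo; rewrite mulr_ge0//; lra.
Unshelve. all: by end_near.
Qed.

End ForestAsymptotics.

(** * From edge sequences to graphs *)

Section Transfer.
Variables (n m : nat).

Lemma graph_enumeration (E : {set {set 'I_n}}) : wf_graph E -> #|E| = m ->
  exists2 w : {ffun 'I_m -> edge n}, injective w & graph_of w = E.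
Proof.
move=> wf c; have sz : size (enum E) = m by rewrite -cardE.
have ex (i : 'I_m) : exists e : edge n, val e == nth finset.set0 (enum E) i.
  have iE : nth finset.set0 (enum E) i \in E by rewrite -mem_enum mem_nth// sz.
  have c2 : #|nth finset.set0 (enum E) i| == 2%N by have /forall_inP := wf; apply.
  by exists (Sub (nth finset.set0 (enum E) i) c2); rewrite SubK.
have /fin_all_exists[h hh] := ex.
exists [ffun i => h i] => [i j|].
  rewrite !ffunE => e; have := hh i; rewrite e (eqP (hh j)) => /eqP/esym/eqP.
  by rewrite nth_uniq ?sz ?enum_uniq// => /eqP/val_inj.
apply/setP => e; apply/imsetP/idP => [[i _ ->]|eE].
  by rewrite ffunE (eqP (hh i)) -mem_enum mem_nth// sz.
have ie : (index e (enum E) < m)%N by rewrite -sz index_mem mem_enum.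
by exists (Ordinal ie) => //; rewrite ffunE (eqP (hh _)) /= nth_index// mem_enum.
Qed.

(** A graph with [m] edges is the graph of each of its [m!] enumerations. *)
Lemma transfer (Q : pred {set {set 'I_n}}) :
  (m`! * #|[set E | [&& wf_graph E, #|E| == m & Q E]]%SET| <=
   #|[set w : {ffun 'I_m -> edge n} | Q (graph_of w)]%SET|)%N.
Proof.
set A := [set E | _]%SET.
apply: (@leq_trans (\sum_(E in A) #|[set w : {ffun 'I_m -> edge n} | graph_of w == E]%SET|)%N).
  rewrite mulnC -sum_nat_const; apply: leq_sum => E; rewrite finset.inE => /and3P[wf /eqP c _].
  have [w0 iw gw] := graph_enumeration wf c.
  rewrite -card_Sn -cardsT; apply: (@card_leq_inj _ _ (fun s : 'S_m => [ffun i => w0 (s i)])).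
    move=> s t _ _ /ffunP e; apply/permP => i; apply: iw; by have := e i; rewrite !ffunE.
  move=> s _; rewrite finset.inE -gw; apply/eqP/setP => e.
  apply/imsetP/imsetP => [[i _ ->]|[i _ ->]]; first by exists (s i); rewrite ?ffunE.
  by exists ((s^-1)%g i); rewrite ?ffunE ?permKV.
rewrite sum_card_pairs; apply: (@card_leq_inj _ _ snd) => [[E w] [E' w']|[E w]].
  by rewrite !finset.inE /= => /andP[_ /eqP<-] /andP[_ /eqP<-] ->.
by rewrite !finset.inE /= => /andP[/and3P[_ _ q] /eqP ->].
Qed.

End Transfer.

(** * Events of high probability in the random planar graph *)

Section WithHighProbability.
Variables (R : realType) (m : nat -> nat).
Local Notation PG n := (planar_graphs R n (m n)).

Definition whp (Q : forall n, {set {set 'I_n}} -> Prop) := forall e : R, 0 < e ->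
  (\forall n \near \oo, #|[set E in PG n | ~~ `[< Q n E >]]%SET|%:R <= e * #|PG n|%:R)%classic.

Lemma planar_graphsP n E : reflect [/\ wf_graph E, #|E| = m n & planar R E] (E \in PG n).
Proof.
rewrite finset.inE; apply: (iffP and3P) => [[h1 /eqP h2 /asboolP h3]|[h1 h2 h3]]; split=> //.
  exact/eqP.
exact/asboolP.
Qed.

Lemma whp_sub (Q1 Q2 : forall n, {set {set 'I_n}} -> Prop) : whp Q1 ->
  (\forall n \near \oo, forall E : {set {set 'I_n}}, E \in PG n -> Q1 n E -> Q2 n E)%classic -> whp Q2.
Proof.
move=> w1 sub e e0; near=> n.
have s : forall E : {set {set 'I_n}}, E \in PG n -> Q1 n E -> Q2 n E by near: n.
apply: (@le_trans _ _ (#|[set E in PG n | ~~ `[< Q1 n E >]]%SET|%:R)); last by near: n; exact: w1.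
rewrite ler_nat; apply: subset_leq_card; apply/fintype.subsetP => E.
rewrite !finset.inE => /andP[h /asboolPn nq]; rewrite h /=; apply/asboolPn => q; apply: nq.
by apply: s => //; rewrite finset.inE.
Unshelve. all: by end_near.
Qed.

Lemma whp_and (Q1 Q2 : forall n, {set {set 'I_n}} -> Prop) : whp Q1 -> whp Q2 ->
  whp (fun n E => Q1 n E /\ Q2 n E).
Proof.
move=> w1 w2 e e0; have e20 : 0 < e / 2 by lra.
near=> n.
have h1 : #|[set E in PG n | ~~ `[< Q1 n E >]]%SET|%:R <= e / 2 * #|PG n|%:R by near: n; exact: w1.
have h2 : #|[set E in PG n | ~~ `[< Q2 n E >]]%SET|%:R <= e / 2 * #|PG n|%:R by near: n; exact: w2.
rewrite [e in leRHS]splitr mulrDl; apply: le_trans (lerD h1 h2).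
rewrite -natrD ler_nat; apply: leq_trans (leq_card_setU _ _).
apply: subset_leq_card; apply/fintype.subsetP => E; rewrite !finset.inE => /andP[h /asboolPn nq].
rewrite h /=; apply/orP; have [q1|] := boolP `[< Q1 n E >]; last by left.
by right; apply/asboolPn => q2; apply: nq; split=> //; exact/asboolP.
Unshelve. all: by end_near.
Qed.

Lemma whp_true (Q : forall n, {set {set 'I_n}} -> Prop) :
  (\forall n \near \oo, forall E : {set {set 'I_n}}, E \in PG n -> Q n E)%classic -> whp Q.
Proof.
move=> h; apply: (whp_sub (Q1 := fun _ _ => True)); last first.
  by apply: filter_app h; near=> n => h E EP _; exact: h.
move=> e e0; near=> n; rewrite (_ : [set E in PG n | _]%SET = finset.set0) ?cards0 ?mulr_ge0// ?ltW//.
by apply/setP => E; rewrite !finset.inE (asboolT I) andbF.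
Unshelve. all: by end_near.
Qed.

Lemma whp_all (T : eqType) (s : seq T) (Q : T -> forall n, {set {set 'I_n}} -> Prop) :
  (forall t, t \in s -> whp (Q t)) -> whp (fun n E => forall t, t \in s -> Q t n E).
Proof.
elim: s => [_|t s IH h]; first by apply: whp_true; near=> n => E.
have h1 := h t (mem_head _ _).
have h2 : whp (fun n E => forall t, t \in s -> Q t n E).
  by apply: IH => u us; apply: h; rewrite inE us orbT.
apply: (whp_sub (whp_and h1 h2)); near=> n => E _ [q1 q2] u.
by rewrite inE => /orP[/eqP->|/q2].
Unshelve. all: by end_near.
Qed.

Hypothesis mcv : ((fun n => (m n)%:R / n%:R : R) @ \oo --> (2^-1 : R))%classic.

Lemma acyclic_planar n (E : {set {set 'I_n}}) : wf_graph E -> acyclic E -> planar R E.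
Proof.
move=> w a; apply/asboolP.
apply: (acyclic_leaf_closed (P := fun E => `[< planar R E >])) w a => [|F x v /asboolP pF xv iso].
  by apply/asboolP; exact: planar0.
by apply/asboolP; exact: planar_leaf.
Qed.

Lemma forests_sub_planar n : forests n (m n) \subset PG n.
Proof.
apply/fintype.subsetP => E; rewrite finset.inE => /and3P[w /eqP c a].
by apply/planar_graphsP; split=> //; exact: acyclic_planar.
Qed.

Lemma planar_graphs_gt0 : (\forall n \near \oo, (0 < #|PG n|)%N)%classic.
Proof.
have := forests_many mcv ltr01; apply: filter_app; near=> n => H.
apply: (@leq_trans #|forests n (m n)|); last exact/subset_leq_card/forests_sub_planar.
rewrite -(ltr_nat R) -(pmulr_rgt0 _ (_ : 0 < ((m n)`!)%:R)); last by rewrite ltr0n fact_gt0.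
apply: lt_le_trans H; rewrite mulr_gt0 ?expR_gt0// ltr0n expn_gt0 bin_gt0.
by apply/orP; left; near: n; exact: nbhs_infty_gt.
Unshelve. all: by end_near.
Qed.

Definition structures (L : nat) (As : forest) (vA : valid_forest L As) n (E : {set {set 'I_n}}) : {set 'I_n} :=
  [set v | `[< has_structure vA E v >]]%SET.

(** Failing sequences have proportion at most [expR (- c * n)], while forests, all planar, have at
    least [expR (- (c / 2) * n)]. The quotient still tends to 0. *)
Lemma whp_structures L As (vA : valid_forest L As) (e : R) : size As = 1%N -> 0 < e ->
  whp (fun n E => (forest_weight R L As - e) * n%:R <= #|structures vA E|%:R).
Proof.
move=> sz e0 d d0; have [c c0 tail] := tail_A vA sz mcv e0.
have c20 : 0 < c / 2 by lra.
have many := forests_many mcv c20.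
near=> n.
have h1 : #|[set w : {ffun 'I_(m n) -> edge n} | #|structure_roots vA w|%:R < (forest_weight R L As - e) * n%:R]%SET|%:R
    <= expR (- c * n%:R) * #|{: {ffun 'I_(m n) -> edge n}}|%:R by near: n.
have h2 : expR (- (c / 2) * n%:R) * ('C(n, 2) ^ (m n))%:R <= ((m n)`!)%:R * #|forests n (m n)|%:R :> R by near: n.
have h3 : expR (- (c / 2) * n%:R) <= d.
  have : (- ln d) / (c / 2) <= n%:R by near: n; exact: nbhs_infty_ger.
  by rewrite ler_pdivrMr// => h; rewrite -[leRHS]lnK ?posrE// ler_expR; lra.
have f0 : 0 < ((m n)`!)%:R :> R by rewrite ltr0n fact_gt0.
rewrite -(ler_pM2l f0).
pose Q (E : {set {set 'I_n}}) := ~~ ((forest_weight R L As - e) * n%:R <= #|structures vA E|%:R).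
apply: (@le_trans _ _ (#|[set w : {ffun 'I_(m n) -> edge n} | Q (graph_of w)]%SET|%:R)).
  rewrite -natrM ler_nat; apply: leq_trans (transfer (m n) Q); rewrite leq_mul2l; apply/orP; right.
  apply: subset_leq_card; apply/fintype.subsetP => E; rewrite finset.inE => /andP[/planar_graphsP[w cE _] nq].
  by rewrite finset.inE w cE eqxx /Q; apply: contra nq => h; apply/asboolP.
apply: le_trans (_ : #|[set w : {ffun 'I_(m n) -> edge n} | #|structure_roots vA w|%:R < (forest_weight R L As - e) * n%:R]%SET|%:R <= _).
  rewrite ler_nat; apply: subset_leq_card; apply/fintype.subsetP => w; rewrite !finset.inE /Q -ltNge.
  apply: le_lt_trans; rewrite ler_nat; apply: subset_leq_card; apply/fintype.subsetP => v h.
  by rewrite finset.inE; apply/asboolP; exact: structure_roots_sub.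
apply: (le_trans h1); rewrite card_ffun card_edge card_ord.
have -> : - c * n%:R = - (c / 2) * n%:R + - (c / 2) * n%:R by lra.
rewrite expRD -mulrA mulrCA; apply: le_trans (_ : d * (((m n)`!)%:R * #|forests n (m n)|%:R) <= _).
  by apply: ler_pM; rewrite ?expR_ge0// mulr_ge0 ?expR_ge0//.
rewrite mulrCA ler_wpM2l// ?(ltW f0)// ler_wpM2l ?(ltW d0)// ler_nat.
exact/subset_leq_card/forests_sub_planar.
Unshelve. all: by end_near.
Qed.

End WithHighProbability.

(** * Limits of empirical probabilities *)

(** Finite families inside [Q] bound [x n] from below, finite families outside [Q] bound it from
    above, and the mass hypothesis makes the two bounds meet. *)
Lemma esum_squeeze (R : realType) (T : choiceType) (a : T -> R) (P Q : T -> Prop) (x : nat -> R) :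
  (forall t, 0 <= a t) ->
  (forall F : seq T, uniq F -> (forall t, t \in F -> P t /\ Q t) -> forall e, 0 < e ->
    (\forall n \near \oo, \sum_(t <- F) a t - e <= x n)%classic) ->
  (forall F : seq T, uniq F -> (forall t, t \in F -> P t /\ ~ Q t) -> forall e, 0 < e ->
    (\forall n \near \oo, x n <= 1 - \sum_(t <- F) a t + e)%classic) ->
  (forall e, 0 < e -> exists F : seq T,
    [/\ uniq F, forall t, t \in F -> P t & 1 - e <= \sum_(t <- F) a t]) ->
  ((fun n => (x n)%:E) @ \oo --> \esum_(t in [set t | P t /\ Q t]) (a t)%:E)%classic.
Proof.
move=> a0 lo hi mass; set S := esum _ _.
have S0 : (0 <= S)%E by apply: esum_ge0 => t _; rewrite lee_fin.
(* Comparing both bounds at one large [n] shows that the total weight cannot exceed 1. *)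
have ub (G H : seq T) : uniq G -> (forall t, t \in G -> P t /\ Q t) ->
    uniq H -> (forall t, t \in H -> P t /\ ~ Q t) -> \sum_(t <- G) a t <= 1 - \sum_(t <- H) a t.
  move=> uG GQ uH HQ; apply/ler_addgt0Pr => e e0.
  have e20 : 0 < e / 2 by lra.
  near \oo%classic => n.
  have h1 : \sum_(t <- G) a t - e / 2 <= x n by near: n; exact: lo.
  have h2 : x n <= 1 - \sum_(t <- H) a t + e / 2 by near: n; exact: hi.
  lra.
have Sle (H : seq T) : uniq H -> (forall t, t \in H -> P t /\ ~ Q t) ->
    (S <= (1 - \sum_(t <- H) a t)%:E)%E.
  move=> uH HQ; apply: ge_ereal_sup => _ [A [fA sA] <-].
  rewrite fsbig_finite// sumEFin lee_fin; apply: ub => // t.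
  by rewrite in_fset_set// inE => /sA.
have Sfin : S \is a fin_num.
  rewrite ge0_fin_numE//; apply: le_lt_trans (ltry 1).
  by have := Sle [::] isT; rewrite big_nil subr0; apply.
rewrite -(fineK Sfin); apply: cvg_EFin; first by near=> n.
apply/cvgrPdist_le => e e0; have e20 : 0 < e / 2 by lra.
have [F [uF PF mF]] := mass _ e20.
pose G := [seq t <- F | `[< Q t >]]; pose H := [seq t <- F | ~~ `[< Q t >]].
have sF : \sum_(t <- F) a t = \sum_(t <- G) a t + \sum_(t <- H) a t.
  by rewrite (bigID (fun t => `[< Q t >])) !big_filter.
have GQ t : t \in G -> P t /\ Q t by rewrite mem_filter => /andP[/asboolP q /PF].
have HQ t : t \in H -> P t /\ ~ Q t by rewrite mem_filter => /andP[/asboolP q /PF].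
have uG : uniq G by rewrite filter_uniq.
have uH : uniq H by rewrite filter_uniq.
have s1 : fine S <= 1 - \sum_(t <- H) a t by rewrite -lee_fin fineK//; exact: Sle.
have s2 : \sum_(t <- G) a t <= fine S.
  rewrite -lee_fin fineK//; apply: esum_ge; exists [set` G]%classic.
    by split=> [|t /GQ]; [exact: finite_seq|].
  by rewrite -fsbig_seq// sumEFin.
near=> n.
have h1 : \sum_(t <- G) a t - e / 2 <= x n by near: n; exact: lo.
have h2 : x n <= 1 - \sum_(t <- H) a t + e / 2 by near: n; exact: hi.
rewrite /= ler_norml; apply/andP; split; lra.
Unshelve. all: by end_near.
Qed.

Lemma card_disjoint_classes (R : realType) (T : eqType) (D : finType) (F : seq T) (a : T -> R)
    (V : T -> {set D}) (W : {set D}) (e u : R) :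
  0 <= e -> 0 <= u -> uniq F ->
  (forall t, t \in F -> (a t - e / (size F).+1%:R) * u <= #|V t|%:R) ->
  (forall t t' v, t \in F -> t' \in F -> v \in V t -> v \in V t' -> t = t') ->
  (forall t v, t \in F -> v \in V t -> v \in W) ->
  (\sum_(t <- F) a t - e) * u <= #|W|%:R.
Proof.
move=> e0 u0 uF cV dV sW; apply: (@le_trans _ _ (\sum_(t <- F) #|V t|)%:R); last first.
  rewrite ler_nat; elim: F W uF dV sW {cV} => [|t F IH] W; first by rewrite big_nil.
  move=> /andP[tF uF] dV sW; rewrite big_cons.
  have : (\sum_(j <- F) #|V j| <= #|W :\: V t|)%N.
    apply: IH => //.
      by move=> t1 t2 v h1 h2; apply: dV; rewrite inE ?h1 ?h2 orbT.
    move=> t' v t'F vt'; rewrite finset.inE; apply/andP; split.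
      by apply/negP => vt; move: tF; rewrite (dV t t' v) ?inE ?eqxx ?t'F ?orbT.
    by apply: sW vt'; rewrite inE t'F orbT.
  move=> h; rewrite -(finset.cardsID (V t) W) leq_add// subset_leq_card//.
  by apply/fintype.subsetP => v vt; rewrite finset.inE vt (sW t) ?inE ?eqxx.
rewrite natr_sum; apply: (@le_trans _ _ (\sum_(t <- F) (a t - e / (size F).+1%:R) * u)).
  rewrite -mulr_suml ler_wpM2r// big_split /= lerD2l big_const_seq count_predT iter_addr_0.
  rewrite mulNrn lerN2 -[leLHS]mulr_natr mulrAC ler_pdivrMr ?ltr0n// ler_wpM2l//.
  by rewrite ler_nat.
by rewrite [leLHS]big_seq [leRHS]big_seq; apply: ler_sum.
Qed.

Section EmpiricalProbability.
Variables (R : realType) (m : nat -> nat).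
Local Notation PG n := (planar_graphs R n (m n)).
Hypothesis PG_gt0 : (\forall n \near \oo, (0 < #|PG n|)%N)%classic.

(** On the exceptional graphs, a proportion of at most [e / K], the loss is at most [w + 1 <= K].
    The lower bound -1 allows both a frequency and its negative as [h]. *)
Lemma whp_average (h : forall n, {set {set 'I_n}} -> R) (w e : R) :
  (forall n E, -1 <= h n E) -> whp R m (fun n E => w <= h n E) -> 0 < e ->
  (\forall n \near \oo, w - e <= (#|PG n|%:R)^-1 * \sum_(E in PG n) h n E)%classic.
Proof.
move=> h1 wh e0; pose K := `|w| + 1.
have K0 : 0 < K by rewrite ltr_wpDl.
have wK : w <= `|w| by exact: ler_norm.
near=> n.
have PG0 : 0 < #|PG n|%:R :> R by rewrite ltr0n; near: n.
have bad : #|[set E in PG n | ~~ `[< w <= h n E >]]%SET|%:R <= e / K * #|PG n|%:R.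
  by near: n; apply: wh; rewrite divr_gt0.
rewrite ler_pdivlMl//.
have -> : #|PG n|%:R * (w - e) = w * #|PG n|%:R - K * (e / K * #|PG n|%:R).
  by field; lra.
apply: (@le_trans _ _ (w * #|PG n|%:R - K * #|[set E in PG n | ~~ `[< w <= h n E >]]%SET|%:R)).
  by rewrite lerD2l lerN2 ler_pM2l.
have -> : w * #|PG n|%:R - K * #|[set E in PG n | ~~ `[< w <= h n E >]]%SET|%:R =
    \sum_(E in PG n) (w - K * (~~ `[< w <= h n E >])%:R).
  rewrite sumrB sumr_const mulr_natr; congr (_ - _).
  by rewrite -mulr_sumr -natr_sum -sum1dep_card big_mkcondr; congr (_ * _%:R).
apply: ler_sum => E _; have [/asboolP|_] := boolP `[< w <= h n E >]; first by rewrite mulr0 subr0.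
by rewrite mulr1; apply: le_trans (h1 n E); rewrite /K; lra.
Unshelve. all: by end_near.
Qed.

Variables (U : forall n, {set {set 'I_n}} -> {set 'I_n}) (l : nat).
Variables (VH : finType) (eH : rel VH) (rH : VH).

(** Disjoint classes of vertices with [Q] are counted inside the good set, those without [Q] in its
    complement; so lower bounds on class sizes yield both inequalities. *)
Lemma emp_prob_cvg (T : choiceType) (a : T -> R) (P Q : T -> Prop) :
  (forall t, 0 <= a t) ->
  (forall e, 0 < e -> exists F : seq T,
    [/\ uniq F, forall t, t \in F -> P t & 1 - e <= \sum_(t <- F) a t]) ->
  (forall F : seq T, uniq F -> (forall t, t \in F -> P t) -> forall e : R, 0 < e ->
    whp R m (fun n E => (0 < #|U E|)%N /\ exists V : T -> {set 'I_n},
      [/\ forall t, t \in F -> (a t - e) * #|U E|%:R <= #|V t|%:R,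
          forall t t' v, t \in F -> t' \in F -> v \in V t -> v \in V t' -> t = t',
          forall t v, t \in F -> v \in V t -> v \in U E &
          forall t v, t \in F -> v \in V t -> ball_iso E (U E) v l eH rH <-> Q t])) ->
  ((fun n => (emp_prob R (m n) (@U n) l eH rH)%:E) @ \oo
    --> \esum_(t in [set t | P t /\ Q t]) (a t)%:E)%classic.
Proof.
move=> a0 mass classes.
pose good n (E : {set {set 'I_n}}) := [set v in U E | `[< ball_iso E (U E) v l eH rH >]]%SET.
pose f n (E : {set {set 'I_n}}) : R := (#|U E|%:R)^-1 * #|good n E|%:R.
have f0 n E : 0 <= f n E by rewrite mulr_ge0// invr_ge0.
have f1 n E : f n E <= 1.
  rewrite /f mulrC; have [->|u0] := posnP #|U E|; first by rewrite invr0 mulr0.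
  rewrite ler_pdivrMr ?ltr0n// mul1r ler_nat; apply: subset_leq_card.
  by apply/fintype.subsetP => v; rewrite finset.inE => /andP[].
apply: esum_squeeze => // F uF FP e e0.
  have e20 : 0 < e / 2 by lra.
  have e3 : 0 < e / 2 / (size F).+1%:R by rewrite divr_gt0// ltr0n.
  have FP' t : t \in F -> P t by move=> /FP[].
  pose w := \sum_(t <- F) a t - e / 2.
  have wh : whp R m (fun n E => w <= f n E).
    apply: (whp_sub (classes F uF FP' _ e3)); apply: nearW => n E _ [U0 [V [cV dV sV bV]]].
    rewrite /f mulrC ler_pdivlMr ?ltr0n//; apply: (card_disjoint_classes (V := V) (ltW e20)) => // t v tF vt.
    rewrite finset.inE (sV t)//=; apply/asboolP/(bV t) => //; by have [] := FP t tF.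
  have h1 n (E : {set {set 'I_n}}) : -1 <= f n E by apply: le_trans (f0 n E); lra.
  have := whp_average h1 wh e20; apply: filterS => n; rewrite /w /emp_prob; apply: le_trans.
  by lra.
have e20 : 0 < e / 2 by lra.
have e3 : 0 < e / 2 / (size F).+1%:R by rewrite divr_gt0// ltr0n.
have FP' t : t \in F -> P t by move=> /FP[].
pose w := \sum_(t <- F) a t - e / 2 - 1.
have wh : whp R m (fun n E => w <= - f n E).
  apply: (whp_sub (classes F uF FP' _ e3)); apply: nearW => n E _ [U0 [V [cV dV sV bV]]].
  have hh : (\sum_(t <- F) a t - e / 2) * #|U E|%:R <= #|U E :\: good n E|%:R.
    apply: (card_disjoint_classes (V := V) (ltW e20)) => // t v tF vt.
    rewrite finset.inE (sV t)// andbT finset.inE (sV t)//=; apply/asboolPn => /(bV t v tF vt).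
    by have [] := FP t tF.
  have := finset.cardsID (good n E) (U E).
  have -> : U E :&: good n E = good n E.
    by apply/setP => v; rewrite !finset.inE andbA andbb.
  move/(congr1 (fun k : nat => k%:R : R)); rewrite natrD => cU.
  rewrite lerNr /f mulrC ler_pdivrMr ?ltr0n//; move: hh cU; rewrite /w.
  move: (\sum_(t <- F) a t) (#|U E|%:R) (#|good n E|%:R) (#|_ :\: _|%:R) => s u g h.
  by move=> *; lra.
have h1 n (E : {set {set 'I_n}}) : -1 <= - f n E by rewrite lerN2.
have := whp_average h1 wh e20; apply: filterS => n; rewrite /w /emp_prob sumrN mulrN.
by rewrite lerNr => h; apply: (le_trans h); lra.
Unshelve. all: by end_near.
Qed.

End EmpiricalProbability.

(** * Tree structures *)

Section Balls.
Variables (n : nat) (E : {set {set 'I_n}}).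

Lemma ball_iso_closed (U : {set 'I_n}) v l (VH : finType) (eH : rel VH) rH :
  (forall x y, x \in U -> adj E x y -> y \in U) -> v \in U ->
  ball_iso E U v l eH rH <-> ball_iso E finset.setT v l eH rH.
Proof.
move=> closed vU.
have adjE x y : x \in U -> adj_in E U x y = adj_in E finset.setT x y.
  move=> xU; rewrite /adj_in xU !finset.inE /=; apply/andP/idP => [[]//|h]; split=> //.
  exact: closed h.
have reachE k : reach E U v k = reach E finset.setT v k /\ reach E U v k \subset U.
  elim: k => [|k [e s]] /=.
    rewrite finset.setIT; have -> : [set v] :&: U = [set v] by apply/finset.setIidPl; rewrite finset.sub1set.
    by rewrite finset.sub1set.
  have -> : [set y | [exists x in reach E U v k, adj_in E U x y]]%SET =
      [set y | [exists x in reach E finset.setT v k, adj_in E finset.setT x y]]%SET.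
    apply/setP => y; rewrite !finset.inE -e; apply/exists_inP/exists_inP => -[x xr h];
      exists x => //; move: h; rewrite adjE//; exact: (fintype.subsetP s).
  rewrite -e; split=> //; apply/fintype.subsetP => y; rewrite !finset.inE => /orP[/(fintype.subsetP s)//|].
  move=> /exists_inP[x /(fintype.subsetP s) xU]; rewrite /adj_in => /and3P[_ _]; exact: closed.
have [e /fintype.subsetP s] := reachE l.
by rewrite /ball_iso -e; split=> -[f [h1 h2 h3 h4]]; exists f; split=> // x y xr yr;
  rewrite h4// adjE//; exact: s.
Qed.

Lemma exact_setT (D : finType) (p : D -> D) dep L (phi : D -> 'I_n) :
  exact p dep L (adj E) phi -> exact p dep L (adj_in E finset.setT) phi.
Proof. by case=> i h; split=> // x z dx; rewrite /adj_in !finset.inE; exact: h. Qed.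

Definition tree_structure l (A : {fset (seq nat)}) (v : 'I_n) :=
  exists vA : valid_forest l [:: A], has_structure vA E v.

Lemma tree_structure_explored l A v : tree_structure l A v -> exists phi : node -> 'I_n,
  [/\ valid_forest l [:: A], explored (@nat_of_ord n) (nbrs (adj E)) id l [:: A] phi & phi root_node = v].
Proof.
move=> [vA [phi [inc ex rv]]]; exists (extend vA phi); split=> //.
  by apply: exact_explored.
rewrite -rv; exact: (extend_val vA phi (rootD vA)).
Qed.

Lemma tree_structure_uniq l A B v : tree_structure l A v -> tree_structure l B v -> A = B.
Proof.
move=> /tree_structure_explored[phi [vA e1 r1]] /tree_structure_explored[psi [vB e2 r2]].
have r12 : phi root_node = psi root_node by rewrite r1 r2.
by have [[]] := explored_uniq (@ord_inj n) vA vB (erefl _) e1 e2 r12.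
Qed.

Lemma tree_structure_kids l A v : (0 < l)%N -> tree_structure l A v ->
  exists g : nat -> 'I_n, {in [pred j | [:: j] \in A] &, injective g} /\
    forall z, adj E v z <-> exists2 j, [:: j] \in A & z = g j.
Proof.
move=> l0 /tree_structure_explored[phi [vA [inj kid _ _] rv]].
exists (fun j => phi (0%N, [:: j])); split=> [i j|z].
  rewrite !inE => iA jA /inj; rewrite !in_nodes /= iA jA => /(_ isT isT) -[] //.
have rin : (0%N, [::]) \in nodes [:: A].
  by rewrite in_nodes /=; have [_ _ /(_ 0%N isT) [[]]] := vA.
have := kid 0%N [::] rin l0 z; rewrite rv /= finset.inE andbT.
by [].
Qed.

Lemma tree_structure_ball l A B v (VH : finType) (eH : rel VH) rH :
  (forall u, (u \in B) && (size u <= l)%N = (u \in A)) -> tree_structure l.+1 B v ->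
  ball_iso E finset.setT v l eH rH <-> tree_iso A eH rH.
Proof.
move=> trunc [vB [phi [_ /exact_setT ex <-]]].
rewrite (ball_iso_exact (depD_root vB) (parD_root vB) (@depD_par _ _ vB) ex)//; last by rewrite finset.inE.
rewrite -/(pattern_iso l eH rH vB); apply: pattern_tree_iso => -[i u].
rewrite in_nodes /=; case: i => [|i]; rewrite /= ?add0n ?trunc//.
Qed.

(** With level [l] empty every pattern vertex is interior, so the copy is closed under adjacency. *)
Lemma tree_structure_comp l A v : level A l = fset0 -> tree_structure l A v ->
  (#|Defs.comp E v| <= #|{: nodes [:: A]}|)%N.
Proof.
move=> lev [vA [phi [_ [_ ex] <-]]].
apply: (@leq_trans #|[set phi x | x in finset.setT]|%SET); last first.
  by apply: (leq_trans (leq_imset_card _ _)); rewrite cardsT.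
apply: subset_leq_card; apply/fintype.subsetP => z; rewrite finset.inE => /connectP[q + ->].
have : phi (rootD vA) \in [set phi x | x in finset.setT]%SET by exact: imset_f.
elim: q (phi (rootD vA)) => //= y q IH x /imsetP[d _ ->] /andP[dy]; apply: IH.
have dl : (depD d < l)%N.
  have := valP d; rewrite in_nodes /depD; case: (val d) => -[|i] u //= uA.
  rewrite add0n ltn_neqAle; have [_ _ /(_ 0%N isT) [_]] := vA; rewrite /= subn0 => -> //.
  rewrite andbT; apply/eqP => ul; have : u \in level A l by rewrite !inE uA ul eqxx.
  by rewrite lev inE.
by move: dy; rewrite ex// => /existsP[d' /andP[/eqP-> _]]; exact: imset_f.
Qed.

End Balls.

(** * Typical properties of planar graphs *)

Lemma good_tree_valid l A : good_tree l A -> valid_forest l [:: A].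
Proof. by move=> gA; split=> //= -[|]//= _; rewrite subn0. Qed.

Lemma iter_generating1 (R : realType) l : iter l (fun x : R => expR (x - 1)) 1 = 1.
Proof. by elim: l => //= l ->; rewrite subrr expR0. Qed.

Section TreeStatistics.
Variables (R : realType) (m : nat -> nat).
Hypothesis mcv : ((fun n => (m n)%:R / n%:R : R) @ \oo --> (2^-1 : R))%classic.
Local Notation PG n := (planar_graphs R n (m n)).
Local Notation whp := (whp R m).
Local Notation gw := (gw_weight (1 : R)).

Lemma whp_trees l (F : seq {fset (seq nat)}) (e : R) :
  uniq F -> (forall A, A \in F -> good_tree l A) -> 0 < e ->
  whp (fun n E => (\sum_(A <- F) gw l A - e) * n%:R <=
    #|[set v | `[< exists2 A, A \in F & tree_structure E l A v >]]%SET|%:R).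
Proof.
move=> uF gF e0.
have e10 : 0 < e / (size F).+1%:R by rewrite divr_gt0// ltr0n.
pose Q (A : {fset (seq nat)}) n (E : {set {set 'I_n}}) :=
  (gw l A - e / (size F).+1%:R) * n%:R <= #|[set v | `[< tree_structure E l A v >]]%SET|%:R.
have wQ A : A \in F -> whp (Q A).
  move=> /gF/good_tree_valid vA.
  apply: (whp_sub (whp_structures mcv vA (erefl _) e10)); apply: nearW => n E _.
  rewrite /forest_weight big_ord1 subn0 /= => h; apply: (le_trans h).
  rewrite ler_nat; apply: subset_leq_card; apply/fintype.subsetP => v.
  by rewrite !finset.inE => /asboolP h'; apply/asboolP; exists vA.
apply: (whp_sub (whp_all wQ)); apply: nearW => n E _ cV.
apply: (card_disjoint_classes (V := fun A => [set v | `[< tree_structure E l A v >]]%SET) (ltW e0)) => //.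
  move=> A B v _ _; rewrite !finset.inE => /asboolP sA /asboolP sB.
  exact: tree_structure_uniq sA sB.
by move=> A v AF; rewrite !finset.inE => /asboolP sA; apply/asboolP; exists A.
Qed.

Lemma whp_tree_count l (A : {fset (seq nat)}) (e : R) : good_tree l A -> 0 < e ->
  whp (fun n E => (gw l A - e) * n%:R <= #|[set v | `[< tree_structure E l A v >]]%SET|%:R).
Proof.
move=> gA e0; have gF B : B \in [:: A] -> good_tree l B by rewrite inE => /eqP->.
apply: (whp_sub (whp_trees (F := [:: A]) isT gF e0)); apply: nearW => n E _.
rewrite big_seq1 => h; apply: (le_trans h); rewrite ler_nat; apply: subset_leq_card.
apply/fintype.subsetP => v; rewrite !finset.inE => /asboolP[B]; rewrite inE => /eqP-> s.
exact/asboolP.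
Qed.

(** Serves (ii) and (iii) together: [U] is a union of components that misses only few vertices. *)
Lemma emp_tree_cvg (U : forall n, {set {set 'I_n}} -> {set 'I_n}) l (VH : finType) (eH : rel VH) rH :
  (forall n (E : {set {set 'I_n}}) x y, x \in U n E -> adj E x y -> y \in U n E) ->
  (forall e : R, 0 < e -> whp (fun n E => #|~: U n E|%SET%:R <= e * n%:R)) ->
  ((fun n => (emp_prob R (m n) (@U n) l eH rH)%:E) @ \oo --> gw_ball_prob (1 : R) l eH rH)%classic.
Proof.
move=> closed small; rewrite /gw_ball_prob.
rewrite (_ : [set A | _]%classic = [set A | good_tree l A /\ tree_iso A eH rH]%classic); last first.
  by apply/seteqP; split=> A /=; [case|case=> -[]].
apply: emp_prob_cvg => [|A|e e0|F uF gF e e0].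
- exact: planar_graphs_gt0.
- exact: gw_weight_ge0.
- have s01 : 0 <= (1 : R) <= 1 by rewrite ler01 lexx.
  have [F [uF gF hF]] := gw_generating l s01 e0; exists F; split=> //.
  move: hF; rewrite iter_generating1 => /le_trans; apply.
  by apply: ler_sum => A _; rewrite expr1n mulr1.
have e40 : 0 < e / 4 by lra.
(* Trees of depth [l] are refined to finitely many extensions of depth [l.+1], which determine the
   ball. A quarter of [e] each goes to the extension, to the statistics and to the complement of
   [U]. *)
have /choice[ext extP] : forall A, exists F' : seq {fset (seq nat)}, A \in F ->
    [/\ uniq F', forall B, B \in F' -> good_tree l.+1 B /\
      (forall v, (v \in B) && (size v <= l)%N = (v \in A)) &
      gw l A - e / 4 <= \sum_(B <- F') gw l.+1 B].
  move=> A; have [AF|_] := boolP (A \in F); last by exists [::].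
  by have [F' h] := gw_extension_mass (gF A AF) e40; exists F'.
pose W (A : {fset (seq nat)}) n (E : {set {set 'I_n}}) :=
  [set v | `[< exists2 B, B \in ext A & tree_structure E l.+1 B v >]]%SET.
have wW A : A \in F -> whp (fun n E => (\sum_(B <- ext A) gw l.+1 B - e / 4) * n%:R <= #|W A n E|%:R).
  by move=> AF; have [u g _] := extP A AF; apply: whp_trees => // B /g[].
(* The bound 1/2 keeps [U] nonempty. *)
have d0 : 0 < Num.min (e / 4) 2^-1 by rewrite lt_min e40 invr_gt0 ltr0n.
have de : Num.min (e / 4) 2^-1 <= e / 4 by rewrite ge_min lexx.
have d2 : Num.min (e / 4) 2^-1 <= 2^-1 by rewrite ge_min lexx orbT.
move: (Num.min _ _) d0 de d2 => d d0 de d2.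
apply: (whp_sub (whp_and (whp_all wW) (small _ d0))); near=> n => E _ [cW sU].
have n0 : (0 < n)%N by near: n; exact: nbhs_infty_gt.
have n0' : 0 < n%:R :> R by rewrite ltr0n.
have cU : #|U n E|%:R + #|~: U n E|%SET%:R = n%:R :> R by rewrite -natrD cardsC card_ord.
split.
  rewrite -(ltr_nat R); have : d * n%:R <= 2^-1 * n%:R by rewrite ler_wpM2r.
  by move=> ?; lra.
exists (fun A => U n E :&: W A n E)%SET; split.
- move=> A AF; have [_ _ mA] := extP A AF.
  (* Replacing [#|U n E|] by the larger [n] needs a nonnegative coefficient; for a negative one the
     bound is trivial. *)
  have [neg|pos] := ltP (gw l A - e) 0.
    by apply: le_trans (ler0n _ _); rewrite nmulr_rle0.
  have hW := cW A AF.
  have h1 : (gw l A - e / 2) * n%:R <= #|W A n E|%:R.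
    by apply: le_trans hW; rewrite ler_wpM2r//; lra.
  have h2 : #|W A n E|%:R <= #|U n E :&: W A n E|%SET%:R + #|~: U n E|%SET%:R :> R.
    rewrite -natrD ler_nat -(finset.cardsID (U n E) (W A n E)) finset.setIC leq_add2l.
    by apply: subset_leq_card; apply/fintype.subsetP => v; rewrite !finset.inE => /andP[].
  have h3 : d * n%:R <= e / 4 * n%:R by rewrite ler_wpM2r.
  have h4 : (gw l A - e) * #|U n E|%:R <= (gw l A - e) * n%:R.
    by rewrite ler_wpM2l// -cU lerDl.
  move: h1 h2 h3 h4 sU e0 n0'; move: (#|W A n E|%:R) (#|_ :&: _|%SET%:R) (#|U n E|%:R) (#|~: _|%SET%:R) (gw l A) (n%:R).
  move=> w1 w2 u1 u2 g N h1 h2 h3 h4 sU e0' N0.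
  have : 0 <= e * N by apply: mulr_ge0; exact: ltW.
  by lra.
- move=> A B v AF BF; rewrite !finset.inE => /andP[_ /asboolP[A' A'F sA]] /andP[_ /asboolP[B' B'F sB]].
  have e' := tree_structure_uniq sA sB; subst B'.
  have [_ /(_ _ A'F)[_ tA] _] := extP A AF; have [_ /(_ _ B'F)[_ tB] _] := extP B BF.
  by apply/fsetP => u; rewrite -tA tB.
- by move=> A v _; rewrite finset.inE => /andP[].
move=> A v AF; rewrite !finset.inE => /andP[vU /asboolP[B BF sB]].
rewrite ball_iso_closed//; last exact: closed.
by have [_ /(_ _ BF)[_ tB] _] := extP A AF; exact: tree_structure_ball sB.
Unshelve. all: by end_near.
Qed.

Lemma gw_weight_gt0 l A : 0 < gw l A.
Proof. by apply: prodr_gt0 => u _; rewrite poisson1E mulr_gt0 ?expR_gt0// invr_gt0 ltr0n fact_gt0. Qed.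

(** An isolated vertex is a copy of the one-vertex tree at depth 1, which has positive weight. *)
Lemma whp_isolated : exists2 c : R, 0 < c & whp (fun n E => c * n%:R <= #|isolated E|%:R).
Proof.
pose A : {fset (seq nat)} := [fset [::]]%fset.
have gA : good_tree 1 A.
  split; last by move=> u; rewrite inE => /eqP->.
  by split=> [|u i]; rewrite inE// -size_eq0 size_rcons.
have w0 := gw_weight_gt0 1 A; have w20 : 0 < gw 1 A / 2 by rewrite divr_gt0.
exists (gw 1 A / 2) => //.
apply: (whp_sub (whp_tree_count gA w20)); apply: nearW => n E _.
have -> : gw 1 A - gw 1 A / 2 = gw 1 A / 2 by lra.
move=> h; apply: (le_trans h); rewrite ler_nat; apply: subset_leq_card.
apply/fintype.subsetP => v; rewrite finset.inE => /asboolP s; apply/isolatedP => z.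
apply/negP => vz; have [//|g [_ kids]] := tree_structure_kids (l := 1) _ s.
by have [/(_ vz)] := kids z; case=> j; rewrite inE.
Qed.

(** Copies with an empty level [l] are whole components of at most [M] vertices and, for large [l],
    cover almost everything. If L had more than [e * n >= M] vertices, it would avoid all of
    them. *)
Lemma whp_largest_small (e : R) : 0 < e ->
  whp (fun n E => #|largest_comp E|%:R <= e * n%:R).
Proof.
move=> e0; have e40 : 0 < e / 4 by lra.
have [l hl] : exists l, 1 - e / 4 <= iter l (fun x : R => expR (x - 1)) 0.
  have /cvgrPdist_le/(_ _ e40) := @extinction R; case=> N _ /(_ N (leqnn _)) /=.
  by rewrite ler_norml => /andP[_ h]; exists N; lra.
have s01 : 0 <= (0 : R) <= 1 by rewrite ler01 lexx.
have [F [uF gF hF]] := gw_generating l s01 e40.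
pose G := [seq A <- F | level A l == fset0].
have sG : 1 - e / 2 <= \sum_(A <- G) gw l A.
  rewrite big_filter big_mkcond /=.
  rewrite (eq_bigr (fun A => gw l A * 0 ^+ #|` level A l|)); first by lra.
  by move=> A _; rewrite expr0n cardfs_eq0; case: eqP; rewrite ?mulr1 ?mulr0.
pose M := (\max_(A <- G) #|{: nodes [:: A]}|)%N.
have wG : whp (fun n E => (\sum_(A <- G) gw l A - e / 2) * n%:R <=
    #|[set v | `[< exists2 A, A \in G & tree_structure E l A v >]]%SET|%:R).
  apply: whp_trees; rewrite ?filter_uniq//; last lra.
  by move=> A; rewrite mem_filter => /andP[_ /gF].
apply: (whp_sub wG); near=> n => E _ h.
have n0 : (0 < n)%N by near: n; exact: nbhs_infty_gt.
have nM : M%:R <= e * n%:R by rewrite mulrC -ler_pdivrMr//; near: n; exact: nbhs_infty_ger.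
rewrite leNgt; apply/negP => big.
have [v0 [Lv0 _]] := largest_compP E n0.
have disj : [set v | `[< exists2 A, A \in G & tree_structure E l A v >]]%SET \subset ~: largest_comp E.
  apply/fintype.subsetP => v; rewrite !finset.inE => /asboolP[A AG sA]; apply/negP => vL.
  move: big; rewrite ltNge => /negP; apply; apply: le_trans nM; rewrite ler_nat Lv0.
  move: vL; rewrite Lv0 => /comp_eq <-.
  apply: leq_trans (tree_structure_comp _ sA) _.
    by move: AG; rewrite mem_filter => /andP[/eqP].
  exact: (leq_bigmax_seq (F := fun A => #|{: nodes [:: A]}|)).
have cL : #|largest_comp E|%:R + #|~: largest_comp E|%SET%:R = n%:R :> R by rewrite -natrD cardsC card_ord.
have c1 : #|[set v | `[< exists2 A, A \in G & tree_structure E l A v >]]%SET|%:R <= #|~: largest_comp E|%SET%:R :> R.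
  by rewrite ler_nat; exact: subset_leq_card.
have h1 : (1 - e) * n%:R <= (\sum_(A <- G) gw l A - e / 2) * n%:R by rewrite ler_wpM2r//; lra.
by lra.
Unshelve. all: by end_near.
Qed.

(** The star with [k] leaves has positive weight, so some vertex has degree [k]. *)
Lemma whp_largest_big k : whp (fun n E => (k <= #|largest_comp E|)%N).
Proof.
pose A : {fset (seq nat)} := seq_fset tt ([::] :: [seq [:: j] | j <- iota 0 k]).
have inA u : (u \in A) = (u == [::]) || ((size u == 1%N) && (nth 0%N u 0 < k)%N).
  rewrite seq_fsetE inE; congr (_ || _); apply/mapP/idP => [[j]|].
    by rewrite mem_iota add0n => /andP[_ jk] ->.
  by case: u => [|j []]//= jk; exists j => //; rewrite mem_iota.
have gA : good_tree 1 A.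
  split; last by move=> u; rewrite inA => /orP[/eqP->//|/andP[/eqP-> _]].
  split=> [|u i]; first by rewrite inA eqxx.
  rewrite inA size_rcons; case: u => [|a u] /=; last by [].
  move=> ik; split=> [|j ji]; first by rewrite inA eqxx.
  by rewrite inA /= (leq_ltn_trans ji ik).
have w0 := gw_weight_gt0 1 A; have w20 : 0 < gw 1 A / 2 by rewrite divr_gt0.
apply: (whp_sub (whp_tree_count gA w20)); near=> n => E _.
have n0 : (0 < n)%N by near: n; exact: nbhs_infty_gt.
have -> : gw 1 A - gw 1 A / 2 = gw 1 A / 2 by lra.
move=> h; have : 0 < #|[set v | `[< tree_structure E 1 A v >]]%SET|%:R :> R.
  by apply: lt_le_trans h; rewrite mulr_gt0// ltr0n.
rewrite ltr0n => /card_gt0P[v]; rewrite finset.inE => /asboolP s.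
have [//|g [ginj kids]] := tree_structure_kids (l := 1) _ s.
have [v0 [-> maxv]] := largest_compP E n0; apply: leq_trans (maxv v).
rewrite -[k in (k <= _)%N]card_ord -cardsT -(card_in_imset (f := fun j : 'I_k => g j)); last first.
  by move=> i j _ _ /ginj gij; apply/val_inj/gij; rewrite inE inA /= ltn_ord.
apply: subset_leq_card; apply/fintype.subsetP => z /imsetP[j _ ->]; rewrite finset.inE.
by apply: connect1; apply/kids; exists (val j) => //; rewrite inA /= ltn_ord.
Unshelve. all: by end_near.
Qed.

End TreeStatistics.

(** * Spanning tree of the largest component *)

Section Numeric.
Variable R : realType.

Lemma binomial_partial_sum (x : R) N j : 0 <= x ->
  \sum_(i < j) 'C(N, i)%:R * x ^+ i <= expR (x * N%:R).
Proof.
move=> x0; apply: (@le_trans _ _ ((1 + x) ^+ N)); last first.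
  rewrite mulrC expRM_natl lerXn2r ?nnegrE ?expR_ge0 ?addr_ge0//; exact: expR_ge1Dx.
elim: N j => [|N IH] [|j]; rewrite ?big_ord0 ?exprn_ge0 ?addr_ge0//.
  rewrite big_ord_recl big1 => [|i _]; first by rewrite bin0 !expr0 mulr1 addr0.
  by rewrite bin0n mul0r.
rewrite big_ord_recl (eq_bigr (fun i : 'I_j => 'C(N, i.+1)%:R * x ^+ i.+1 + x * ('C(N, i)%:R * x ^+ i))).
  rewrite big_split /= -mulr_sumr addrA exprS mulrDl mul1r; apply: lerD.
    by apply: le_trans (IH j.+1); rewrite big_ord_recl !bin0.
  by apply: ler_wpM2l => //; exact: IH.
by move=> i _; rewrite ?lift0 /= binS natrD exprS; ring.
Qed.

(** A single term of the binomial sum at [b * x]; [b] is a Chernoff parameter, later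
    [expR (2 / d)]. *)
Lemma binomial_term (x b : R) N j : 0 <= x -> 0 < b ->
  'C(N, j)%:R * x ^+ j <= b ^- j * expR (b * x * N%:R).
Proof.
move=> x0 b0; rewrite ler_pdivlMl ?exprn_gt0// mulrCA -exprMn.
apply: le_trans (binomial_partial_sum N j.+1 _); last by rewrite mulr_ge0// ltW.
rewrite big_ord_recr /= lerDr; apply: sumr_ge0 => i _.
by rewrite mulr_ge0// exprn_ge0// mulr_ge0// ltW.
Qed.

Lemma geometric_tail (q : R) a b : 0 <= q < 1 ->
  \sum_(a <= k < b) q ^+ k <= q ^+ a / (1 - q).
Proof.
move=> /andP[q0 q1]; have q1' : 0 < 1 - q by lra.
rewrite ler_pdivlMr//; have [ab|/ltnW ba] := leqP a b; last by rewrite big_geq// mul0r exprn_ge0.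
apply: (@le_trans _ _ (q ^+ a - q ^+ b)); last by rewrite gerBl exprn_ge0.
rewrite mulrC mulr_sumr (eq_bigr (fun k => q ^+ k - q ^+ k.+1)).
  rewrite (@telescope_sumr_eq _ _ _ (fun k => - q ^+ k))//; first by rewrite opprK addrC.
  by move=> k _; rewrite opprK addrC.
by move=> k _; rewrite mulrBl mul1r exprS.
Qed.

Lemma cube_le_expR (c : R) k : 0 < c -> k%:R ^+ 3 <= (12 / c) ^+ 3 * expR (c / 4 * k%:R).
Proof.
move=> c0; have -> : expR (c / 4 * k%:R) = expR (c / 12 * k%:R) ^+ 3.
  by rewrite -expRM_natl; congr expR; lra.
have main : k%:R <= 12 / c * expR (c / 12 * k%:R).
  have : c / 12 * k%:R <= expR (c / 12 * k%:R) by apply: le_trans (expR_ge1Dx _); lra.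
  by rewrite -(ler_pM2l (_ : 0 < 12 / c)) ?divr_gt0// mulrA (_ : 12 / c * (c / 12) = 1) ?mul1r//; field; lra.
have p : 0 <= 12 / c * expR (c / 12 * k%:R) by apply: mulr_ge0; [apply: divr_ge0 => //; exact: ltW|exact: expR_ge0].
by rewrite -exprMn; apply: lerXn2r; rewrite ?nnegrE.
Qed.

End Numeric.

Section NiceSpanningTree.
Variables (R : realType) (m : nat -> nat).
Hypothesis mcv : ((fun n => (m n)%:R / n%:R : R) @ \oo --> (2^-1 : R))%classic.
Local Notation PG n := (planar_graphs R n (m n)).
Local Notation whp := (whp R m).
Let Pl n (E : {set {set 'I_n}}) := `[< planar R E >].

Let Pl0 n : Pl (n := n) finset.set0. Proof. by apply/asboolP; exact: planar0. Qed.
Let PlS n (E F : {set {set 'I_n}}) : F \subset E -> Pl E -> Pl F.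
Proof. by move=> FE /asboolP p; apply/asboolP; exact: planarS p. Qed.
Let Pl_leaf n (E : {set {set 'I_n}}) x v : Pl E -> x != v ->
  (forall y, ~~ adj E v y) -> Pl ([set x; v] |: E)%SET.
Proof. by move=> /asboolP p xv iso; apply/asboolP; exact: planar_leaf. Qed.

Lemma graph_class_planar n (a : nat) :
  graph_class (@Pl n) (m n) a = [set E in PG n | (a <= #|isolated E|)%N]%SET.
Proof.
by apply/setP => E; rewrite !finset.inE /Pl; case: (wf_graph E); case: (_ == _); case: `[< _ >].
Qed.

Variable nice : forall n (V : {set 'I_n}), pred {ffun {x | x \in V} -> {x | x \in V}}.
Variables (c K d : R) (k0 : nat).
Hypotheses (c0 : 0 < c) (K0 : 0 <= K) (d0 : 0 < d).
Hypothesis tail : forall n (V : {set 'I_n}), (k0 <= #|V|)%N ->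
  #|[set f | ~~ @nice n V f]%SET|%:R <= K * expR (- c * #|V|%:R) * (#|V| ^ #|V|)%:R.

(** Fewer than [excess k] excess edges means at most [d * k] of them. *)
Definition excess k := (Num.truncn (d * k%:R)).+1.

(** Two of the three factors [k] come from [card_ugly], the third from [k ^ k] against the
    [k ^ k.-1] of Cayley's bound. *)
Lemma ugly_bound n i a k : (1 < k)%N -> (k0 <= k)%N ->
  #|ugly (@Pl n) (@nice n) i a k|%:R <=
    K * k%:R ^+ 3 * expR (- c * k%:R) * #|graph_class (@Pl n) i a|%:R :> R.
Proof.
move=> k1 kk0; have K0' := K0.
pose s := Num.truncn (K * expR (- c * k%:R) * (k ^ k)%:R).
have y0 : 0 <= K * expR (- c * k%:R) * (k ^ k)%:R by rewrite !mulr_ge0// expR_ge0.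
have hs (V : {set 'I_n}) : #|V| = k -> (#|[set f | ~~ @nice n V f]%SET| <= s)%N.
  by move=> Vk; rewrite truncn_ge_nat// -Vk; apply: tail; rewrite Vk.
have := @card_ugly n (@Pl n) (@PlS n) (@Pl_leaf n) (@nice n) i a k s k1 hs.
rewrite -(ler_nat R) !natrM => h.
have kp : 0 < (k ^ k.-1)%:R :> R by rewrite ltr0n expn_gt0 (ltnW k1).
have sle : s%:R <= K * expR (- c * k%:R) * (k ^ k)%:R by have /andP[] := truncn_itv y0.
rewrite -(ler_pM2r kp); apply: (le_trans h).
rewrite (_ : (k ^ k)%:R = k%:R * (k ^ k.-1)%:R) in sle; last by rewrite -natrM -expnS prednK// ltnW.
apply: (@le_trans _ _ (k%:R * (k%:R * (K * expR (- c * k%:R) * (k%:R * (k ^ k.-1)%:R))) * #|graph_class (@Pl n) i a|%:R)).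
  by apply: ler_wpM2r => //; apply: ler_wpM2l => //; apply: ler_wpM2l.
move: (#|graph_class _ _ _|%:R) (expR (- c * k%:R)) (k%:R : R) ((k ^ k.-1)%:R : R) => g e k' p.
by apply: eq_imp_le; ring.
Qed.

(** Trading [e] edges for pendant edges at isolated vertices costs a factor of order [1 / n] each
    when [a] is linear in [n]. *)
Lemma class_ratio n e a j : (0 < a)%N -> (1 < n)%N -> (e <= m n)%N -> (e <= j)%N ->
  #|graph_class (@Pl n) (m n - e)%N (a + 2 * j)%N|%:R <=
    (2 * (m n)%:R / (a%:R * n.-1%:R)) ^+ e * #|PG n|%:R :> R.
Proof.
move=> a0 n1 em ej; have := graph_class_iter (@Pl0 n) (@Pl_leaf n) (m n - e)%N e a.
rewrite subnK// -(ler_nat R) !natrM !natrX !natrM => h.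
have p0 : 0 < a%:R * n.-1%:R :> R by rewrite mulr_gt0// ltr0n// -subn1 subn_gt0.
rewrite expr_div_n mulrAC ler_pdivlMr ?exprn_gt0//.
apply: (@le_trans _ _ (#|graph_class (@Pl n) (m n - e)%N (a + 2 * e)%N|%:R * (a%:R * n.-1%:R) ^+ e)).
  apply: ler_wpM2r; first by rewrite exprn_ge0// ltW.
  rewrite ler_nat; apply: subset_leq_card; apply/fintype.subsetP => E.
  rewrite !finset.inE => /and4P[-> -> ->] /=; apply: leq_trans.
  by rewrite leq_add2l leq_mul2l ej orbT.
apply: (le_trans h); apply: ler_wpM2l; first by rewrite exprn_ge0// mulr_ge0.
rewrite ler_nat; apply: subset_leq_card; rewrite graph_class_planar.
by apply/fintype.subsetP => E; rewrite finset.inE => /andP[].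
Qed.

Definition not_nice n k a : {set {set {set 'I_n}}} := [set E in graph_class (@Pl n) (m n) a |
  (#|largest_comp E| == k) && ~~ nice_spanning (@nice n) E (excess k)]%SET.

(** Write [x] for the cost of one traded edge. Many excess edges: [j >= d * k] and
    [b = expR (2 / d)] give [expR (b * x * k ^ 2 - 2 * k)], at most [expR (- k)]. Few: the binomial
    sum is at most [expR (x * k ^ 2) <= expR (c * k / 2)], and [k ^ 3] costs another
    [expR (c * k / 4)], against the gain [expR (- c * k)]. *)
Lemma not_nice_bound n k a : (0 < a)%N -> (1 < n)%N -> (1 < k)%N -> (k0 <= k)%N ->
  (excess k <= m n)%N ->
  expR (2 / d) * (2 * (m n)%:R / (a%:R * n.-1%:R)) * k%:R <= 1 ->
  (2 * (m n)%:R / (a%:R * n.-1%:R)) * k%:R <= c / 2 ->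
  #|not_nice n k (a + 2 * excess k)%N|%:R <=
    (1 + K * (12 / c) ^+ 3) * expR (- Num.min 1 (c / 4)) ^+ k * #|PG n|%:R.
Proof.
move=> a0 n1 k1 kk0 jm hB hc; have K0' := K0; have c0' := c0; have d0' := d0.
set x := 2 * _ / _ in hB hc; set j := excess k in jm *.
have x0 : 0 <= x by rewrite divr_ge0 ?mulr_ge0.
set q := Num.min 1 (c / 4).
have q1 : q <= 1 by rewrite ge_min lexx.
have q2 : q <= c / 4 by rewrite ge_min lexx orbT.
have ratio e : (e <= j)%N -> #|graph_class (@Pl n) (m n - e)%N (a + 2 * j)%N|%:R <= x ^+ e * #|PG n|%:R.
  by move=> ej; apply: class_ratio => //; exact: leq_trans jm.
have kR : 1 <= k%:R :> R by rewrite ler1n ltnW.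
have k2 : (k ^ 2)%N%:R = k%:R * k%:R :> R by rewrite -natrM.
have := @card_not_nice_spanning n (@Pl n) (@Pl0 n) (@PlS n) (@nice n) (m n) (a + 2 * j)%N k j (ltnW k1).
rewrite -(ler_nat R) natrD natrM natr_sum => /le_trans; apply.
apply: (@le_trans _ _ ((x ^+ j * #|PG n|%:R) * 'C(k ^ 2, j)%:R +
    \sum_(e < j) K * k%:R ^+ 3 * expR (- c * k%:R) * (x ^+ e * #|PG n|%:R) * 'C(k ^ 2, e)%:R)).
  apply: lerD; first by apply: ler_wpM2r => //; exact: ratio.
  apply: ler_sum => e _; rewrite natrM; apply: ler_wpM2r => //.
  apply: (le_trans (ugly_bound _ _ _ k1 kk0)); apply: ler_wpM2l; last by apply: ratio; exact: ltnW.
  by rewrite !mulr_ge0 ?expR_ge0// exprn_ge0.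
have -> : \sum_(e < j) K * k%:R ^+ 3 * expR (- c * k%:R) * (x ^+ e * #|PG n|%:R) * 'C(k ^ 2, e)%:R =
    K * k%:R ^+ 3 * expR (- c * k%:R) * (\sum_(e < j) 'C(k ^ 2, e)%:R * x ^+ e) * #|PG n|%:R.
  rewrite mulr_sumr mulr_suml; apply: eq_bigr => e _.
  move: (K * k%:R ^+ 3 * expR (- c * k%:R)) (x ^+ e) ('C(k ^ 2, e)%:R : R) (#|PG n|%:R : R) => A1 A2 A3 A4.
  by ring.
have -> : x ^+ j * #|PG n|%:R * 'C(k ^ 2, j)%:R = 'C(k ^ 2, j)%:R * x ^+ j * #|PG n|%:R.
  by rewrite mulrC mulrA.
rewrite -mulrDl; apply: ler_wpM2r => //; rewrite mulrDl mul1r; apply: lerD.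
  apply: le_trans (binomial_term (k ^ 2)%N j x0 (expR_gt0 (2 / d))) _.
  rewrite -!expRM_natl -expRN -expRD ler_expR k2.
  have jk : d * k%:R <= j%:R.
    by rewrite /j /excess; apply/ltW; have /andP[] := truncn_itv (mulr_ge0 (ltW d0') (ler0n R k)).
  have h1 : expR (2 / d) * x * (k%:R * k%:R) <= k%:R.
    by rewrite mulrA -[leRHS]mul1r; apply: ler_wpM2r.
  have h2 : 2 * k%:R <= j%:R * (2 / d).
    by rewrite mulrCA ler_wpM2l// ler_pdivlMr// mulrC.
  have h3 : k%:R * q <= k%:R by rewrite -[leRHS]mulr1 ler_wpM2l.
  lra.
apply: (@le_trans _ _ (K * ((12 / c) ^+ 3 * expR (c / 4 * k%:R)) * expR (- c * k%:R) * expR (c / 2 * k%:R))).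
  apply: ler_pM; rewrite ?mulr_ge0 ?expR_ge0 ?exprn_ge0//.
  - by apply: sumr_ge0 => e _; rewrite mulr_ge0// exprn_ge0.
  - by apply: ler_wpM2r; [exact: expR_ge0|apply: ler_wpM2l => //; exact: cube_le_expR].
  - apply: (le_trans (binomial_partial_sum _ _ x0)); rewrite ler_expR k2 mulrA.
    by apply: ler_wpM2r.
have p0 : 0 <= K * (12 / c) ^+ 3 by apply: mulr_ge0 => //; apply: exprn_ge0; rewrite divr_ge0// ltW.
rewrite [leLHS](_ : _ = K * (12 / c) ^+ 3 * (expR (c / 4 * k%:R) * (expR (- c * k%:R) * expR (c / 2 * k%:R)))).
  rewrite -!expRD -expRM_natl; apply: ler_wpM2l => //; rewrite ler_expR.
  have h3 : k%:R * q <= k%:R * (c / 4) by rewrite ler_wpM2l.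
  lra.
move: ((12 / c) ^+ 3) (expR (c / 4 * _)) (expR (- c * _)) (expR (c / 2 * _)) => A1 A2 A3 A4.
by ring.
Qed.

Lemma whp_nice_spanning : whp (fun n E => nice_spanning (@nice n) E (excess #|largest_comp E|)).
Proof.
move=> e e0; have c0' := c0; have d0' := d0; have K0' := K0.
have [t t0 wt] := whp_isolated mcv.
pose B : R := expR (2 / d); have B0 : 0 < B by exact: expR_gt0.
(* The four bounds give, in this order, the two smallness conditions of [not_nice_bound], enough
   isolated vertices for [a + 2 * excess k], and [excess k <= m n]. *)
pose h : R := Num.min (Num.min (t / (16 * B)) (t * c / 32)) (Num.min (t / (8 * d)) ((8 * d)^-1)).
have h0 : 0 < h by rewrite !lt_min !divr_gt0 ?mulr_gt0 ?invr_gt0 ?mulr_gt0.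
have [h1 h2 h3 h4] : [/\ h <= t / (16 * B), h <= t * c / 32, h <= t / (8 * d) & h <= (8 * d)^-1].
  by have := lexx h; rewrite {2}/h !le_min => /andP[/andP[? ?] /andP[? ?]].
have BE : B = expR (2 / d) by [].
clearbody h B.
have h8 : h * d <= 8^-1.
  by move: h4; rewrite -ler_pdivlMr// invfM => /le_trans; apply; rewrite mulrC.
pose q := expR (- Num.min 1 (c / 4)).
have q01 : 0 <= q < 1.
  by rewrite expR_ge0 expR_lt1 oppr_lt0 lt_min ltr01 divr_gt0.
pose K' := 1 + K * (12 / c) ^+ 3.
have K'0 : 0 < K'.
  by rewrite ltr_pwDl// mulr_ge0// exprn_ge0// divr_ge0// ltW.
(* Makes the tail of the union bound over component sizes small; smaller sizes are excluded by
   [whp_largest_big]. *)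
have [k1 kk1] : exists k1, K' * (q ^+ k1 / (1 - q)) <= e / 4.
  have q1 : `|q| < 1 by case/andP: q01 => qa qb; rewrite ger0_norm.
  have q1p : 0 < 1 - q by case/andP: q01; lra.
  have e' : 0 < e / 4 / K' * (1 - q) by rewrite !mulr_gt0 ?invr_gt0.
  have /cvgrPdist_le/(_ _ e') := cvg_expr q1; case=> N _ /(_ N (leqnn _)) /=.
  rewrite sub0r normrN => hN; exists N; move: (le_trans (ler_norm _) hN).
  by rewrite -ler_pdivrMr// ler_pdivlMr// mulrC.
have wbig := whp_largest_big mcv (maxn k1 (maxn k0 2)).
have wsmall := whp_largest_small mcv h0.
have e40 : 0 < e / 4 by lra.
have q4 : 0 < 4^-1 :> R by rewrite invr_gt0.
have /cvgrPdist_lt/(_ _ q4) mv := mcv.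
near=> n.
have n2 : (1 < n)%N by near: n; exact: nbhs_infty_gt.
have n0 : 0 < n%:R :> R by rewrite ltr0n ltnW.
have n4 : 4 / t <= n%:R by near: n; exact: nbhs_infty_ger.
have n8 : 8 <= n%:R :> R by near: n; exact: nbhs_infty_ger.
have n9 : 8 / t <= n%:R by near: n; exact: nbhs_infty_ger.
have nn : n.-1%:R = n%:R - 1 :> R by rewrite -subn1 natrB// ltnW.
have [mlo mhi] : 4^-1 * n%:R <= (m n)%:R :> R /\ (m n)%:R <= n%:R :> R.
  have : `|2^-1 - (m n)%:R / n%:R| < 4^-1 :> R by near: n.
  rewrite ltr_norml => /andP[m1 m2]; split.
    by rewrite -ler_pdivlMr//; lra.
  by rewrite -[leRHS]mul1r -ler_pdivrMr//; lra.
have tn4 : 4 <= t * n%:R by rewrite mulrC -ler_pdivrMr.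
have tn8 : 8 <= t * n%:R by rewrite mulrC -ler_pdivrMr.
pose a := Num.truncn (t * n%:R / 2).
have /andP[a1 a2] : a%:R <= t * n%:R / 2 < a.+1%:R by apply: truncn_itv; lra.
have {}a2 : t * n%:R / 2 < a%:R + 1 by rewrite natr1.
have {}a2 : t * n%:R / 4 <= a%:R by lra.
have a0 : (0 < a)%N by rewrite -(ltr_nat R); lra.
pose ok k := [&& (k1 <= k)%N, (k0 <= k)%N, (1 < k)%N & k%:R <= h * n%:R].
have jle k : ok k -> (excess k)%:R <= d * h * n%:R + 1.
  move=> /and4P[_ _ _ kh]; rewrite /excess -[leLHS]natr1 lerD2r.
  have /andP[j1 _] := truncn_itv (mulr_ge0 (ltW d0') (ler0n R k)).
  by apply: (le_trans j1); rewrite -mulrA; apply: ler_wpM2l => //; exact: ltW.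
have bound k : ok k -> #|not_nice n k (a + 2 * excess k)%N|%:R <= K' * q ^+ k * #|PG n|%:R.
  move=> okk; have jk := jle k okk; case/and4P: okk => k1k k0k kgt kh.
  pose x : R := 2 * (m n)%:R / (a%:R * n.-1%:R).
  have x16 : x * k%:R <= 16 * h / t.
    have xb : x <= 16 / (t * n%:R).
      rewrite /x ler_pdivrMr ?mulr_gt0 ?ltr0n// -?subn1 ?subn_gt0//.
      rewrite mulrAC ler_pdivlMr ?mulr_gt0// natrB ?(ltnW n2)//.
      have p1 : 2 * (m n)%:R * (t * n%:R) <= 2 * n%:R * (t * n%:R).
        by apply: ler_wpM2r; [rewrite mulr_ge0// ltW|apply: ler_wpM2l].
      have p2 : t * n%:R / 4 * (n%:R / 2) <= a%:R * (n%:R - 1).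
        by apply: ler_pM => //; [rewrite divr_ge0// mulr_ge0// ltW|lra].
      by apply: (le_trans p1); lra.
    apply: le_trans (ler_wpM2r (ler0n R k) xb) _.
    have -> : 16 * h / t = 16 / (t * n%:R) * (h * n%:R) by field; lra.
    by apply: ler_wpM2l => //; rewrite divr_ge0// mulr_ge0// ltW.
  apply: not_nice_bound => //.
  - rewrite -(ler_nat R); apply: (le_trans jk); apply: le_trans mlo.
    have : h * d * n%:R <= 8^-1 * n%:R by apply: ler_wpM2r.
    by move=> ?; lra.
  - rewrite -/x -BE -mulrA; apply: (@le_trans _ _ (B * (16 * h / t))).
      by apply: ler_wpM2l => //; exact: ltW.
    have : B * 16 / t * h <= B * 16 / t * (t / (16 * B)).
      by apply: ler_wpM2l => //; rewrite divr_ge0 ?mulr_ge0// ltW.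
    have -> : B * 16 / t * (t / (16 * B)) = 1 by field; rewrite ?gt_eqF.
    by move=> ?; lra.
  - rewrite -/x; apply: (le_trans x16).
    have : 16 / t * h <= 16 / t * (t * c / 32) by apply: ler_wpM2l => //; rewrite divr_ge0// ltW.
    have -> : 16 / t * (t * c / 32) = c / 2 by field; lra.
    by move=> ?; lra.
have b1 : #|[set E in PG n | ~~ `[< t * n%:R <= #|isolated E|%:R >]]%SET|%:R <= e / 4 * #|PG n|%:R by near: n; exact: wt.
have b2 : #|[set E in PG n | ~~ `[< #|largest_comp E|%:R <= h * n%:R >]]%SET|%:R <= e / 4 * #|PG n|%:R by near: n; exact: wsmall.
have b3 : #|[set E in PG n | ~~ `[< (maxn k1 (maxn k0 2) <= #|largest_comp E|)%N >]]%SET|%:R <= e / 4 * #|PG n|%:R by near: n; exact: wbig.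
have b4 : (\sum_(k < n.+1 | ok k) #|not_nice n k (a + 2 * excess k)%N|)%:R <= e / 4 * #|PG n|%:R.
  rewrite natr_sum; apply: (@le_trans _ _ (\sum_(k < n.+1 | ok k) K' * q ^+ k * #|PG n|%:R)).
    by apply: ler_sum => k okk; exact: bound.
  rewrite -mulr_suml -mulr_sumr; apply: ler_wpM2r => //; apply: le_trans kk1.
  rewrite ler_pM2l//; apply: le_trans (geometric_tail k1 n.+1 q01).
  rewrite big_geq_mkord [leLHS]big_mkcond [leRHS]big_mkcond /=.
  apply: ler_sum => k _; have q0 : 0 <= q ^+ k by rewrite exprn_ge0// expR_ge0.
  by case: ifP => [/and4P[->]//|_]; case: ifP.
have e4 : e * #|PG n|%:R = e / 4 * #|PG n|%:R + e / 4 * #|PG n|%:R + e / 4 * #|PG n|%:R + e / 4 * #|PG n|%:R by lra.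
rewrite e4; apply: le_trans (lerD (lerD (lerD b1 b2) b3) b4).
rewrite -!natrD ler_nat.
set S0 := [set E in PG n | _]%SET; set S1 := [set E in PG n | _]%SET; set S2 := [set E in PG n | _]%SET; set S3 := [set E in PG n | _]%SET.
apply: (@leq_trans #|S1 :|: S2 :|: S3 :|: (\bigcup_(k < n.+1 | ok k) not_nice n k (a + 2 * excess k)%N)%SET|%SET); last first.
  apply: leq_trans (leq_card_setU _ _) _; apply: leq_add.
    apply: leq_trans (leq_card_setU _ _) _; apply: leq_add => //.
    exact: (leq_of_leqif (leq_card_setU _ _)).
  apply: (big_ind2 (fun (X : {set {set {set 'I_n}}}) x => (#|X| <= x)%N)) => //; first by rewrite cards0.
  by move=> X x Y y hX hY; apply: leq_trans (leq_card_setU _ _) _; exact: leq_add.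
apply: subset_leq_card; apply/fintype.subsetP => E; rewrite finset.inE => /andP[EP /asboolPn nn'].
rewrite !finset.in_setU.
have [E1|n1] := boolP (E \in S1); first by [].
have [E2|n2'] := boolP (E \in S2); first by [].
have [E3|n3] := boolP (E \in S3); first by [].
have g1 : t * n%:R <= #|isolated E|%:R by move: n1; rewrite finset.inE EP /= negbK => /asboolP.
have g2 : #|largest_comp E|%:R <= h * n%:R by move: n2'; rewrite finset.inE EP /= negbK => /asboolP.
have g3 : (maxn k1 (maxn k0 2) <= #|largest_comp E|)%N by move: n3; rewrite finset.inE EP /= negbK => /asboolP.
have okE : ok #|largest_comp E|.
  by move: g3; rewrite !geq_max => /and3P[q1 q2 q3]; rewrite /ok q1 q2 q3 /=; exact: g2.
have kn : (#|largest_comp E| < n.+1)%N by rewrite ltnS -[n in (_ <= n)%N]card_ord max_card.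
apply/bigcupP; exists (Ordinal kn) => //.
rewrite finset.inE eqxx graph_class_planar finset.inE EP /=; apply/andP; split.
  rewrite -(ler_nat R) natrD natrM; apply: le_trans g1.
  have := jle _ okE; have : h * d * n%:R <= t / 8 * n%:R.
    apply: ler_wpM2r => //; have := h3; rewrite -ler_pdivlMr// => /le_trans; apply.
    by rewrite invfM mulrA.
  by move=> ? ?; lra.
by apply/negP => ns; exact: nn'.
Unshelve. all: by end_near.
Qed.

End NiceSpanningTree.

(** * Skeleton structures *)

Section SkeletonMass.
Variable R : realType.
Local Notation gw := (gw_weight (1 : R)).
Local Notation fw := (forest_weight R).

Lemma mulr_lower (a b x y e : R) : 0 <= a -> 0 <= b -> 0 <= x -> 0 <= y -> 0 < e ->
  a - e / (2 * (b + 1)) <= x -> b - e / (2 * (a + 1)) <= y -> a * b - e <= x * y.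
Proof.
move=> a0 b0 x0 y0 e0; set e1 := e / _; set e2 := e / _ => hx hy.
have h1 : e1 * (b + 1) = e / 2 by rewrite /e1; field; lra.
have h2 : e2 * (a + 1) = e / 2 by rewrite /e2; field; lra.
have e10 : 0 <= e1 by rewrite /e1 divr_ge0 ?(ltW e0)//; lra.
have e20 : 0 <= e2 by rewrite /e2 divr_ge0 ?(ltW e0)//; lra.
clearbody e1 e2; have xy : 0 <= x * y by rewrite mulr_ge0.
have [ha|ha] := leP a e1; first by have := ler_wpM2r b0 ha; lra.
have [hb|hb] := leP b e2; first by have := ler_wpM2l a0 hb; lra.
have ha' : 0 <= a - e1 by lra.
have hb' : 0 <= b - e2 by lra.
have := ler_pM ha' hb' hx hy; have := mulr_ge0 e10 e20; lra.
Qed.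

Lemma forest_weight_cons l A As : fw l (A :: As) = gw l A * fw l.-1 As.
Proof.
rewrite /forest_weight big_ord_recl /= subn0; congr (_ * _); apply: eq_bigr => i _.
by have -> : (l.-1 - i = l - i.+1)%N by lia.
Qed.

Lemma forest_weight_ge0 l As : 0 <= fw l As.
Proof. by apply: prodr_ge0 => i _; exact: gw_weight_ge0. Qed.

Lemma sum_forest_weight_cons l (F : seq {fset (seq nat)}) (G : seq forest) :
  \sum_(B <- [seq A :: Bs | A <- F, Bs <- G]) fw l B =
  (\sum_(A <- F) gw l A) * (\sum_(Bs <- G) fw l.-1 Bs).
Proof.
rewrite big_allpairs_dep big_distrlr /=; apply: eq_bigr => A _; apply: eq_bigr => Bs _.
exact: forest_weight_cons.
Qed.

Lemma uniq_cons_pairs (F : seq {fset (seq nat)}) (G : seq forest) :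
  uniq F -> uniq G -> uniq [seq A :: Bs | A <- F, Bs <- G].
Proof. by move=> uF uG; apply: allpairs_uniq => // -[A As] [B Bs] _ _ [-> ->]. Qed.

Definition skeleton_forest l (B : forest) := size B = l.+1 /\
  forall i, (i <= l)%N -> good_tree (l - i) (nth fset0 B i).

Lemma skeleton_forest_valid l B : skeleton_forest l B -> valid_forest l B.
Proof. by move=> [sz h]; split=> [||i]; rewrite sz//; exact: h. Qed.

Lemma skeleton_forest_cons l A B : good_tree l.+1 A -> skeleton_forest l B ->
  skeleton_forest l.+1 (A :: B).
Proof. by move=> gA [sz h]; split=> [|[|i] il] /=; rewrite ?sz//; exact: h. Qed.

Lemma skeleton_forest0 : skeleton_forest 0 [:: [fset [::]]%fset].
Proof. by split=> // -[|]//= _; exact: good_root. Qed.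

Lemma forest_weight0 : fw 0 [:: [fset [::]]%fset] = 1.
Proof. by rewrite forest_weight_cons /forest_weight big_ord0 mulr1; exact: gw_weight0. Qed.

Lemma forest_mass l e : 0 < e -> exists G : seq forest,
  [/\ uniq G, forall B, B \in G -> skeleton_forest l B & 1 - e <= \sum_(B <- G) fw l B].
Proof.
elim: l e => [|l IH] e e0.
  exists [:: [:: [fset [::]]%fset]]; split=> // [B|]; last first.
    by rewrite big_seq1 forest_weight0; lra.
  by rewrite inE => /eqP->; exact: skeleton_forest0.
have e40 : 0 < e / (2 * (1 + 1)) by rewrite divr_gt0 ?mulr_gt0 ?addr_gt0.
have [G [uG gG mG]] := IH _ e40.
have s01 : 0 <= (1 : R) <= 1 by rewrite ler01 lexx.
have [F [uF gF mF]] := gw_generating l.+1 s01 e40.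
exists [seq A :: Bs | A <- F, Bs <- G]; split.
- exact: uniq_cons_pairs.
- by move=> _ /allpairsP[[A B] /= [/gF gA /gG gB ->]]; exact: skeleton_forest_cons.
rewrite sum_forest_weight_cons /= -[1 in X in X <= _]mulr1; apply: mulr_lower => //.
- by apply: sumr_ge0 => A _; exact: gw_weight_ge0.
- by apply: sumr_ge0 => B _; exact: forest_weight_ge0.
move: mF; rewrite iter_generating1 => /le_trans; apply.
by apply: ler_sum => A _; rewrite expr1n mulr1.
Qed.

(** Every tree gains one generation, and a new last spine vertex with the one-vertex tree of weight
    1 is appended. *)
Lemma forest_extension (As : forest) e :
  (forall i, (i < size As)%N -> good_tree (size As - i.+1) (nth fset0 As i)) -> 0 < e ->
  exists G : seq forest, [/\ uniq G,
    forall B, B \in G -> skeleton_forest (size As) B /\ forall i v, (i < size As)%N ->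
      (v \in nth fset0 B i) && (size v <= size As - i.+1)%N = (v \in nth fset0 As i) &
    fw (size As).-1 As - e <= \sum_(B <- G) fw (size As) B].
Proof.
elim: As e => [|A As IH] e gAs e0.
  exists [:: [:: [fset [::]]%fset]]; split=> // [B|].
    by rewrite inE => /eqP->; split=> //; exact: skeleton_forest0.
  by rewrite big_seq1 forest_weight0 /forest_weight big_ord0; lra.
have gA : good_tree (size As) A by have := gAs 0%N isT; rewrite /= subn1.
have gAs' i : (i < size As)%N -> good_tree (size As - i.+1) (nth fset0 As i) by move=> h; exact: (gAs i.+1 h).
pose a := gw (size As) A; pose b := fw (size As).-1 As.
have a0 : 0 <= a by exact: gw_weight_ge0.
have b0 : 0 <= b by exact: forest_weight_ge0.
have ea : 0 < e / (2 * (b + 1)) by rewrite divr_gt0//; lra.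
have eb : 0 < e / (2 * (a + 1)) by rewrite divr_gt0//; lra.
have [G [uG gG mG]] := IH _ gAs' eb; have [F [uF gF mF]] := gw_extension_mass gA ea.
exists [seq A' :: Bs | A' <- F, Bs <- G]; split.
- exact: uniq_cons_pairs.
- move=> _ /allpairsP[[A' B] /= [/gF[gA' tA'] /gG[gB tB] ->]]; split; first exact: skeleton_forest_cons.
  by case=> [|i] v il /=; [rewrite subn1 /= tA'|exact: tB].
rewrite sum_forest_weight_cons forest_weight_cons /=; apply: mulr_lower => //.
- by apply: sumr_ge0 => A' _; exact: gw_weight_ge0.
- by apply: sumr_ge0 => B _; exact: forest_weight_ge0.
Qed.

(** Quantifying over the proofs [vB] and [full] makes a predicate on all of [G] at once; the choice
    is immaterial by proof irrelevance. *)
Definition nice_map (L : nat) (G : seq forest) (e : R) (V : finType) (rk : V -> nat)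
    (f : {ffun V -> V}) : bool :=
  `[< forall B, B \in G -> forall (vB : valid_forest L B) (full : size B = L.+1),
      (fw L B - e) * #|V|%:R <= #|map_roots vB full rk f|%:R >].

Lemma nice_map_tail L (G : seq forest) e : (forall B, B \in G -> skeleton_forest L B) -> 0 < e ->
  exists2 c : R, 0 < c & exists k0, forall (V : finType) (rk : V -> nat), injective rk ->
    (k0 <= #|V|)%N -> #|[set f | ~~ nice_map L G e rk f]%SET|%:R <=
      (size G)%:R * expR (- c * #|V|%:R) * (#|V| ^ #|V|)%:R.
Proof.
move=> gG e0; elim: G gG => [|B G IH] gG.
  exists 1 => //; exists 0%N => V rk _ _.
  rewrite (_ : [set f | _]%SET = finset.set0) ?cards0 ?mulr_ge0 ?expR_ge0//.
  by apply/setP => f; rewrite !finset.inE; apply/negbTE; rewrite negbK; apply/asboolP.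
have [|c1 c10 [k1 H1]] := IH; first by move=> C CG; apply: gG; rewrite inE CG orbT.
have gB : skeleton_forest L B by apply: gG; rewrite inE eqxx.
have vB := skeleton_forest_valid gB; have [full _] := gB.
have [c2 c20 [k2 H2]] := tail_B vB full e0.
exists (Num.min c1 c2); first by rewrite lt_min c10.
exists (maxn k1 k2) => V rk rki; rewrite geq_max => /andP[kk1 kk2].
have {}H1 := H1 V rk rki kk1; have {}H2 := H2 V rk rki kk2.
have m1 : expR (- c1 * #|V|%:R) <= expR (- Num.min c1 c2 * #|V|%:R).
  by rewrite ler_expR ler_wpM2r// lerN2 ge_min lexx.
have m2 : expR (- c2 * #|V|%:R) <= expR (- Num.min c1 c2 * #|V|%:R).
  by rewrite ler_expR ler_wpM2r// lerN2 ge_min lexx orbT.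
rewrite card_ffun in H2.
apply: (@le_trans _ _ (#|[set f | ~~ nice_map L G e rk f]%SET|%:R +
    #|[set f | #|map_roots vB full rk f|%:R < (fw L B - e) * #|V|%:R]%SET|%:R)).
  rewrite -natrD ler_nat; apply: leq_trans (leq_card_setU _ _).
  apply: subset_leq_card; apply/fintype.subsetP => f; rewrite !finset.inE => /asboolPn nf.
  have [/asboolP h1|//] := boolP (nice_map L G e rk f); rewrite orFb ltNge; apply/negP => h2.
  apply: nf => C; rewrite inE => /orP[/eqP->|CG] vC fC; last exact: h1.
  by rewrite (Prop_irrelevance vC vB) (Prop_irrelevance fC full).
apply: (le_trans (lerD H1 H2)); rewrite -mulrDl; apply: ler_wpM2r => //=.
rewrite -natr1 mulrDl mul1r; apply: lerD => //; exact: ler_wpM2l.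
Qed.

End SkeletonMass.

Section SkeletonStructures.
Variables (n : nat) (E : {set {set 'I_n}}) (V : {set 'I_n}).
Local Notation U := {x | x \in V}.
Variables (f : {ffun U -> U}) (Y : {set {set 'I_n}}).
Hypothesis adjE : forall u w : U, (forall e, e \in Y -> val u \notin e) ->
  adj E (val u) (val w) = map_rel f u w.
Local Notation rk := (fun x : U => nat_of_ord (val x)).

Let rk_inj : injective rk. Proof. by move=> x y /ord_inj/val_inj. Qed.

(** The interior of the copy avoids the excess edges [Y], so there the neighbours in the graph and
    in the spanning tree agree. *)
Definition skeleton_structure L B (v : 'I_n) :=
  exists (vB : valid_forest L B) (full : size B = L.+1) (phi : {ffun nodes B -> U}),
    [/\ phi \in embeddings vB rk, map_sees vB full phi f, val (phi (rootD vB)) = v &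
        forall d, (depD d < L)%N -> forall e, e \in Y -> val (phi d) \notin e].

Lemma skeleton_structure_mem L B v : skeleton_structure L B v -> v \in V.
Proof. by move=> [vB [full [phi [_ _ <- _]]]]; exact: valP. Qed.

Lemma skeleton_structure_uniq L B B' v :
  skeleton_structure L B v -> skeleton_structure L B' v -> B = B'.
Proof.
move=> [vB [full [phi [inc see rv _]]]] [vB' [full' [phi' [inc' see' rv' _]]]].
have r12 : extend vB phi root_node = extend vB' phi' root_node.
  by rewrite (extend_val vB phi (rootD vB)) (extend_val vB' phi' (rootD vB')); apply: val_inj; rewrite rv rv'.
by have [] := explored_uniq rk_inj vB vB' (etrans full (esym full'))
  (map_sees_explored rk_inj inc see) (map_sees_explored rk_inj inc' see') r12.
Qed.

Lemma skeleton_structure_ball l As B v (VH : finType) (eH : rel VH) rH :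
  (forall q : node, (q \in nodes B) && (q.1 + size q.2 <= l)%N = (q.1 <= l)%N && (q.2 \in nth fset0 As q.1)) ->
  skeleton_structure l.+1 B v -> ball_iso E V v l eH rH <-> skel_iso l As eH rH.
Proof.
move=> trunc [vB [full [phi [inc see <- clean]]]].
have phi_inj := embeddings_inj inc.
have [_ ex] := map_sees_exact phi_inj see.
have ex' : exact (parD vB) (@depD B) l.+1 (adj_in E V) (fun d => val (phi d)).
  split=> [x y /val_inj/phi_inj//|x z dx]; rewrite /adj_in (valP (phi x)) /=.
  have [zV|zV] /= := boolP (z \in V); last first.
    apply/esym/existsP => -[y /andP[/eqP zy _]]; case/negP: zV; rewrite zy; exact: valP.
  have -> : z = val (exist _ z zV : U) by [].
  rewrite adjE; last exact: clean.
  by rewrite ex//; apply: eq_existsb => y; rewrite (inj_eq val_inj).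
rewrite (ball_iso_exact (depD_root vB) (parD_root vB) (@depD_par _ _ vB) ex')//; last exact: valP.
by rewrite -/(pattern_iso l eH rH vB); exact: pattern_skel_iso.
Qed.

(** A copy is lost only if an interior vertex lies on one of the at most [#|Y| * 2] ends of excess
    edges, and few roots are near any given vertex. *)
Lemma card_skeleton_structures L B (vB : valid_forest L B) (full : size B = L.+1) :
  (forall e, e \in Y -> (#|e| <= 2)%N) ->
  (#|map_roots vB full rk f| <= #|[set v | `[< skeleton_structure L B v >]]%SET| +
    #|Y| * 2 * (\sum_(d < L) #|{: nodes B}| ^ d))%N.
Proof.
move=> Y2; pose Z := [set u : U | [exists e in Y, val u \in e]].
have cZ : (#|Z| <= #|Y| * 2)%N.
  apply: (@leq_trans (\sum_(e in Y) #|[set u : U | val u \in e]|)%N).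
    apply: (@leq_trans #|\bigcup_(e in Y) [set u : U | val u \in e]|%SET).
      apply: subset_leq_card; apply/fintype.subsetP => u; rewrite finset.inE => /exists_inP[e eY ue].
      by apply/bigcupP; exists e => //; rewrite finset.inE.
    apply: (big_ind2 (fun (X : {set U}) x => (#|X| <= x)%N)) => //; first by rewrite cards0.
    by move=> X x X' x' hX hX'; apply: leq_trans (leq_card_setU _ _) _; exact: leq_add.
  rewrite -sum_nat_const; apply: leq_sum => e eY; apply: leq_trans (Y2 e eY).
  rewrite -(card_imset _ val_inj); apply: subset_leq_card; apply/fintype.subsetP => x.
  by case/imsetP => u; rewrite finset.inE => ue ->.
pose N z := near_ball (map_rel f) #|{: nodes B}| L z.
apply: (@leq_trans #|[set v | `[< skeleton_structure L B v >]]%SET :|: [set val u | u in (\bigcup_(z in Z) N z)%SET]%SET|%SET).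
  apply: (@card_leq_inj _ _ val); first by move=> x y _ _; exact: val_inj.
  move=> u; rewrite finset.inE => /exists_inP[phi inc /andP[/eqP ru see]].
  rewrite finset.in_setU; have [clean|dirty] := boolP [forall d, (depD d < L)%N ==> (phi d \notin Z)].
    apply/orP; left; rewrite finset.inE; apply/asboolP; exists vB, full, phi; split=> //.
      by rewrite ru.
    move=> d dL e eY; have /forallP/(_ d) := clean; rewrite dL /=.
    by apply: contra => h; rewrite finset.inE; apply/exists_inP; exists e.
  apply/orP; right; apply: imset_f; move: dirty; rewrite negb_forall => /existsP[d].
  rewrite negb_imply negbK => /andP[dL dZ]; apply/bigcupP; exists (phi d) => //.
  have ex := map_sees_exact (embeddings_inj inc) see.
  by rewrite -ru; exact: (exact_near (depD_root vB) (@depD_par _ _ vB) ex dL).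
apply: leq_trans (leq_card_setU _ _) _; rewrite leq_add2l.
apply: leq_trans (leq_imset_card _ _) _.
apply: (@leq_trans (\sum_(z in Z) #|N z|)%N).
  apply: (big_ind2 (fun (X : {set U}) x => (#|X| <= x)%N)) => //; first by rewrite cards0.
  by move=> X x X' x' hX hX'; apply: leq_trans (leq_card_setU _ _) _; exact: leq_add.
apply: (@leq_trans (#|Z| * (\sum_(d < L) #|{: nodes B}| ^ d))%N); last by rewrite leq_mul2r cZ orbT.
by rewrite -sum_nat_const; apply: leq_sum => z _; exact: card_near_ball.
Qed.

End SkeletonStructures.

(** * Local limits *)

Section SkeletonLimit.
Variables (R : realType) (m : nat -> nat).
Hypothesis mcv : ((fun n => (m n)%:R / n%:R : R) @ \oo --> (2^-1 : R))%classic.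
Local Notation fw := (forest_weight R).

Lemma spanning_tree_adj n (E : {set {set 'I_n}}) (V : {set 'I_n})
    (f : {ffun {x | x \in V} -> {x | x \in V}}) (u w : {x | x \in V}) :
  wf_graph E -> tree_edges val f \subset E ->
  (forall e, e \in (inner V E :\: tree_edges val f)%SET -> val u \notin e) ->
  adj E (val u) (val w) = map_rel f u w.
Proof.
move=> wE TE clean; apply/idP/idP => [uw|/andP[uw h]].
  have uwT : [set val u; val w]%SET \in tree_edges val f.
    have uwV : ([set val u; val w] \subset V)%SET.
      by apply/fintype.subsetP => x; rewrite !finset.inE => /orP[/eqP->|/eqP->]; exact: valP.
    apply/negPn/negP => nT; have := clean [set val u; val w]%SET.
    by rewrite !finset.inE nT uwV eqxx; move: uw; rewrite /adj => -> /(_ isT).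
  apply/andP; split; first by have := wf_adj_neq wE uw; rewrite (inj_eq val_inj).
  move/tree_edgesP: uwT => [x fx /eq_set2[[/val_inj-> /val_inj->]|[/val_inj-> /val_inj->]]].
    by rewrite eqxx.
  by rewrite eqxx orbT.
have edge (x : {x | x \in V}) : f x != x -> adj E (val x) (val (f x)).
  by move=> fx; apply: (fintype.subsetP TE); apply/tree_edgesP; exists x.
case/orP: h => /eqP e; first by rewrite -e; apply: edge; rewrite e eq_sym.
by rewrite adj_sym -e; apply: edge; rewrite e.
Qed.

Lemma emp_skeleton_cvg l (VH : finType) (eH : rel VH) rH :
  ((fun n => (emp_prob R (m n) (@largest_comp n) l eH rH)%:E) @ \oo -->
    skel_ball_prob R l eH rH)%classic.
Proof.
have -> : skel_ball_prob R l eH rH =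
    (\esum_(As in [set As | skeleton_forest l As /\ skel_iso l As eH rH]) (fw l As)%:E)%classic.
  rewrite /skel_ball_prob (_ : [set As | _]%classic =
      [set As | skeleton_forest l As /\ skel_iso l As eH rH]%classic).
    by apply: eq_esum => As [[sz _] _]; rewrite /forest_weight sz.
  by apply/seteqP; split=> As /=; [case|case=> -[]].
apply: emp_prob_cvg => [|As|e e0|F uF gF e e0].
- exact: planar_graphs_gt0.
- exact: forest_weight_ge0.
- exact: forest_mass.
have e40 : 0 < e / 4 by lra.
have /choice[ext extP] : forall As, exists G : seq forest, As \in F ->
    [/\ uniq G, forall B, B \in G -> skeleton_forest l.+1 B /\ forall i v, (i < l.+1)%N ->
        (v \in nth fset0 B i) && (size v <= l.+1 - i.+1)%N = (v \in nth fset0 As i) &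
      fw l As - e / 4 <= \sum_(B <- G) fw l.+1 B].
  move=> As; have [AF|_] := boolP (As \in F); last by exists [::].
  have [sz gAs] := gF As AF.
  have [|G [uG gG mG]] := @forest_extension R As (e / 4) _ e40.
    by move=> i; rewrite sz ltnS subSS; exact: gAs.
  by exists G => _; rewrite sz in gG mG.
pose G := flatten [seq ext As | As <- F].
have gG B : B \in G -> skeleton_forest l.+1 B.
  by case/flatten_mapP => As AF BA; have [_ /(_ B BA)[]] := extP As AF.
pose N := (\max_(As <- F) size (ext As))%N.
pose M := (\max_(B <- G) \sum_(d < l.+1) #|{: nodes B}| ^ d)%N.
(* [d] is chosen so that at most [d * k] excess edges spoil at most [t * k] roots. Together with the
   tolerance [t] of [nice] each class loses [2 * t], and [t * N.+1 = e / 8] keeps the loss over all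
   extensions of one tree below [e / 2]. *)
pose t := e / 8 / N.+1%:R; pose d := t / (2 * M.+1%:R).
have N0 : 0 < N.+1%:R :> R by rewrite ltr0n.
have M0 : 0 < M.+1%:R :> R by rewrite ltr0n.
have t0 : 0 < t by rewrite /t !divr_gt0.
have d0 : 0 < d by rewrite /d divr_gt0// mulr_gt0.
have dM : d * (2 * M.+1%:R) = t by rewrite /d divfK// gt_eqF// mulr_gt0.
have tN : t * N.+1%:R = e / 8 by rewrite /t divfK// gt_eqF.
clearbody t d.
have [c c0 [k0 tail]] := nice_map_tail gG t0.
pose rk n (V : {set 'I_n}) (x : {x | x \in V}) := nat_of_ord (val x).
pose nice n (V : {set 'I_n}) : pred {ffun {x | x \in V} -> {x | x \in V}} :=
  fun f => nice_map l.+1 G t (@rk n V) f.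
have tail' n (V : {set 'I_n}) : (k0 <= #|V|)%N ->
    #|[set f | ~~ @nice n V f]%SET|%:R <= (size G)%:R * expR (- c * #|V|%:R) * (#|V| ^ #|V|)%:R.
  move=> kV; have cV : #|{: {x | x \in V}}| = #|V| by rewrite card_sig.
  have rki : injective (@rk n V) by move=> x y /ord_inj/val_inj.
  by have := tail _ (@rk n V) rki; rewrite cV => /(_ kV).
have wn := whp_nice_spanning mcv c0 (ler0n R (size G)) d0 tail'.
apply: (whp_sub (whp_and (whp_largest_big mcv 1) wn)); apply: nearW => n E /planar_graphsP[wE _ _] [L1 ns].
split=> //; move: ns => /existsP[f /existsP[r /and4P[tf TE hj /asboolP nf]]].
set V := largest_comp E in f r tf TE hj nf *.
have cU : #|{: {x | x \in V}}| = #|V| by rewrite card_sig.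
pose Y := (inner V E :\: tree_edges val f)%SET.
have Y2 e' : e' \in Y -> (#|e'| <= 2)%N.
  rewrite !finset.inE => /andP[_ /andP[eE _]].
  by move: wE => /forall_inP/(_ _ eE)/eqP->.
have cY : #|Y|%:R <= d * #|V|%:R.
  have TI : tree_edges val f \subset inner V E.
    apply/fintype.subsetP => e' eT; rewrite finset.inE (fintype.subsetP TE)//=.
    exact: tree_edges_inner eT.
  have : (#|Y| <= Num.truncn (d * #|V|%:R))%N.
    rewrite /Y cardsD (finset.setIidPr TI) (card_tree_edges val_inj tf) cU.
    by rewrite leq_subLR -ltnS -addnS.
  rewrite -(ler_nat R) => /le_trans; apply.
  by have /andP[] := truncn_itv (mulr_ge0 (ltW d0) (ler0n R #|V|)).
have adjE u w : (forall e', e' \in Y -> val u \notin e') -> adj E (val u) (val w) = map_rel f u w.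
  exact: spanning_tree_adj.
clearbody Y.
pose S B := [set v | `[< skeleton_structure f Y l.+1 B v >]]%SET.
have cS B : B \in G -> (fw l.+1 B - 2 * t) * #|V|%:R <= #|S B|%:R.
  move=> BG; have gB := gG B BG; have vB := skeleton_forest_valid gB; have [full _] := gB.
  have := nf B BG vB full; rewrite cU => h1.
  have := card_skeleton_structures f vB full Y2; rewrite -(ler_nat R) natrD !natrM => h2.
  have h3 : (\sum_(d < l.+1) #|{: nodes B}| ^ d)%:R <= M.+1%:R :> R.
    rewrite ler_nat ltnW// ltnS.
    exact: (leq_bigmax_seq (F := fun B : forest => (\sum_(d < l.+1) #|{: nodes B}| ^ d)%N)).
  have h4 : #|Y|%:R * 2 * (\sum_(d < l.+1) #|{: nodes B}| ^ d)%:R <= t * #|V|%:R :> R.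
    apply: (@le_trans _ _ (d * #|V|%:R * 2 * M.+1%:R)); last by rewrite -dM; apply: eq_imp_le; ring.
    by apply: ler_pM => //; rewrite ?mulr_ge0//; apply: ler_wpM2r.
  have h5 := le_trans h1 h2.
  rewrite mulrBl -mulrA; rewrite mulrBl in h5.
  move: h4 h5; rewrite -/(S B).
  move: (_ * 2 * _) (fw _ _ * _) (t * _) (#|S B|%:R) => a1 a2 a3 a4 h4 h5; lra.
exists (fun As => [set v | `[< exists2 B, B \in ext As & skeleton_structure f Y l.+1 B v >]]%SET); split.
- move=> As AF; have [uA gA mA] := extP As AF.
  have e20 : 0 <= e / 2 by lra.
  apply: (@le_trans _ _ ((\sum_(B <- ext As) fw l.+1 B - e / 2) * #|V|%:R)).
    by apply: ler_wpM2r => //; lra.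
  apply: (card_disjoint_classes (V := S)) => //.
  + move=> B BA; apply: le_trans (cS B _); last by apply/flatten_mapP; exists As.
    apply: ler_wpM2r => //; apply: lerB => //.
    rewrite ler_pdivlMr ?ltr0n//.
    have sN : (size (ext As)).+1%:R <= N.+1%:R :> R.
      by rewrite ler_nat ltnS; exact: (leq_bigmax_seq (F := fun As => size (ext As))).
    have := ler_wpM2l (ltW t0) sN; rewrite tN => ?; lra.
  + move=> B B' v _ _; rewrite !finset.inE => /asboolP sB /asboolP sB'.
    exact: skeleton_structure_uniq sB sB'.
  + by move=> B v BA; rewrite !finset.inE => /asboolP sB; apply/asboolP; exists B.
- move=> As As' v AF AF'; rewrite !finset.inE => /asboolP[B BA sB] /asboolP[B' BA' sB'].
  have e' := skeleton_structure_uniq sB sB'; subst B'.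
  have [_ /(_ _ BA)[_ tA] _] := extP As AF; have [_ /(_ _ BA')[_ tA'] _] := extP As' AF'.
  have [sz _] := gF As AF; have [sz' _] := gF As' AF'.
  apply: (eq_from_nth (x0 := fset0)); rewrite sz ?sz'// => i il.
  by apply/fsetP => v'; rewrite -(tA _ _ il) -(tA' _ _ il).
- by move=> As v _; rewrite finset.inE => /asboolP[B _ /skeleton_structure_mem].
move=> As v AF; rewrite finset.inE => /asboolP[B BA sB].
have [_ /(_ _ BA)[[szB gB] tB] _] := extP As AF.
apply: (@skeleton_structure_ball n E V f Y adjE l As B v VH eH rH _ sB) => -[i u]; rewrite in_nodes szB /=.
have [il|il] := leqP i l; last by rewrite [(_ <= l)%N]leqNgt (leq_trans il (leq_addr _ _)) andbF.
have -> : (i < l.+2)%N by rewrite ltnS; exact: leq_trans il (leqnSn l).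
by rewrite -(tB i u) ?ltnS// subSS leq_subRL.
Qed.

End SkeletonLimit.

Local Open Scope classical_set_scope.
Local Open Scope ring_scope.

Theorem theorem1p4 (R : realType) (m : nat -> nat) :
  let s := fun n : nat => (m n)%:R - n%:R / 2 : R in
  (forall n, 0 < s n) ->
  (fun n => s n / n%:R) @ \oo --> (0 : R) ->
  (fun n => s n ^+ 3 / n%:R ^+ 2) @ \oo --> +oo ->
  forall (VH : finType) (eH : rel VH) (rH : VH),
    symmetric eH -> irreflexive eH ->
  forall l : nat,
  [/\ (fun n => (@emp_prob R n (m n) (@largest_comp n) l VH eH rH)%:E) @ \oo
        --> skel_ball_prob R l eH rH,
      (fun n => (@emp_prob R n (m n) (@small_comps n) l VH eH rH)%:E) @ \oo
        --> gw_ball_prob (1 : R) l eH rH &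
      (fun n => (@emp_prob R n (m n) (fun _ => [set: 'I_n]%SET) l VH eH rH)%:E) @ \oo
        --> gw_ball_prob (1 : R) l eH rH].
Proof.
move=> s _ scv _ VH eH rH _ _ l.
have mcv : (fun n => (m n)%:R / n%:R : R) @ \oo --> (2^-1 : R).
  have h : (fun n => s n / n%:R + 2^-1) @ \oo --> (0 + 2^-1 : R).
    by apply: cvgD => //; exact: cvg_cst.
  rewrite add0r in h; apply: cvg_trans h; apply: near_eq_cvg; near=> n; rewrite /s /=.
  have n0 : n%:R != 0 :> R by rewrite pnatr_eq0 -lt0n; near: n; exact: nbhs_infty_gt.
  by field.
split.
- exact: emp_skeleton_cvg.
- apply: (@emp_tree_cvg R m mcv (@small_comps)) => [n E x y|e e0]; first exact: small_comps_closed.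
  apply: (whp_sub (whp_largest_small mcv e0)); apply: nearW => n E _.
  by rewrite /small_comps finset.setCK.
- apply: (@emp_tree_cvg R m mcv (fun n _ => [set: 'I_n]%SET)) => [n E x y _ _|e e0].
    by rewrite finset.inE.
  apply: whp_true; apply: nearW => n E _; rewrite finset.setCT cards0.
  by rewrite mulr_ge0// ltW.
Unshelve. all: by end_near.
Qed.
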